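(* The system $\mathrm{RCA}_0^\omega+\mathrm{DIN}_{\mathrm{net}}$ proves $\mathrm{HBU}$. Here $\mathrm{DIN}_{\mathrm{net}}$ (Dini's theorem for nets) is the statement: for $D$ a directed subset of Baire space and continuous functions $f_d:(D\times[0,1])\to\mathbb{R}$ forming an increasing net and converging to a continuous $f:[0,1]\to\mathbb{R}$, the convergence is uniform. And $\mathrm{HBU}$ is the statement that for every $\Psi:\mathbb{R}\to\mathbb{R}^+$ there are finitely many $y_1,\dots,y_k\in[0,1]$ such that $(\forall x\in[0,1])(\exists i\le k)\big(x\in(y_i-\Psi(y_i),y_i+\Psi(y_i))\big)$.
   Context: Base theory. Finite types: $0$ (natural numbers) is a type, and if $\sigma,\tau$ are types then so is $\sigma\to\tau$ (mappings from type $\sigma$ to type $\tau$ objects); $1:=0\to0$ and $n+1:=n\to0$; a superscript on a variable is its type. $L_\omega$ is the language with variables and quantifiers of all finite types, constants $0,1,<_0,+_0,\times_0,=_0$ on $\mathbb{N}$, the combinators $\Pi,\Sigma$ and a recursor constant $\mathbf{R}_0$. Equality at higher types is defined extensionally: $x=_\tau y$ iff $xz_1\dots z_k=_0yz_1\dots z_k$ for all arguments. $\mathrm{QF\text{-}AC}^{\sigma,\tau}$ is the schema $(\forall x^\sigma)(\exists y^\tau)A(x,y)\to(\exists Y^{\sigma\to\tau})(\forall x^\sigma)A(x,Y(x))$ for quantifier-free $A$ of $L_\omega$ (parameters of any type allowed). $\mathrm{RCA}_0^\omega$ is the theory in $L_\omega$ with classical logic and the axioms: $\mathbb{N}$ is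 an ordered semi-ring; the defining axioms of $\Pi,\Sigma$ (giving $\lambda$-abstraction); $\mathbf{R}_0(f,m,0)=m$ and $\mathbf{R}_0(f,m,n+1)=f(n,\mathbf{R}_0(f,m,n))$; extensionality $x=_\rho y\to\varphi(x)=_\tau\varphi(y)$ for all types $\rho,\tau$ and $\varphi^{\rho\to\tau}$; induction for quantifier-free formulas of $L_\omega$; $\mathrm{QF\text{-}AC}^{1,0}$. Reals. A real is a sequence of rationals $(q_n)$ with $|q_n-q_{n+i}|<2^{-n}$ for all $n,i$ (a type 1 object); $(q_n)=_{\mathbb{R}}(r_n)$ iff $|q_n-r_n|\le2^{-n+1}$ for all $n$. A function $\mathbb{R}\to\mathbb{R}$ is a type $1\to1$ functional mapping equal reals to equal reals (similarly for functions on $[0,1]$); continuity is the usual epsilon-delta notion. Sets. A subset $D$ of Baire space $\mathbb{N}^{\mathbb{N}}$ is given by a characteristic function $F_D^2\le1$ ($f\in D$ means $F_D(f)=1$); a binary relation $\preceq$ on $D$ is likewise given by a characteristic function of type $(1\times1)\to0$. Via coding (and extensionality with respect to $=_{\mathbb{R}}$), subsets of $\mathbb{R}$ and sets of finite sequences of reals, and relations on them, are included. Nets. $(D,\preceq)$ with $D\neq\emptyset$ is directed if $\preceq$ is transitive and reflexive on $D$ and for all $x,y\in D$ there is $z\in D$ with $x\preceq z$ and $y\preceq z$. A net of functions is a map $f_d:(D\times[0,1])\to\mathbb{R}$ with $(D,\preceq)$ directed; all index sets are subsets of Baire space given by characteristic functions $F_D^2\le1$, with $\preceq$ given by a characteristic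 function of type $(1\times1)\to0$ (including, via coding, subsets of $\mathbb{R}$ and sets of finite sequences of reals); properties such as continuity concern the variable $x\in[0,1]$ of $f_d(x)$ for fixed $d$. It is increasing if $a\preceq b$ implies $f_a(x)\le_{\mathbb{R}}f_b(x)$ for all $x\in[0,1]$ and $a,b\in D$. It converges to $f$ if for every $x\in[0,1]$ and $\varepsilon>0$ there is $d_0\in D$ with $|f_e(x)-f(x)|<\varepsilon$ for all $e\succeq d_0$; the convergence is uniform if $d_0$ can be chosen independently of $x\in[0,1]$. *)

(* Defs.v *)
(* A deep embedding of the finite-type language L_omega, of classical
   derivability in it, and of the theory RCA_0^omega. *)
From Stdlib Require Import List.
Import ListNotations.

Set Implicit Arguments.
Unset Strict Implicit.
Unset Printing Implicit Defensive.

(** * The language L_omega *)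

Inductive ty : Type :=
| ty0 : ty
| Arr : ty -> ty -> ty.

Declare Scope ty_scope.
Delimit Scope ty_scope with ty.
Bind Scope ty_scope with ty.
Notation "s ⇒ t" := (Arr s t) (at level 60, right associativity) : ty_scope.
Local Open Scope ty_scope.

Notation ty1 := (ty0 ⇒ ty0).
Notation ty2 := ((ty0 ⇒ ty0) ⇒ ty0).

(* Intrinsically typed de Bruijn variables; a context lists the types of the
   free variables, the most recently bound one first. *)
Inductive var : list ty -> ty -> Type :=
| V0 : forall G s, var (s :: G) s
| VS : forall G s t, var G s -> var (t :: G) s.
Arguments V0 {G s}.
Arguments VS {G s t} v.

Inductive tm (G : list ty) : ty -> Type :=
| Var : forall s, var G s -> tm G s
| Zero : tm G ty0
| One : tm G ty0
| Plus : tm G (ty0 ⇒ ty0 ⇒ ty0)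
| Times : tm G (ty0 ⇒ ty0 ⇒ ty0)
| Pi : forall s t, tm G (s ⇒ t ⇒ s)
| Sigma : forall r s t, tm G ((r ⇒ s ⇒ t) ⇒ (r ⇒ s) ⇒ r ⇒ t)
| Rec : tm G ((ty0 ⇒ ty0 ⇒ ty0) ⇒ ty0 ⇒ ty0 ⇒ ty0)
| App : forall s t, tm G (s ⇒ t) -> tm G s -> tm G t.
Arguments Var {G s} v.
Arguments Zero {G}.
Arguments One {G}.
Arguments Plus {G}.
Arguments Times {G}.
Arguments Pi {G} s t.
Arguments Sigma {G} r s t.
Arguments Rec {G}.
Arguments App {G s t} f a.

(* Equality and order are primitive at type 0 only. *)
Inductive fm (G : list ty) : Type :=
| Eq0 : tm G ty0 -> tm G ty0 -> fm G
| Lt0 : tm G ty0 -> tm G ty0 -> fm G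
| Bot : fm G
| Imp : fm G -> fm G -> fm G
| And : fm G -> fm G -> fm G
| Or : fm G -> fm G -> fm G
| All : forall s, fm (s :: G) -> fm G
| Ex : forall s, fm (s :: G) -> fm G.
Arguments Eq0 {G} a b.
Arguments Lt0 {G} a b.
Arguments Bot {G}.
Arguments Imp {G} A B.
Arguments And {G} A B.
Arguments Or {G} A B.
Arguments All {G} s A.
Arguments Ex {G} s A.

Definition sentence : Type := fm [].

Fixpoint qf {G} (A : fm G) : Prop :=
  match A with
  | Eq0 _ _ | Lt0 _ _ | Bot => True
  | Imp A B | And A B | Or A B => qf A /\ qf B
  | All _ _ | Ex _ _ => False
  end.

(* Universal closure. *)
Fixpoint close {G} : fm G -> sentence :=
  match G with
  | [] => fun A => A
  | s :: G' => fun A => close (All s A)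
  end.

(** ** Renaming and substitution *)

Definition renaming (G D : list ty) : Type := forall s, var G s -> var D s.
Definition substitution (G D : list ty) : Type := forall s, var G s -> tm D s.

Definition scons {X : ty -> Type} {G s} (a : X s) (f : forall t, var G t -> X t)
    (t : ty) (v : var (s :: G) t) : X t :=
  match v in var D t return
    match D with
    | [] => unit
    | s :: G => X s -> (forall t, var G t -> X t) -> X t
    end
  with
  | V0 => fun a _ => a
  | VS w => fun _ f => f _ w
  end a f.

Fixpoint ren_tm {G D} (r : renaming G D) {s} (a : tm G s) : tm D s :=
  match a with
  | Var v => Var (r _ v)
  | Zero => Zero
  | One => One
  | Plus => Plus
  | Times => Times
  | Pi s t => Pi s t
  | Sigma r s t => Sigma r s t
  | Rec => Rec
  | App f a => App (ren_tm r f) (ren_tm r a)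
  end.

Fixpoint subst_tm {G D} (f : substitution G D) {s} (a : tm G s) : tm D s :=
  match a with
  | Var v => f _ v
  | Zero => Zero
  | One => One
  | Plus => Plus
  | Times => Times
  | Pi s t => Pi s t
  | Sigma r s t => Sigma r s t
  | Rec => Rec
  | App g a => App (subst_tm f g) (subst_tm f a)
  end.

Definition wk_tm {G s t} (a : tm G t) : tm (s :: G) t :=
  ren_tm (fun _ v => VS v) a.

Definition up {G D} (f : substitution G D) {s} : substitution (s :: G) (s :: D) :=
  scons (X := tm (s :: D)) (Var V0) (fun _ v => wk_tm (f _ v)).

Fixpoint subst {G D} (f : substitution G D) (A : fm G) : fm D :=
  match A with
  | Eq0 a b => Eq0 (subst_tm f a) (subst_tm f b)
  | Lt0 a b => Lt0 (subst_tm f a) (subst_tm f b)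
  | Bot => Bot
  | Imp A B => Imp (subst f A) (subst f B)
  | And A B => And (subst f A) (subst f B)
  | Or A B => Or (subst f A) (subst f B)
  | All s A => All s (subst (up f) A)
  | Ex s A => Ex s (subst (up f) A)
  end.

Definition wk {G s} (A : fm G) : fm (s :: G) := subst (fun _ v => Var (VS v)) A.

Definition inst {G s} (A : fm (s :: G)) (a : tm G s) : fm G :=
  subst (scons (X := tm G) a (fun _ v => Var v)) A.

(** ** Provability: classical natural deduction with equality at type 0 *)

Inductive nd : forall G, list (fm G) -> fm G -> Prop :=
| nd_hyp : forall G (H : list (fm G)) A, In A H -> nd H A
| nd_raa : forall G (H : list (fm G)) A, nd (Imp A Bot :: H) Bot -> nd H A
| nd_impI : forall G (H : list (fm G)) A B, nd (A :: H) B -> nd H (Imp A B)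
| nd_impE : forall G (H : list (fm G)) A B, nd H (Imp A B) -> nd H A -> nd H B
| nd_andI : forall G (H : list (fm G)) A B, nd H A -> nd H B -> nd H (And A B)
| nd_andE1 : forall G (H : list (fm G)) A B, nd H (And A B) -> nd H A
| nd_andE2 : forall G (H : list (fm G)) A B, nd H (And A B) -> nd H B
| nd_orI1 : forall G (H : list (fm G)) A B, nd H A -> nd H (Or A B)
| nd_orI2 : forall G (H : list (fm G)) A B, nd H B -> nd H (Or A B)
| nd_orE : forall G (H : list (fm G)) A B C,
    nd H (Or A B) -> nd (A :: H) C -> nd (B :: H) C -> nd H C
| nd_allI : forall G (H : list (fm G)) s (A : fm (s :: G)),
    nd (map wk H) A -> nd H (All s A)
| nd_allE : forall G (H : list (fm G)) s (A : fm (s :: G)) a,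
    nd H (All s A) -> nd H (inst A a)
| nd_exI : forall G (H : list (fm G)) s (A : fm (s :: G)) a,
    nd H (inst A a) -> nd H (Ex s A)
| nd_exE : forall G (H : list (fm G)) s (A : fm (s :: G)) C,
    nd H (Ex s A) -> nd (A :: map wk H) (wk C) -> nd H C
| nd_eq_refl : forall G (H : list (fm G)) a, nd H (Eq0 a a)
| nd_eq_subst : forall G (H : list (fm G)) (A : fm (ty0 :: G)) a b,
    nd H (Eq0 a b) -> nd H (inst A a) -> nd H (inst A b).

Definition proves (T : sentence -> Prop) (A : sentence) : Prop :=
  exists H : list sentence, (forall B, In B H -> T B) /\ nd H A.

(** ** Named binders

    [Ext G D] holds when [D] extends [G] by further bound variables; [↑ a]
    weakens [a] from its own context to the one at hand.  There is at most one
    way to view [G] as a suffix of [D], so the weakening is unambiguous. *)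

Class Ext (G D : list ty) : Type := ext : renaming G D.
#[global] Hint Mode Ext + + : typeclass_instances.
#[global] Instance Ext_refl G : Ext G G | 0 := fun _ v => v.
#[global] Instance Ext_step G D s (E : Ext G D) : Ext G (s :: D) | 1 :=
  fun t v => VS (ext v).

Definition lift {G D} {E : Ext G D} {s} (a : tm G s) : tm D s := ren_tm ext a.

Definition all_ {G} s (A : tm (s :: G) s -> fm (s :: G)) : fm G := All s (A (Var V0)).
Definition ex_ {G} s (A : tm (s :: G) s -> fm (s :: G)) : fm G := Ex s (A (Var V0)).
Arguments all_ {G} s & A.
Arguments ex_ {G} s & A.

Declare Scope tm_scope.
Delimit Scope tm_scope with tm.
Bind Scope tm_scope with tm.
Declare Scope fm_scope.
Delimit Scope fm_scope with fm.
Bind Scope fm_scope with fm.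

Notation "↑ a" := (lift a) (at level 8, a at level 8) : tm_scope.
Notation "f · a" := (App f a) (at level 38, left associativity) : tm_scope.
Notation "0" := Zero : tm_scope.
Notation "1" := One : tm_scope.
Notation "a + b" := (App (App Plus a) b) : tm_scope.
Notation "a * b" := (App (App Times a) b) : tm_scope.

Definition leq {G} (a b : tm G ty0) : fm G := Or (Lt0 a b) (Eq0 a b).

Notation "a ≡ b" := (Eq0 a%tm b%tm) (at level 70) : fm_scope.
Notation "a < b" := (Lt0 a%tm b%tm) : fm_scope.
Notation "a <= b" := (leq a%tm b%tm) : fm_scope.
Notation "A ∧ B" := (And A B) (at level 80, right associativity) : fm_scope.
Notation "A ∨ B" := (Or A B) (at level 85, right associativity) : fm_scope.
Notation "A ⟶ B" := (Imp A B) (at level 95, right associativity) : fm_scope.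
Notation "'ALL' x : s , A" := (all_ s%ty (fun x => A%fm))
  (at level 200, x name, s at level 100, A at level 200) : fm_scope.
Notation "'EX' x : s , A" := (ex_ s%ty (fun x => A%fm))
  (at level 200, x name, s at level 100, A at level 200) : fm_scope.

Local Open Scope fm_scope.
Local Open Scope tm_scope.

(* Extensional equality x =_t y. *)
Fixpoint eqt {G} {t : ty} : tm G t -> tm G t -> fm G :=
  match t with
  | ty0 => fun a b => Eq0 a b
  | s ⇒ t' => fun a b => ALL z : s, eqt (↑a · z) (↑b · z)
  end.

(** * The theory RCA_0^omega *)

(* Commutative semi-ring with a compatible strict linear order whose least
   element is 0 and in which nothing lies strictly between x and x + 1 (the
   last two axioms also follow from the others by quantifier-free induction). *)
Inductive ordered_semiring : sentence -> Prop :=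
| ax_addA : ordered_semiring
    (ALL x : ty0, ALL y : ty0, ALL z : ty0, (↑x + ↑y) + z ≡ ↑x + (↑y + z))
| ax_addC : ordered_semiring (ALL x : ty0, ALL y : ty0, ↑x + y ≡ y + ↑x)
| ax_add0 : ordered_semiring (ALL x : ty0, x + 0 ≡ x)
| ax_mulA : ordered_semiring
    (ALL x : ty0, ALL y : ty0, ALL z : ty0, (↑x * ↑y) * z ≡ ↑x * (↑y * z))
| ax_mulC : ordered_semiring (ALL x : ty0, ALL y : ty0, ↑x * y ≡ y * ↑x)
| ax_mul1 : ordered_semiring (ALL x : ty0, x * 1 ≡ x)
| ax_mul0 : ordered_semiring (ALL x : ty0, x * 0 ≡ 0)
| ax_mulD : ordered_semiring
    (ALL x : ty0, ALL y : ty0, ALL z : ty0, ↑x * (↑y + z) ≡ ↑x * ↑y + ↑x * z)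
| ax_lt_irrefl : ordered_semiring (ALL x : ty0, x < x ⟶ Bot)
| ax_lt_trans : ordered_semiring
    (ALL x : ty0, ALL y : ty0, ALL z : ty0, ↑x < ↑y ⟶ ↑y < z ⟶ ↑x < z)
| ax_lt_total : ordered_semiring
    (ALL x : ty0, ALL y : ty0, ↑x < y ∨ ↑x ≡ y ∨ y < ↑x)
| ax_lt_add : ordered_semiring
    (ALL x : ty0, ALL y : ty0, ALL z : ty0, ↑x < ↑y ⟶ ↑x + z < ↑y + z)
| ax_lt_mul : ordered_semiring
    (ALL x : ty0, ALL y : ty0, ALL z : ty0, 0 < z ⟶ ↑x < ↑y ⟶ ↑x * z < ↑y * z)
| ax_lt01 : ordered_semiring (0 < 1)
| ax_le0 : ordered_semiring (ALL x : ty0, 0 <= x)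
| ax_discrete : ordered_semiring (ALL x : ty0, ALL y : ty0, ↑x < y + 1 ⟶ ↑x <= y).

Definition ax_Pi (s t : ty) : sentence :=
  ALL x : s, ALL y : t, eqt (Pi s t · ↑x · y) (↑x).

Definition ax_Sigma (r s t : ty) : sentence :=
  ALL x : r ⇒ s ⇒ t, ALL y : r ⇒ s, ALL z : r,
    eqt (Sigma r s t · ↑x · ↑y · z) (↑x · z · (↑y · z)).

Definition ax_Rec0 : sentence :=
  ALL f : ty0 ⇒ ty0 ⇒ ty0, ALL m : ty0, Rec · ↑f · m · 0 ≡ m.

Definition ax_RecS : sentence :=
  ALL f : ty0 ⇒ ty0 ⇒ ty0, ALL m : ty0, ALL n : ty0,
    Rec · ↑f · ↑m · (n + 1) ≡ ↑f · n · (Rec · ↑f · ↑m · n).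

Definition ax_ext (r t : ty) : sentence :=
  ALL x : r, ALL y : r, ALL φ : r ⇒ t, eqt (↑x) (↑y) ⟶ eqt (φ · ↑x) (φ · ↑y).

(* A(n + 1), for A(n) with distinguished variable n. *)
Definition at_succ {G} (A : fm (ty0 :: G)) : fm (ty0 :: G) :=
  subst (scons (X := tm (ty0 :: G)) (Var V0 + 1) (fun _ v => Var (VS v))) A.

Definition induction {G} (A : fm (ty0 :: G)) : fm G :=
  inst A 0 ∧ All ty0 (A ⟶ at_succ A) ⟶ All ty0 A.

(* In A(x,y) the variable y is bound last; in the conclusion the context is
   x, Y, followed by the parameters. *)
Definition AC {G} {s t : ty} (A : fm (t :: s :: G)) : fm G :=
  All s (Ex t A) ⟶
  Ex (s ⇒ t) (All s
    (subst (scons (X := tm (s :: (s ⇒ t) :: G)) (Var (VS V0) · Var V0)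
       (scons (X := tm (s :: (s ⇒ t) :: G)) (Var V0) (fun _ v => Var (VS (VS v)))))
     A)).

Inductive RCA0w : sentence -> Prop :=
| RCA_semiring : forall A, ordered_semiring A -> RCA0w A
| RCA_Pi : forall s t, RCA0w (ax_Pi s t)
| RCA_Sigma : forall r s t, RCA0w (ax_Sigma r s t)
| RCA_Rec0 : RCA0w ax_Rec0
| RCA_RecS : RCA0w ax_RecS
| RCA_ext : forall r t, RCA0w (ax_ext r t)
| RCA_QFind : forall G (A : fm (ty0 :: G)), qf A -> RCA0w (close (induction A))
| RCA_QFAC : forall G (A : fm (ty0 :: ty1 :: G)), qf A -> RCA0w (close (AC A)).

(** * Lambda abstraction and arithmetic terms *)

Definition lam_var {s G t} (v : var (s :: G) t) : tm G (s ⇒ t) :=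
  match v in var D t return
    match D with [] => unit | s :: G => tm G (s ⇒ t) end
  with
  | @V0 G s => Sigma s (s ⇒ s) s · Pi s (s ⇒ s) · Pi s s
  | @VS G t s v => Pi t s · Var v
  end.

Fixpoint abstract {s G t} (a : tm (s :: G) t) : tm G (s ⇒ t) :=
  match a in tm _ t return tm G (s ⇒ t) with
  | Var v => lam_var v
  | Zero => Pi ty0 s · Zero
  | One => Pi ty0 s · One
  | Plus => Pi _ s · Plus
  | Times => Pi _ s · Times
  | Pi r t => Pi _ s · Pi r t
  | Sigma p q r => Pi _ s · Sigma p q r
  | Rec => Pi _ s · Rec
  | @App _ r t f a => Sigma s r t · abstract f · abstract a
  end.

Definition lam {G} s {t} (a : tm (s :: G) s -> tm (s :: G) t) : tm G (s ⇒ t) :=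
  abstract (a (Var V0)).
Arguments lam {G} s {t} & a.
Notation "'LAM' x : s , a" := (lam s%ty (fun x => a%tm))
  (at level 200, x name, s at level 100, a at level 200) : tm_scope.

Definition pred_ {G} (a : tm G ty0) : tm G ty0 :=
  Rec · (LAM k : ty0, LAM r : ty0, ↑k) · 0 · a.

(* Truncated subtraction. *)
Definition monus {G} (a b : tm G ty0) : tm G ty0 :=
  Rec · (LAM k : ty0, LAM r : ty0, pred_ r) · a · b.

(* 1 if a <= b, and 0 otherwise. *)
Definition leq_test {G} (a b : tm G ty0) : tm G ty0 := monus 1 (monus a b).

Definition exp2 {G} (a : tm G ty0) : tm G ty0 :=
  Rec · (LAM k : ty0, LAM r : ty0, r + r) · 1 · a.

(* Integer square root. *)
Definition root {G} (a : tm G ty0) : tm G ty0 :=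
  Rec · (LAM k : ty0, LAM r : ty0, r + leq_test ((r + 1) * (r + 1)) (↑k + 1)) · 0 · a.

(* The injective pairing (a + b)^2 + a; [fst_] and [snd_] are total. *)
Definition pair_ {G} (a b : tm G ty0) : tm G ty0 := (a + b) * (a + b) + a.
Definition fst_ {G} (c : tm G ty0) : tm G ty0 := monus c (root c * root c).
Definition snd_ {G} (c : tm G ty0) : tm G ty0 := monus (root c) (fst_ c).

(** * Rationals and reals *)

(* Every number q codes the rational (qpos q - qneg q) / (qden q + 1). *)
Definition qmk {G} (a b c : tm G ty0) : tm G ty0 := pair_ (pair_ a b) c.
Definition qpos {G} (q : tm G ty0) : tm G ty0 := fst_ (fst_ q).
Definition qneg {G} (q : tm G ty0) : tm G ty0 := snd_ (fst_ q).
Definition qden {G} (q : tm G ty0) : tm G ty0 := snd_ q.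

Definition qadd {G} (q r : tm G ty0) : tm G ty0 :=
  qmk (qpos q * (qden r + 1) + qpos r * (qden q + 1))
      (qneg q * (qden r + 1) + qneg r * (qden q + 1))
      (pred_ ((qden q + 1) * (qden r + 1))).
Definition qopp {G} (q : tm G ty0) : tm G ty0 := qmk (qneg q) (qpos q) (qden q).
Definition qsub {G} (q r : tm G ty0) : tm G ty0 := qadd q (qopp r).
Definition qabs {G} (q : tm G ty0) : tm G ty0 :=
  qmk (monus (qpos q) (qneg q) + monus (qneg q) (qpos q)) 0 (qden q).

(* The dyadic rational a / 2^n. *)
Definition qdyad {G} (a n : tm G ty0) : tm G ty0 := qmk a 0 (pred_ (exp2 n)).

Definition qlt {G} (q r : tm G ty0) : fm G :=
  qpos q * (qden r + 1) + qneg r * (qden q + 1) <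
  qpos r * (qden q + 1) + qneg q * (qden r + 1).
Definition qle {G} (q r : tm G ty0) : fm G :=
  qpos q * (qden r + 1) + qneg r * (qden q + 1) <=
  qpos r * (qden q + 1) + qneg q * (qden r + 1).

Definition real {G} (x : tm G ty1) : fm G :=
  ALL n : ty0, ALL i : ty0,
    qlt (qabs (qsub (↑x · ↑n) (↑x · (↑n + i)))) (qdyad 1 (↑n)).

Definition req {G} (x y : tm G ty1) : fm G :=
  ALL n : ty0, qle (qabs (qsub (↑x · n) (↑y · n))) (qdyad (1 + 1) n).

(* The n-th term of a real is within 2^-n of it, so x < y iff for some n the
   n-th terms differ by more than 2 * 2^-n. *)
Definition rlt {G} (x y : tm G ty1) : fm G :=
  EX n : ty0, qlt (qadd (↑x · n) (qdyad (1 + 1) n)) (↑y · n).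
Definition rle {G} (x y : tm G ty1) : fm G := rlt y x ⟶ Bot.

Definition rzero {G} : tm G ty1 := LAM n : ty0, qmk 0 0 0.
Definition rone {G} : tm G ty1 := LAM n : ty0, qmk 1 0 0.

(* The index shift makes the sum converge at the prescribed rate. *)
Definition radd {G} (x y : tm G ty1) : tm G ty1 :=
  LAM n : ty0, qadd (↑x · (n + 1)) (↑y · (n + 1)).
Definition ropp {G} (x : tm G ty1) : tm G ty1 := LAM n : ty0, qopp (↑x · n).
Definition rsub {G} (x y : tm G ty1) : tm G ty1 := radd x (ropp y).
Definition rabs {G} (x : tm G ty1) : tm G ty1 := LAM n : ty0, qabs (↑x · n).

Definition posreal {G} (x : tm G ty1) : fm G := real x ∧ rlt rzero x.
Definition unit_interval {G} (x : tm G ty1) : fm G :=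
  real x ∧ rle rzero x ∧ rle x rone.

(** ** Functions on the reals and on the unit interval *)

Definition real_function {G} (f : tm G (ty1 ⇒ ty1)) : fm G :=
  (ALL x : ty1, real x ⟶ real (↑f · x)) ∧
  (ALL x : ty1, ALL y : ty1,
     real (↑x) ⟶ real y ⟶ req (↑x) y ⟶ req (↑f · ↑x) (↑f · y)).

Definition unit_function {G} (f : tm G (ty1 ⇒ ty1)) : fm G :=
  (ALL x : ty1, unit_interval x ⟶ real (↑f · x)) ∧
  (ALL x : ty1, ALL y : ty1,
     unit_interval (↑x) ⟶ unit_interval y ⟶
     req (↑x) y ⟶ req (↑f · ↑x) (↑f · y)).

Definition unit_continuous {G} (f : tm G (ty1 ⇒ ty1)) : fm G :=
  ALL x : ty1, unit_interval x ⟶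
  ALL ε : ty1, posreal ε ⟶
  EX δ : ty1, posreal δ ∧
  ALL y : ty1, unit_interval y ⟶
    rlt (rabs (rsub (↑x) y)) (↑δ) ⟶
    rlt (rabs (rsub (↑f · ↑x) (↑f · y))) (↑ε).

(** ** Nets *)

Definition charfun {G} (D : tm G ty2) : fm G := ALL x : ty1, ↑D · x <= 1.
Definition mem {G} (d : tm G ty1) (D : tm G ty2) : fm G := D · d ≡ 1.

(* Binary characteristic functions of type (1 x 1) -> 0 are curried. *)
Definition charrel {G} (P : tm G (ty1 ⇒ ty1 ⇒ ty0)) : fm G :=
  ALL x : ty1, ALL y : ty1, ↑P · ↑x · y <= 1.
Definition related {G} (P : tm G (ty1 ⇒ ty1 ⇒ ty0)) (d e : tm G ty1) : fm G :=
  P · d · e ≡ 1.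

Definition directed {G} (D : tm G ty2) (P : tm G (ty1 ⇒ ty1 ⇒ ty0)) : fm G :=
  charfun D ∧ charrel P ∧
  (EX d : ty1, mem d (↑D)) ∧
  (ALL x : ty1, ALL y : ty1, ALL z : ty1,
     mem (↑x) (↑D) ⟶ mem (↑y) (↑D) ⟶ mem z (↑D) ⟶
     related (↑P) (↑x) (↑y) ⟶ related (↑P) (↑y) z ⟶ related (↑P) (↑x) z) ∧
  (ALL x : ty1, mem x (↑D) ⟶ related (↑P) x x) ∧
  (ALL x : ty1, ALL y : ty1, mem (↑x) (↑D) ⟶ mem y (↑D) ⟶
     EX z : ty1, mem z (↑D) ∧ related (↑P) (↑x) z ∧ related (↑P) (↑y) z).

(* For a net F of functions on the unit interval, F d x stands for f_d(x); only
   its values for d in D and x in [0,1] are ever constrained. *)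
Definition increasing {G} (D : tm G ty2) (P : tm G (ty1 ⇒ ty1 ⇒ ty0))
    (F : tm G (ty1 ⇒ ty1 ⇒ ty1)) : fm G :=
  ALL a : ty1, ALL b : ty1, mem (↑a) (↑D) ⟶ mem b (↑D) ⟶ related (↑P) (↑a) b ⟶
  ALL x : ty1, unit_interval x ⟶ rle (↑F · ↑a · x) (↑F · ↑b · x).

Definition converges {G} (D : tm G ty2) (P : tm G (ty1 ⇒ ty1 ⇒ ty0))
    (F : tm G (ty1 ⇒ ty1 ⇒ ty1)) (f : tm G (ty1 ⇒ ty1)) : fm G :=
  ALL x : ty1, unit_interval x ⟶
  ALL ε : ty1, posreal ε ⟶
  EX d : ty1, mem d (↑D) ∧
  ALL e : ty1, mem e (↑D) ⟶ related (↑P) (↑d) e ⟶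
    rlt (rabs (rsub (↑F · e · ↑x) (↑f · ↑x))) (↑ε).

Definition converges_uniformly {G} (D : tm G ty2) (P : tm G (ty1 ⇒ ty1 ⇒ ty0))
    (F : tm G (ty1 ⇒ ty1 ⇒ ty1)) (f : tm G (ty1 ⇒ ty1)) : fm G :=
  ALL ε : ty1, posreal ε ⟶
  EX d : ty1, mem d (↑D) ∧
  ALL x : ty1, unit_interval x ⟶
  ALL e : ty1, mem e (↑D) ⟶ related (↑P) (↑d) e ⟶
    rlt (rabs (rsub (↑F · e · ↑x) (↑f · ↑x))) (↑ε).

(** * Dini's theorem for nets, and the Heine-Borel theorem for uncountable covers *)

Definition DIN_net : sentence :=
  ALL D : ty2, ALL P : ty1 ⇒ ty1 ⇒ ty0,
  ALL F : ty1 ⇒ ty1 ⇒ ty1, ALL f : ty1 ⇒ ty1,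
    directed (↑D) (↑P) ⟶
    (ALL d : ty1, mem d (↑D) ⟶
       unit_function (↑F · d) ∧ unit_continuous (↑F · d)) ⟶
    increasing (↑D) (↑P) (↑F) ⟶
    unit_function f ∧ unit_continuous f ⟶
    converges (↑D) (↑P) (↑F) f ⟶
    converges_uniformly (↑D) (↑P) (↑F) f.

(* The finite sequence y_1, ..., y_k is given by the first k values of Y. *)
Definition HBU : sentence :=
  ALL Ψ : ty1 ⇒ ty1,
    real_function Ψ ∧ (ALL x : ty1, real x ⟶ rlt rzero (↑Ψ · x)) ⟶
    EX k : ty0, EX Y : ty0 ⇒ ty1,
      (ALL i : ty0, i < ↑k ⟶ unit_interval (↑Y · i)) ∧
      (ALL x : ty1, unit_interval x ⟶
         EX i : ty0, i < ↑k ∧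
           rlt (rsub (↑Y · i) (↑Ψ · (↑Y · i))) (↑x) ∧
           rlt (↑x) (radd (↑Y · i) (↑Ψ · (↑Y · i)))).

(* Main.v *)
(* By completeness of the deductive system (Henkin's construction, followed by an
   extensional collapse), it suffices to derive HBU from DIN_net in an arbitrary
   extensional model M of RCA_0^omega.  The type 0 objects of M form an ordered
   semiring, which embeds into an ordered field K; this is where rationals are
   evaluated.

   Given Psi, QF-AC^{1,0} chooses for each real y a radius 2^-N(y) < Psi(y), and
   a rational c(y) close to y.  The pair (c(y), N(y)) is a natural number, the
   code of y.  An index d of the net lists finitely many reals, and indices are
   compared through the sets of their codes, so that the order is decidable even
   though equality of reals is not.  The function f_d is the maximum of the tent
   functions over the rational intervals coded in d.  The net converges to the
   constant 1, because a real x lies in the middle of its own interval, and a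
   single d with f_d > 0 everywhere yields a finite subcover. *)
From HB Require Import structures.
From mathcomp Require Import all_boot all_order all_algebra.
From mathcomp Require Import ring lra.
From mathcomp Require Import boolp.
From Stdlib Require Import List.
From Stdlib Require Cantor.
Require Import Defs.

Set Implicit Arguments.
Unset Strict Implicit.
Unset Printing Implicit Defensive.

(** * Quotients *)

(** The model [M] may be nonstandard, and this shapes everything after completeness. Induction and
    recursion of the metatheory do not reach all numbers of [M]: a maximum over the codes below a
    number must be a term built with [Rec], and each fact about it must be phrased as a
    quantifier-free formula with parameters before [M] admits an induction. Finite means bounded by
    a number of [M]. [RCA0w] offers no choice of type 1 objects, so the centres of the subcover
    cannot be chosen afterwards from their codes. An index therefore carries its own witnesses: it
    is one type 1 object whose columns hold reals, and column [k] counts only if its code is [k].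
    The functions $f_d$ see only the codes; the columns are read off at the end. The choice of radii
    ranges over all type 1 objects, whereas [Psi] is controlled only at reals. The functional [nrm],
    which sends every type 1 object to a real in $[0,1]$, bridges this gap. Radii and codes need not
    respect equality of reals, as they are compared only as numbers. *)

Section Quot.
Variables (X : Type) (R : X -> X -> Prop).
Hypothesis R_refl : forall x, R x x.
Hypothesis R_sym : forall x y, R x y -> R y x.
Hypothesis R_trans : forall x y z, R x y -> R y z -> R x z.

Definition quot : Type := {P : X -> Prop | exists x, P = R x}.

Definition cls (x : X) : quot := exist _ (R x) (ex_intro _ x erefl).

Definition rep (c : quot) : X := sval (cid (svalP c)).

Lemma clsP x y : cls x = cls y <-> R x y.
Proof.
split=> [[] /= ->|xy]; first exact: R_refl.
apply: eq_exist => /=; apply/funext => z; apply/propext.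
by split; apply: R_trans => //; apply: R_sym.
Qed.

Lemma repK c : cls (rep c) = c.
Proof.
rewrite /rep; case: cid => x /= ex; case: c ex => P PX /= ex.
by apply: eq_exist.
Qed.

Lemma rep_cls x : R (rep (cls x)) x.
Proof. by apply/clsP; rewrite repK. Qed.

Lemma quotW (P : quot -> Prop) : (forall x, P (cls x)) -> forall c, P c.
Proof. by move=> Pcls c; rewrite -(repK c). Qed.

End Quot.

(** * Substitution and derivability *)

Lemma subst_ext G D (f g : forall s, var G s -> D s) :
  (forall s v, f s v = g s v) -> f = g.
Proof. by move=> fg; do 2![apply: functional_extensionality_dep => ?]. Qed.

(** The index [s :: G] blocks plain elimination of a variable, so the [match] returns a statement
    computed from the context. *)
Lemma var_ind_cons s G (P : forall t, var (s :: G) t -> Prop) :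
  P s V0 -> (forall t v, P t (VS v)) -> forall t v, P t v.
Proof.
move=> P0 PS t v.
refine (match v as v' in var D t' return
  match D with
  | [::] => fun _ => True
  | s' :: G' => fun v' : var (s' :: G') t' =>
     forall P : forall t, var (s' :: G') t -> Prop,
       P s' V0 -> (forall t v, P t (VS v)) -> P t' v'
  end v' with V0 _ _ => _ | VS _ _ _ w => _ end P P0 PS); by move=> *; auto.
Qed.

Lemma var_nil (P : Type) t : var [::] t -> P.
Proof.
move=> v.
by refine (match v in var D t' return match D with [::] => P | _ => unit end
  with V0 _ _ => tt | VS _ _ _ w => tt end).
Qed.

Lemma scons_ext (X : ty -> Type) s G (f g : forall t, var (s :: G) t -> X t) :
  f s V0 = g s V0 -> (forall t v, f t (VS v) = g t (VS v)) -> f = g.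
Proof. by move=> fg0 fgS; apply: subst_ext; apply: var_ind_cons. Qed.

Lemma eq_subst_tm G D (f g : substitution G D) s (a : tm G s) :
  (forall s v, f s v = g s v) -> subst_tm f a = subst_tm g a.
Proof. by move=> /subst_ext ->. Qed.

Lemma eq_subst G D (f g : substitution G D) (A : fm G) :
  (forall s v, f s v = g s v) -> subst f A = subst g A.
Proof. by move=> /subst_ext ->. Qed.

Lemma ren_tmE G D (r : renaming G D) s (a : tm G s) :
  ren_tm r a = subst_tm (fun _ v => Var (r _ v)) a.
Proof. by elim: a => //= {}s t f -> a ->. Qed.

Lemma subst_tm_comp G D E (f : substitution G D) (g : substitution D E) s
    (a : tm G s) :
  subst_tm g (subst_tm f a) = subst_tm (fun _ v => subst_tm g (f _ v)) a.
Proof. by elim: a => //= {}s t h -> a ->. Qed.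

Lemma subst_tm_id G s (a : tm G s) : subst_tm (fun _ v => Var v) a = a.
Proof. by elim: a => //= {}s t h -> a ->. Qed.

Lemma wk_tmE G s t (a : tm G t) :
  wk_tm (s := s) a = subst_tm (fun _ v => Var (VS v)) a.
Proof. exact: ren_tmE. Qed.

Lemma up_comp G D E (f : substitution G D) (g : substitution D E) s :
  (fun _ v => subst_tm (up g (s := s)) (up f v)) =
  up (fun _ v => subst_tm g (f _ v)).
Proof.
apply: scons_ext => // t v; rewrite /= !wk_tmE !subst_tm_comp.
by apply: eq_subst_tm => u w; rewrite /= wk_tmE.
Qed.

Lemma up_id G s : up (fun _ (v : var G _) => Var v) = fun _ (v : var (s :: G) _) => Var v.
Proof. exact: scons_ext. Qed.

Lemma subst_comp G (A : fm G) :
  forall D E (f : substitution G D) (g : substitution D E),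
  subst g (subst f A) = subst (fun _ v => subst_tm g (f _ v)) A.
Proof.
elim: A => {G} [G a b|G a b|G|G A IA B IB|G A IA B IB|G A IA B IB|G s A IA|G s A IA]
  D E f g //=; rewrite ?subst_tm_comp ?IA ?IB //; by rewrite up_comp.
Qed.

Lemma subst_id G (A : fm G) : subst (fun _ v => Var v) A = A.
Proof.
elim: A => {G} [G a b|G a b|G|G A IA B IB|G A IA B IB|G A IA B IB|G s A IA|G s A IA];
  by rewrite /= ?subst_tm_id ?up_id ?IA ?IB.
Qed.

Lemma subst_inst G D (f : substitution G D) s (A : fm (s :: G)) (a : tm G s) :
  subst f (inst A a) = inst (subst (up f) A) (subst_tm f a).
Proof.
rewrite /inst !subst_comp; apply: eq_subst; apply: var_ind_cons => // t v /=.
by rewrite wk_tmE subst_tm_comp subst_tm_id.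
Qed.

Lemma subst_wk G D (f : substitution G D) s (A : fm G) :
  subst (up f) (wk (s := s) A) = wk (subst f A).
Proof.
rewrite /wk !subst_comp; apply: eq_subst => t v /=.
by rewrite wk_tmE.
Qed.

Lemma nd_weak G (H : list (fm G)) A :
  nd H A -> forall H', incl H H' -> nd H' A.
Proof.
elim=> {G H A}.
- by move=> G H A HA H' HH'; apply: nd_hyp; apply: HH'.
- by move=> G H A _ IH H' HH'; apply/nd_raa/IH/incl_cons; [left|apply: incl_tl].
- by move=> G H A B _ IH H' HH'; apply/nd_impI/IH/incl_cons; [left|apply: incl_tl].
- by move=> G H A B _ IH _ IH' H' HH'; apply: nd_impE (IH _ HH') (IH' _ HH').
- by move=> G H A B _ IH _ IH' H' HH'; apply: nd_andI (IH _ HH') (IH' _ HH').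
- by move=> G H A B _ IH H' HH'; apply: nd_andE1 (IH _ HH').
- by move=> G H A B _ IH H' HH'; apply: nd_andE2 (IH _ HH').
- by move=> G H A B _ IH H' HH'; apply: nd_orI1 (IH _ HH').
- by move=> G H A B _ IH H' HH'; apply: nd_orI2 (IH _ HH').
- move=> G H A B C _ IH _ IA _ IB H' HH'; apply: nd_orE (IH _ HH') _ _.
  + by apply/IA/incl_cons; [left|apply: incl_tl].
  + by apply/IB/incl_cons; [left|apply: incl_tl].
- by move=> G H s A _ IH H' HH'; apply/nd_allI/IH/incl_map.
- by move=> G H s A a _ IH H' HH'; apply/nd_allE/IH.
- by move=> G H s A a _ IH H' HH'; apply/nd_exI/IH.
- move=> G H s A C _ IH _ IC H' HH'; apply: nd_exE (IH _ HH') _.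
  by apply/IC/incl_cons; [left|apply/incl_tl/incl_map].
- by move=> G H a H' _; apply: nd_eq_refl.
- by move=> G H A a b _ IH _ IA H' HH'; apply: nd_eq_subst (IH _ HH') (IA _ HH').
Qed.

Lemma map_subst_wk G D (f : substitution G D) s (H : list (fm G)) :
  List.map (subst (up f)) (List.map (wk (s := s)) H) =
  List.map wk (List.map (subst f) H).
Proof. by rewrite !map_map; apply: map_ext => A; apply: subst_wk. Qed.

(** Lets a derivation move between contexts: fresh Henkin parameters enter as new variables, and
    retracting them is again a substitution. *)
Lemma nd_subst G (H : list (fm G)) A :
  nd H A -> forall D (f : substitution G D), nd (List.map (subst f) H) (subst f A).
Proof.
elim=> {G H A}.
- by move=> G H A HA D f; apply/nd_hyp/in_map.
- by move=> G H A _ IH D f; apply/nd_raa/(IH D f).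
- by move=> G H A B _ IH D f; apply/nd_impI/(IH D f).
- by move=> G H A B _ IH _ IH' D f; apply: nd_impE (IH D f) (IH' D f).
- by move=> G H A B _ IH _ IH' D f; apply: nd_andI (IH D f) (IH' D f).
- by move=> G H A B _ IH D f; apply: nd_andE1 (IH D f).
- by move=> G H A B _ IH D f; apply: nd_andE2 (IH D f).
- by move=> G H A B _ IH D f; apply: nd_orI1 (IH D f).
- by move=> G H A B _ IH D f; apply: nd_orI2 (IH D f).
- by move=> G H A B C _ IH _ IA _ IB D f; apply: nd_orE (IH D f) (IA D f) (IB D f).
- by move=> G H s A _ IH D f; apply: nd_allI; rewrite -map_subst_wk; apply: IH.
- by move=> G H s A a _ IH D f; rewrite subst_inst; apply/nd_allE/(IH D f).
- move=> G H s A a _ IH D f; apply: (@nd_exI _ _ _ _ (subst_tm f a)).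
  by rewrite -subst_inst.
- move=> G H s A C _ IH _ IC D f; apply: nd_exE (IH D f) _.
  by rewrite -map_subst_wk -subst_wk; apply: (IC _ (up f)).
- by move=> G H a D f; apply: nd_eq_refl.
- move=> G H A a b _ IH _ IA D f; rewrite subst_inst.
  by apply: nd_eq_subst (IH D f) _; rewrite -subst_inst.
Qed.

(** * Enumerations *)

Definition enumerable (X : Type) (P : X -> Prop) : Prop :=
  exists e : nat -> option X, forall x, P x -> exists n, e n = Some x.

Lemma enumerable_sub X (P Q : X -> Prop) :
  (forall x, P x -> Q x) -> enumerable Q -> enumerable P.
Proof. by move=> PQ [e he]; exists e => x /PQ /he. Qed.

Lemma enumerable_image X Y (P : X -> Prop) (f : X -> Y) :
  enumerable P -> enumerable (fun y => exists2 x, P x & y = f x).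
Proof.
move=> [e he]; exists (fun n => omap f (e n)) => y [x /he[n en] ->].
by exists n; rewrite en.
Qed.

Lemma enumerable_sigma I (X : I -> Type) (P : I -> Prop)
    (Q : forall i, X i -> Prop) :
  enumerable P -> (forall i, enumerable (Q i)) ->
  enumerable (fun u : {i & X i} => P (projT1 u) /\ Q _ (projT2 u)).
Proof.
move=> [e he] Qe; pose f i := sval (cid (Qe i)).
have hf i : forall x, Q i x -> exists n, f i n = Some x := svalP (cid (Qe i)).
exists (fun n => let (k, l) := Cantor.of_nat n in
  if e k is Some i then omap (existT X i) (f i l) else None).
move=> [i x] /= [/he[k ek] /hf[l fl]]; exists (Cantor.to_nat (k, l)).
by rewrite Cantor.cancel_of_to ek fl.
Qed.

Lemma enumerable_union I X (P : I -> Prop) (Q : I -> X -> Prop) :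
  enumerable P -> (forall i, enumerable (Q i)) ->
  enumerable (fun x => exists2 i, P i & Q i x).
Proof.
move=> Pe Qe.
have := enumerable_image (@projT2 I (fun=> X)) (enumerable_sigma Pe Qe).
by apply: enumerable_sub => x [i Pi Qx]; exists (existT _ i x).
Qed.

Lemma enumerable_subsingleton X (P : X -> Prop) :
  (forall x y, P x -> P y -> x = y) -> enumerable P.
Proof.
move=> sP; have [[x Px]|nP] := pselect (exists x, P x).
  by exists (fun=> Some x) => y Py; exists 0; rewrite (sP _ _ Px Py).
by exists (fun=> None) => y Py; case: nP; exists y.
Qed.

Lemma enumerable_or X (P Q : X -> Prop) :
  enumerable P -> enumerable Q -> enumerable (fun x => P x \/ Q x).
Proof.
move=> Pe Qe.
have bool_enum : enumerable (fun _ : bool => True).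
  by exists (fun n => Some (n == 0)) => -[] _; [exists 0|exists 1].
have := enumerable_union (Q := fun b : bool => if b then P else Q) bool_enum.
move=> /(_ _)/enumerable_sub; apply; last by case.
by move=> x [?|?]; [exists true|exists false].
Qed.

Lemma enumerable_nat : enumerable (fun _ : nat => True).
Proof. by exists Some => n; exists n. Qed.

(** The syntactic families recur at varying types and contexts, so they are enumerated rank by rank,
    with the type or context quantified inside the induction. *)
Lemma enumerable_rank X (rk : X -> nat) :
  (forall n, enumerable (fun x => rk x <= n)) -> enumerable (fun _ : X => True).
Proof.
move=> h; apply: enumerable_sub (enumerable_union enumerable_nat h) => x _.
by exists (rk x).
Qed.

Fixpoint ty_rank (s : ty) : nat :=
  if s is Arr s t then (maxn (ty_rank s) (ty_rank t)).+1 else 0.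

Lemma enumerable_ty : enumerable (fun _ : ty => True).
Proof.
apply: (enumerable_rank (rk := ty_rank)); elim=> [|n IH].
  by apply: enumerable_subsingleton => -[|s t] [|s' t'].
apply: enumerable_sub (enumerable_or (P := eq ty0) _ (enumerable_image
  (fun u : {_ : ty & ty} => Arr (projT1 u) (projT2 u))
  (enumerable_sigma IH (fun=> IH)))).
  case=> [|s t]; [by left|right]; exists (existT _ s t) => //=.
  by move: H; rewrite /= ltnS geq_max => /andP.
by apply: enumerable_subsingleton => x y <- <-.
Qed.

(** Serves the constants, whose type is forced: at type [t] there is at most one transported copy of
    [c], because equality proofs are irrelevant. *)
Lemma enumerable_cast (F : ty -> Type) s t (c : F s) :
  enumerable (fun x : F t => exists e : s = t, x = eq_rect s F c t e).
Proof.
apply: enumerable_subsingleton => x y [e ->] [e' ->].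
by rewrite (Prop_irrelevance e e').
Qed.

Lemma enumerable_var G s : enumerable (fun _ : var G s => True).
Proof.
elim: G s => [|r G IH] s; first by exists (fun=> None) => v; apply: var_nil v.
apply: enumerable_sub (enumerable_or (enumerable_cast s (@V0 G r))
  (enumerable_image (fun v : var G s => VS (t := r) v) (IH s))) => v _.
move: s v {IH}; apply: var_ind_cons => [|t v]; first by left; exists erefl.
by right; exists v.
Qed.

Fixpoint tm_rank G s (a : tm G s) : nat :=
  if a is App _ _ f a then (maxn (tm_rank f) (tm_rank a)).+1 else 0.

Lemma enumerable_tm G s : enumerable (fun _ : tm G s => True).
Proof.
apply: (enumerable_rank (rk := @tm_rank G s)) => n; elim: n s => [|n IH] s.
  have u0 := enumerable_image (@Var G s) (enumerable_var G s).
  have u1 := enumerable_or u0 (enumerable_cast s (@Zero G)).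
  have u2 := enumerable_or u1 (enumerable_cast s (@One G)).
  have u3 := enumerable_or u2 (enumerable_cast s (@Plus G)).
  have u4 := enumerable_or u3 (enumerable_cast s (@Times G)).
  have u5 := enumerable_or u4 (enumerable_cast s (@Rec G)).
  have u6 := enumerable_or u5 (enumerable_union enumerable_ty (fun r =>
    enumerable_union enumerable_ty (fun t => enumerable_cast s (@Pi G r t)))).
  have := enumerable_or u6 (enumerable_union enumerable_ty (fun q =>
    enumerable_union enumerable_ty (fun r =>
    enumerable_union enumerable_ty (fun t => enumerable_cast s (@Sigma G q r t))))).
  apply: enumerable_sub => x; case: {s u0 u1 u2 u3 u4 u5 u6} _ / x => //.
  - by move=> s v _; do 7!left; exists v.
  - by do 6!left; right; exists erefl.
  - by do 5!left; right; exists erefl.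
  - by do 4!left; right; exists erefl.
  - by do 3!left; right; exists erefl.
  - by move=> s t _; left; right; exists s => //; exists t => //; exists erefl.
  - by move=> q s t _; right; exists q => //; exists s => //; exists t => //; exists erefl.
  - by do 2!left; right; exists erefl.
have ua := enumerable_union enumerable_ty (fun r => enumerable_image
  (fun u : {_ : tm G (Arr r s) & tm G r} => App (projT1 u) (projT2 u))
  (enumerable_sigma (IH (Arr r s)) (fun=> IH r))).
apply: enumerable_sub (enumerable_or (IH s) ua) => x.
case: {s ua} _ / x; try by left.
move=> s t f a /=; rewrite ltnS geq_max => /andP fa; right.
by exists s => //; exists (existT _ f a).
Qed.

Fixpoint fm_rank G (A : fm G) : nat :=
  match A with
  | Eq0 _ _ | Lt0 _ _ | Bot => 0
  | Imp A B | And A B | Or A B => (maxn (fm_rank A) (fm_rank B)).+1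
  | All _ A | Ex _ A => (fm_rank A).+1
  end.

Lemma enumerable_fm G : enumerable (fun _ : fm G => True).
Proof.
apply: (enumerable_rank (rk := @fm_rank G)) => n; elim: n G => [|n IH] G.
  have tt := enumerable_sigma (enumerable_tm G ty0) (fun=> enumerable_tm G ty0).
  have u0 := enumerable_image
    (fun u : {_ : tm G ty0 & tm G ty0} => Eq0 (projT1 u) (projT2 u)) tt.
  have u1 := enumerable_or u0 (enumerable_image
    (fun u : {_ : tm G ty0 & tm G ty0} => Lt0 (projT1 u) (projT2 u)) tt).
  have ub : enumerable (eq (@Bot G)).
    by apply: enumerable_subsingleton => x y <- <-.
  apply: enumerable_sub (enumerable_or u1 ub) => -[] //=.
  - by move=> a b _; do 2!left; exists (existT _ a b).
  - by move=> a b _; left; right; exists (existT _ a b).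
  - by right.
have ff := enumerable_sigma (IH G) (fun=> IH G).
have u0 := enumerable_or (IH G) (enumerable_image
  (fun u : {_ : fm G & fm G} => Imp (projT1 u) (projT2 u)) ff).
have u1 := enumerable_or u0 (enumerable_image
  (fun u : {_ : fm G & fm G} => And (projT1 u) (projT2 u)) ff).
have u2 := enumerable_or u1 (enumerable_image
  (fun u : {_ : fm G & fm G} => Or (projT1 u) (projT2 u)) ff).
have u3 := enumerable_or u2 (enumerable_union enumerable_ty (fun s =>
  enumerable_image (@All G s) (IH (s :: G)))).
have := enumerable_or u3 (enumerable_union enumerable_ty (fun s =>
  enumerable_image (@Ex G s) (IH (s :: G)))).
apply: enumerable_sub; case=> /=; try by move=> *; do 5!left.
- move=> A B; rewrite ltnS geq_max => /andP h; do 4!left; right.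
  by exists (existT _ A B).
- move=> A B; rewrite ltnS geq_max => /andP h; do 3!left; right.
  by exists (existT _ A B).
- move=> A B; rewrite ltnS geq_max => /andP h; do 2!left; right.
  by exists (existT _ A B).
- by move=> s A h; left; right; exists s => //; exists A.
- by move=> s A h; right; exists s => //; exists A.
Qed.

(** Pairing a code of a type with an arbitrarily large second component makes every type recur
    beyond any index, so a fresh parameter of a required type always exists. *)
Lemma type_stream : exists sq : nat -> ty, forall s n, exists2 m, n <= m & sq m = s.
Proof.
have [e he] := enumerable_ty.
exists (fun n => odflt ty0 (e (Cantor.of_nat n).1)) => s n.
have [k ek] := he s I; exists (Cantor.to_nat (k, n)).
  have := Cantor.to_nat_non_decreasing k n => /leP; apply: leq_trans.
  exact: leq_addr.
by rewrite Cantor.cancel_of_to /= ek.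
Qed.

(** * Completeness *)

Record structure := Structure {
  car : ty -> Type;
  app : forall s t, car (Arr s t) -> car s -> car t;
  zero_ : car ty0;
  one_ : car ty0;
  plus_ : car (Arr ty0 (Arr ty0 ty0));
  times_ : car (Arr ty0 (Arr ty0 ty0));
  pi_ : forall s t, car (Arr s (Arr t s));
  sigma_ : forall r s t, car (Arr (Arr r (Arr s t)) (Arr (Arr r s) (Arr r t)));
  rec_ : car (Arr (Arr ty0 (Arr ty0 ty0)) (Arr ty0 (Arr ty0 ty0)));
  eqr : car ty0 -> car ty0 -> Prop;
  ltr : car ty0 -> car ty0 -> Prop }.
Arguments app {_ _ _}.
Arguments zero_ {_}.
Arguments one_ {_}.
Arguments plus_ {_}.
Arguments times_ {_}.
Arguments pi_ {_}.
Arguments sigma_ {_}.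
Arguments rec_ {_}.

Definition env (M : structure) G := forall s, var G s -> car M s.

Fixpoint eval (M : structure) G (e : env M G) s (a : tm G s) : car M s :=
  match a with
  | Var _ v => e _ v
  | Zero => zero_
  | One => one_
  | Plus => plus_
  | Times => times_
  | Pi s t => pi_ s t
  | Sigma r s t => sigma_ r s t
  | Rec => rec_
  | App _ _ f a => app (eval e f) (eval e a)
  end.

Fixpoint sat (M : structure) G (e : env M G) (A : fm G) : Prop :=
  match A with
  | Eq0 a b => eqr (eval e a) (eval e b)
  | Lt0 a b => ltr (eval e a) (eval e b)
  | Bot => False
  | Imp A B => sat e A -> sat e B
  | And A B => sat e A /\ sat e B
  | Or A B => sat e A \/ sat e B
  | All s A => forall x : car M s, sat (scons (X := car M) x e) A
  | Ex s A => exists x : car M s, sat (scons (X := car M) x e) A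
  end.

Definition env0 (M : structure) : env M [::] := fun s v => var_nil _ v.
Arguments env0 : clear implicits.

Definition model (M : structure) (T : sentence -> Prop) : Prop :=
  forall A, T A -> sat (env0 M) A.

(** * Derivability from a theory under open assumptions *)

Section Deduction.
Variable T : sentence -> Prop.

Definition cl G (B : sentence) : fm G := subst (fun s v => var_nil _ v) B.

Definition ded G (H : list (fm G)) (A : fm G) : Prop :=
  exists L : list sentence,
    (forall B, In B L -> T B) /\ nd (List.map (cl G) L ++ H)%list A.

Lemma subst_cl G D (f : substitution G D) B : subst f (cl G B) = cl D B.
Proof. by rewrite /cl subst_comp; apply: eq_subst => s v; apply: var_nil v. Qed.

Lemma ded_subst G D (f : substitution G D) H A :
  ded H A -> ded (List.map (subst f) H) (subst f A).
Proof.
move=> [L [TL HL]]; exists L; split=> //; have := nd_subst HL f.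
rewrite map_app map_map.
by rewrite (map_ext _ (cl D)) // => B; rewrite subst_cl.
Qed.

Lemma ded_weak G (H H' : list (fm G)) A : incl H H' -> ded H A -> ded H' A.
Proof.
move=> HH' [L [TL HL]]; exists L; split=> //; apply: (nd_weak HL).
by apply: incl_app; [apply: incl_appl|apply: incl_appr].
Qed.

Lemma ded_nd G (H : list (fm G)) A : nd H A -> ded H A.
Proof. by move=> HA; exists nil; split. Qed.

Lemma ded_impI G (H : list (fm G)) A B : ded (A :: H) B -> ded H (Imp A B).
Proof.
move=> [L [TL HL]]; exists L; split=> //; apply: nd_impI; apply: (nd_weak HL).
move=> C; rewrite /= !in_app_iff /=; tauto.
Qed.

Lemma ded_impE G (H : list (fm G)) A B : ded H (Imp A B) -> ded H A -> ded H B.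
Proof.
move=> [L [TL HL]] [L' [TL' HL']]; exists (L ++ L')%list; split.
  by move=> C /in_app_iff[/TL|/TL'].
by apply: nd_impE (nd_weak HL _) (nd_weak HL' _) => C;
  rewrite map_app !in_app_iff; tauto.
Qed.

Lemma ded_cut G (H : list (fm G)) A B : ded H A -> ded (A :: H) B -> ded H B.
Proof. by move=> HA /ded_impI HB; apply: ded_impE HB HA. Qed.

(** The existential formula stays among the assumptions because a stage will contain it next to its
    witnessed instance. *)
Lemma ded_exE G (H : list (fm G)) s (A : fm (s :: G)) :
  ded (A :: List.map wk (Ex s A :: H)) Bot -> ded (Ex s A :: H) Bot.
Proof.
move=> [L [TL HL]]; exists L; split=> //.
apply: (@nd_exE _ _ s A).
  by apply: nd_hyp; rewrite in_app_iff; right; left.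
have -> : wk (@Bot G) = @Bot (s :: G) by [].
apply: (nd_weak HL); rewrite map_app map_map.
have -> : List.map (fun B => wk (s := s) (cl G B)) L = List.map (cl (s :: G)) L.
  by apply: map_ext => B; rewrite /wk subst_cl.
move=> C; rewrite /= !in_app_iff /= ?in_app_iff /=; tauto.
Qed.

End Deduction.

(** * Henkin's construction: deciding all formulas and adding witnesses *)

Section Henkin.
Variable sq : nat -> ty.
Hypothesis sqP : forall s n, exists2 m, n <= m & sq m = s.

(** Elements of the future term model. At level [n] the parameters below [n] appear as the variables
    of [ctx n]; this is how formulas refer to them. *)
Inductive ctm : ty -> Type :=
| CPar i : ctm (sq i)
| CZero : ctm ty0
| COne : ctm ty0
| CPlus : ctm (Arr ty0 (Arr ty0 ty0))
| CTimes : ctm (Arr ty0 (Arr ty0 ty0))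
| CPi s t : ctm (Arr s (Arr t s))
| CSigma r s t : ctm (Arr (Arr r (Arr s t)) (Arr (Arr r s) (Arr r t)))
| CRec : ctm (Arr (Arr ty0 (Arr ty0 ty0)) (Arr ty0 (Arr ty0 ty0)))
| CApp s t : ctm (Arr s t) -> ctm s -> ctm t.

Fixpoint ctx (n : nat) : list ty :=
  if n is n.+1 then sq n :: ctx n else [::].

Fixpoint inh G (s : ty) : tm G s :=
  if s is Arr r t then App (Pi t r) (inh G t) else Zero.

Fixpoint par n i : tm (ctx n) (sq i) :=
  if n is n.+1 then
    match PeanoNat.Nat.eq_dec n i with
    | left e => eq_rect n (fun i => tm (ctx n.+1) (sq i)) (Var V0) i e
    | right _ => wk_tm (par n i)
    end
  else inh _ _.

(* The term at level [n]; parameters not yet available get a junk value. *)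
Fixpoint back n s (d : ctm s) : tm (ctx n) s :=
  match d with
  | CPar i => par n i
  | CZero => Zero
  | COne => One
  | CPlus => Plus
  | CTimes => Times
  | CPi s t => Pi s t
  | CSigma r s t => Sigma r s t
  | CRec => Rec
  | CApp _ _ f a => App (back n f) (back n a)
  end.

Fixpoint low n s (d : ctm s) : Prop :=
  match d with
  | CPar i => i < n
  | CApp _ _ f a => low n f /\ low n a
  | _ => True
  end.

Fixpoint nm n : forall s, var (ctx n) s -> ctm s :=
  if n is n.+1 then scons (X := ctm) (CPar n) (@nm n) else fun s v => var_nil _ v.

(* For n <= m this embeds level n into level m; for m <= n it is a retraction. *)
Definition tr n m : substitution (ctx n) (ctx m) := fun s v => back m (nm v).

Lemma low_le n m s (d : ctm s) : n <= m -> low n d -> low m d.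
Proof.
move=> nm_; elim: d => //=; first by move=> i /leq_trans; apply.
by move=> {}s t f IHf a IHa [/IHf ? /IHa ?].
Qed.

Lemma low_ex s (d : ctm s) : exists n, low n d.
Proof.
elim: d => [i||||||||{}s t f [n fn] a [m am]]; try by exists 0.
  by exists i.+1 => /=.
by exists (maxn n m); split; [apply: low_le fn|apply: low_le am];
  rewrite ?leq_maxl ?leq_maxr.
Qed.

Lemma low_nm n s (v : var (ctx n) s) : low n (nm v).
Proof.
elim: n s v => [|n IH] s v; first exact: var_nil v.
move: s v; apply: var_ind_cons => [|s v] /=; first exact: ltnSn.
exact: low_le (IH s v).
Qed.

Lemma par_low n i : i < n -> exists2 v, par n i = Var v & nm v = CPar i.
Proof.
elim: n => [//|n IH] /=; rewrite ltnS leq_eqVlt => /orP ine.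
case: PeanoNat.Nat.eq_dec => [e|ne].
  by subst i; exists V0.
have /IH[v -> nv] : i < n by case: ine => // /eqP/esym.
by exists (VS v).
Qed.

Lemma back_nm n s (v : var (ctx n) s) : back n (nm v) = Var v.
Proof.
elim: n s v => [|n IH] s v; first exact: var_nil v.
move: s v; apply: var_ind_cons => [|s v] /=.
  by case: PeanoNat.Nat.eq_dec => [e|//]; rewrite (Prop_irrelevance e erefl).
have backS r (d : ctm r) : low n d -> back n.+1 d = wk_tm (back n d).
  elim: d => //= [i|r' t f IHf a IHa [/IHf -> /IHa ->]] //.
  by move=> lin; case: PeanoNat.Nat.eq_dec => // e; rewrite e ltnn in lin.
by rewrite backS ?IH //; apply: low_nm.
Qed.

Lemma tr_id n : @tr n n = fun _ v => Var v.
Proof. by apply: subst_ext => s v; apply: back_nm. Qed.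

Lemma subst_back m p s (d : ctm s) :
  low m d -> subst_tm (@tr m p) (back m d) = back p d.
Proof.
elim: d => //= [i /par_low[v -> nv]|{}s t f IHf a IHa [/IHf -> /IHa ->]] //.
by rewrite /= /tr nv.
Qed.

(** The bound [n <= m] matters: an intermediate level below [n] would overwrite parameters by
    junk. *)
Lemma tr_comp n m p : n <= m -> 
  (fun _ v => subst_tm (@tr m p) (@tr n m _ v)) = @tr n p.
Proof.
by move=> nm_; apply: subst_ext => s v; apply/subst_back/(low_le nm_)/low_nm.
Qed.

Lemma tr_succ n m : n <= m ->
  @tr n m.+1 = fun _ v => wk_tm (@tr n m _ v).
Proof.
move=> nm_; apply: subst_ext => s v; rewrite wk_tmE.
have := congr1 (fun f => f s v) (tr_comp m.+1 nm_); rewrite /= => <-.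
apply: eq_subst_tm => t w; rewrite /tr.
by have := back_nm (VS w : var (ctx m.+1) t).
Qed.

Lemma subst_tr n m p A : n <= m ->
  subst (@tr m p) (subst (@tr n m) A) = subst (@tr n p) A.
Proof. by move=> nm_; rewrite subst_comp tr_comp. Qed.

Lemma subst_tr_id n A : subst (@tr n n) A = A.
Proof. by rewrite tr_id subst_id. Qed.

Variable T : sentence -> Prop.
Notation ded := (ded T).

Definition stage := {n : nat & list (fm (ctx n))}.
Definition task := {n : nat & fm (ctx n)}.

Definition consistent (S : stage) : Prop := ~ ded (projT2 S) Bot.

Definition extends (S S' : stage) : Prop :=
  projT1 S <= projT1 S' /\
  forall B, In B (projT2 S) -> In (subst (@tr _ (projT1 S')) B) (projT2 S').

Definition witnessed k (A : fm (ctx k)) m (H : list (fm (ctx m))) : Prop :=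
  if A is Ex s B then
    exists v, In (inst (subst (up (@tr k m)) B) (Var v)) H
  else True.

Definition decides (u : task) (S : stage) : Prop :=
  let m := projT1 S in let A := subst (@tr _ m) (projT2 u) in
  projT1 u <= m /\
  ((In A (projT2 S) /\ witnessed (projT2 u) (projT2 S)) \/
   In (Imp A Bot) (projT2 S)).

(** A contradiction at level [m] is substituted back along [tr m n], which undoes [tr n m]; the junk
    given to the extra parameters is harmless, since the formulas of [H] do not mention them. *)
Lemma consistent_tr n m (H : list (fm (ctx n))) : n <= m ->
  ~ ded H Bot -> ~ ded (List.map (subst (@tr n m)) H) Bot.
Proof.
move=> nm_ nH /(ded_subst (@tr m n)); apply: contra_not nH; rewrite map_map /=.
rewrite (map_ext _ id) ?map_id // => A.
by rewrite subst_tr // subst_tr_id.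
Qed.

(** Lindenbaum step with witnesses: [A] is added if this is consistent, otherwise its negation. A
    consistent existential formula comes with an instance at a fresh parameter. *)
Lemma extend_stage (S : stage) (u : task) : consistent S ->
  exists S', consistent S' /\ extends S S' /\ decides u S'.
Proof.
case: S u => [n H] [k A]; rewrite /consistent /= => cH.
pose N := maxn n k; have nN : n <= N := leq_maxl _ _.
have kN : k <= N := leq_maxr _ _.
have cN := consistent_tr nN cH; set HN := List.map _ H in cN.
pose AN := subst (@tr k N) A.
have [cA|nA] := pselect (ded (AN :: HN) Bot).
  exists (existT _ N (Imp AN Bot :: HN)); split; last first.
    split; first by split=> // B HB; right; apply: in_map.
    by split=> //; right; left.
  by move=> /(ded_cut (ded_impI cA)).
have [[s [B eA]]|nE] : (exists s B, A = Ex s B) \/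
    forall m (H' : list (fm (ctx m))), witnessed A H'.
  by case: (A); try (by right); move=> s B; left; exists s, B.
all: swap 1 2.
  exists (existT _ N (AN :: HN)); split=> //; split.
    by split=> // B HB; right; apply: in_map.
  by split=> //; left; split; [left|apply: nE].
(* Since [p] is at least [N], the parameter is fresh; the stage moves to level [p.+1], where it is
   the variable [V0]. *)
have [p Np es] := sqP s N; subst s; subst A.
have Nq : N <= p.+1 by apply: leq_trans (leqnSn _).
pose C : fm (ctx p.+1) := subst (up (@tr k p)) B.
pose Hq := C :: List.map (subst (@tr N p.+1)) (AN :: HN).
exists (existT _ p.+1 Hq); split; last first.
  split.
    split=> /=; first exact: leq_trans Nq.
    move=> D HD /=; do 2!right; rewrite -(subst_tr p.+1 D nN).
    by apply/in_map/in_map.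
  split=> /=; first exact: leq_trans Nq.
  left; split.
    by right; left; apply: (subst_tr p.+1 (Ex (sq p) B) kN).
  exists V0; left; rewrite /inst subst_comp; apply: eq_subst.
  apply: var_ind_cons => //= s v; rewrite tr_succ ?(leq_trans kN) //.
  by rewrite !wk_tmE !subst_tm_comp.
have eA : subst (@tr N p) AN = Ex (sq p) C := subst_tr p (Ex (sq p) B) kN.
have := consistent_tr Np nA; apply: contra_not; rewrite map_cons eA => HB.
apply: ded_exE; rewrite /Hq map_cons in HB.
apply: ded_weak HB => D HD.
case: (in_inv HD) => [|{}HD]; first by left.
case: (in_inv HD) => [<-|{}HD].
  right; left; rewrite -eA /wk subst_comp; apply: eq_subst => s v.
  by rewrite tr_succ // wk_tmE.
do 2!right; rewrite map_map; move: HD; rewrite !in_map_iff.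
move=> [E [<- HE]]; exists E; split=> //.
rewrite /wk !subst_comp; apply: eq_subst => s v; rewrite tr_succ //=.
by rewrite wk_tmE.
Qed.

Lemma stage_chain (S0 : stage) : consistent S0 -> exists S : nat -> stage,
  [/\ S 0 = S0, forall k, consistent (S k), forall k, extends (S k) (S k.+1) &
      forall u, exists k, decides u (S k)].
Proof.
move=> c0.
have [e he] : exists e : nat -> option task, forall u, exists n, e n = Some u.
  have [e he] := enumerable_sigma enumerable_nat
    (fun n => enumerable_fm (ctx n)).
  by exists e => u; apply: he.
pose next (S : {S | consistent S}) (u : task) : {S' | consistent S'} :=
  let h := cid (extend_stage u (svalP S)) in exist _ (sval h) (svalP h).1.
have nextP S u : extends (sval S) (sval (next S u)) /\ decides u (sval (next S u)).
  by rewrite /next /=; case: cid => S' [? []].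
pose fix S k : {S | consistent S} :=
  if k is k.+1 then if e k is Some u then next (S k) u else S k
  else exist _ S0 c0.
exists (fun k => sval (S k)); split=> //.
- by move=> k; apply: svalP.
- move=> k /=; case: (e k) => [u|]; first by have [] := nextP (S k) u.
  by split=> // B HB; rewrite subst_tr_id.
- move=> u; have [n en] := he u; exists n.+1 => /=.
  by rewrite en; have [] := nextP (S n) u.
Qed.

Section Truth.
Variable S : nat -> stage.
Hypothesis S_cons : forall k, consistent (S k).
Hypothesis S_ext : forall k, extends (S k) (S k.+1).
Hypothesis S_dec : forall u, exists k, decides u (S k).

Notation lev k := (projT1 (S k)).

Definition tru n (A : fm (ctx n)) : Prop :=
  exists k, n <= lev k /\ In (subst (@tr n (lev k)) A) (projT2 (S k)).

Lemma chain_le k l : k <= l -> lev k <= lev l /\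
  forall B, In B (projT2 (S k)) -> In (subst (@tr _ (lev l)) B) (projT2 (S l)).
Proof.
move=> /subnKC <-; elim: (l - k) => [|d [IHl IH]].
  by rewrite addn0; split=> // B HB; rewrite subst_tr_id.
rewrite addnS; have [sl sI] := S_ext (k + d).
split; first exact: leq_trans sl.
by move=> B /IH /sI; rewrite subst_tr.
Qed.

Lemma tru_stages n (H : list (fm (ctx n))) : (forall B, In B H -> tru B) ->
  forall k0, exists k, [/\ k0 <= k, n <= lev k &
    forall B, In B H -> In (subst (@tr n (lev k)) B) (projT2 (S k))].
Proof.
move=> + k0; elim: H => [_|A H IH HA].
  have [k [/= nk _]] := S_dec (existT _ n (Bot : fm (ctx n))).
  exists (maxn k0 k); split=> //; first exact: leq_maxl.
  exact: leq_trans (chain_le (leq_maxr _ _)).1.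
have [|k [k0k nk Hk]] := IH; first by move=> B HB; apply: HA; right.
have [|l [nl Al]] := HA A; first by left.
have [kk Ik] := chain_le (leq_maxl k l).
have [ll Il] := chain_le (leq_maxr k l).
exists (maxn k l); split.
- exact: leq_trans (leq_maxl _ _).
- exact: leq_trans ll.
move=> B [<-|/Hk HB]; first by rewrite -(subst_tr _ A nl); apply: Il.
by rewrite -(subst_tr _ B nk); apply: Ik.
Qed.

Lemma tru_consistent n (H : list (fm (ctx n))) :
  (forall B, In B H -> tru B) -> ~ ded H Bot.
Proof.
move=> /tru_stages /(_ 0) [k [_ nk Hk]] /(ded_subst (@tr n (lev k))) HB.
apply: (S_cons (k := k)); apply: ded_weak HB => B.
by rewrite in_map_iff => -[C [<- /Hk]].
Qed.

Lemma tru_dec n (A : fm (ctx n)) : tru A \/ tru (Imp A Bot).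
Proof.
have [k [/= nk]] := S_dec (existT _ n A).
by case=> [[Ak _]|Ak]; [left|right]; exists k.
Qed.

Lemma tru_ded n (H : list (fm (ctx n))) A :
  (forall B, In B H -> tru B) -> ded H A -> tru A.
Proof.
move=> Ht HA; have [//|nA] := tru_dec A.
have [] := @tru_consistent n (Imp A Bot :: H).
  by move=> B [<-|/Ht].
apply: (@ded_impE _ _ _ A).
  by apply: ded_nd; apply: nd_hyp; left.
by apply: ded_weak HA => B HB; right.
Qed.

Lemma tru_nd n (H : list (fm (ctx n))) A :
  (forall B, In B H -> tru B) -> nd H A -> tru A.
Proof. by move=> Ht /(@ded_nd T); apply: tru_ded. Qed.

Lemma tru_neg n (A : fm (ctx n)) : tru (Imp A Bot) <-> ~ tru A.
Proof.
split=> [nA tA|]; last by case: (tru_dec A).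
apply: (@tru_consistent n [:: Imp A Bot; A]); first by move=> B [<-|[<-|[]]].
by apply: ded_nd; apply: (@nd_impE _ _ A); apply: nd_hyp; [left|right; left].
Qed.

(** Only the upward direction needs stages. Downwards, a formula that is not true at level [n] has a
    true negation there, and that negation moves up. *)
Lemma tru_tr n m (A : fm (ctx n)) : n <= m -> tru (subst (@tr n m) A) <-> tru A.
Proof.
move=> nm_.
have up_ B : tru B -> tru (subst (@tr n m) B).
  move=> tB; have [|k [_ mk Hk]] := @tru_stages m nil _ 0; first by [].
  have [|l [kl nl Bl]] := @tru_stages n [:: B] _ k; first by move=> ? [<-|[]].
  have ml : m <= lev l := leq_trans mk (chain_le kl).1.
  by exists l; split=> //; rewrite subst_tr //; apply: Bl; left.
split; last exact: up_.
by move=> tA; case: (tru_dec A) => // /up_ /= /tru_neg.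
Qed.

Lemma tru_ex n s (B : fm (s :: ctx n)) : tru (Ex s B) ->
  exists m (v : var (ctx m) s), n <= m /\ tru (inst (subst (up (@tr n m)) B) (Var v)).
Proof.
move=> tB; have [k [/= nk [[_ [v Hv]]|nB]]] := S_dec (existT _ n (Ex s B)).
  by exists (lev k), v; split=> //; exists k; rewrite subst_tr_id.
have : tru (Imp (Ex s B) Bot) by exists k.
by move=> /tru_neg.
Qed.

End Truth.
End Henkin.

(** * Semantics of substitution *)

Section Eval.
Variable M : structure.

Lemma env_eq G (e e' : env M G) : (forall s v, e s v = e' s v) -> e = e'.
Proof. exact: (@subst_ext G (car M)). Qed.

Lemma eval_ren G D (r : renaming G D) (e : env M D) s (a : tm G s) :
  eval e (ren_tm r a) = eval (fun _ v => e _ (r _ v)) a.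
Proof. by elim: a => //= {}s t f -> a ->. Qed.

Lemma eval_subst G D (f : substitution G D) (e : env M D) s (a : tm G s) :
  eval e (subst_tm f a) = eval (fun _ v => eval e (f _ v)) a.
Proof. by elim: a => //= {}s t h -> a ->. Qed.

Lemma sat_subst G (A : fm G) : forall D (f : substitution G D) (e : env M D),
  sat e (subst f A) <-> sat (fun _ v => eval e (f _ v)) A.
Proof.
elim: A => {G} [G a b|G a b|G|G A IA B IB|G A IA B IB|G A IA B IB|G s A IA|G s A IA]
  D f e /=; rewrite ?eval_subst //.
- by rewrite IA IB.
- by rewrite IA IB.
- by rewrite IA IB.
- have h x : (fun _ v => eval (scons (X := car M) x e) (up f (s := s) v)) =
    scons (X := car M) x (fun _ v => eval e (f _ v)).
    by apply: scons_ext => // t v; rewrite /= wk_tmE eval_subst.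
  by split=> Ax x; have := Ax x; rewrite IA h.
- have h x : (fun _ v => eval (scons (X := car M) x e) (up f (s := s) v)) =
    scons (X := car M) x (fun _ v => eval e (f _ v)).
    by apply: scons_ext => // t v; rewrite /= wk_tmE eval_subst.
  by split=> -[x Ax]; exists x; move: Ax; rewrite IA h.
Qed.

Lemma sat_inst G s (A : fm (s :: G)) a (e : env M G) :
  sat e (inst A a) <-> sat (scons (X := car M) (eval e a) e) A.
Proof.
rewrite sat_subst; set e1 := (X in sat X A); set e2 := scons _ _.
by rewrite (_ : e1 = e2) //; apply: scons_ext.
Qed.

Lemma sat_close G (A : fm G) :
  sat (env0 M) (close A) <-> forall e : env M G, sat e A.
Proof.
elim: G A => [|s G IH] A /=.
  split=> [+ e|]; last exact.
  by rewrite (_ : e = env0 M) //; apply: env_eq => s v; apply: var_nil v.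
rewrite IH /=; split=> h e => [|x]; last exact: h.
have := h (fun t v => e t (VS v)) (e s V0).
rewrite (_ : scons _ _ = e) //; exact: scons_ext.
Qed.

End Eval.

(** * The extensional collapse *)

Section Quotient.
Variable M : structure.
Hypothesis M_refl : forall x : car M ty0, eqr x x.
Hypothesis M_cong : forall G (e : env M G) B x y, eqr x y ->
  sat (scons (X := car M) x e) B -> sat (scons (X := car M) y e) B.
Hypothesis M_ext : forall r t, sat (env0 M) (ax_ext r t).

Fixpoint eqv (s : ty) : car M s -> car M s -> Prop :=
  if s is Arr s t then fun x y => forall z, eqv (app x z) (app y z) else @eqr M.

Lemma sat_eqt t G (e : env M G) (a b : tm G t) :
  sat e (eqt a b) <-> eqv (eval e a) (eval e b).
Proof.
elim: t G e a b => [|s _ t IH] G e a b //=.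
by split=> h z; have := h z; rewrite IH /= /lift !eval_ren.
Qed.

Lemma eqr_sym x y : @eqr M x y -> eqr y x.
Proof.
move=> xy; have := M_cong (e := scons (X := car M) x (env0 M)) 
  (B := Eq0 (Var V0) (Var (VS V0))) xy; apply; exact: M_refl.
Qed.

Lemma eqr_trans x y z : @eqr M x y -> eqr y z -> eqr x z.
Proof.
move=> xy yz; have := M_cong (e := scons (X := car M) x (env0 M)) 
  (B := Eq0 (Var (VS V0)) (Var V0)) yz; exact.
Qed.

Lemma ltr_eqr x y x' y' : @eqr M x x' -> eqr y y' -> ltr x y -> ltr x' y'.
Proof.
move=> xx yy xy.
have := M_cong (e := scons (X := car M) x' (env0 M))
  (B := Lt0 (Var (VS V0)) (Var V0)) yy; apply.
by have := M_cong (e := scons (X := car M) y (env0 M))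
  (B := Lt0 (Var V0) (Var (VS V0))) xx; apply.
Qed.

Lemma eqv_refl s (x : car M s) : eqv x x.
Proof. by elim: s x => [|s _ t IH] x; [apply: M_refl|move=> z; apply: IH]. Qed.

Lemma eqv_sym s (x y : car M s) : eqv x y -> eqv y x.
Proof.
by elim: s x y => [|s _ t IH] x y; [apply: eqr_sym|move=> xy z; apply/IH/xy].
Qed.

Lemma eqv_trans s (x y z : car M s) : eqv x y -> eqv y z -> eqv x z.
Proof.
elim: s x y z => [|s _ t IH] x y z; first exact: eqr_trans.
by move=> xy yz u; apply: IH (xy u) (yz u).
Qed.

(** Congruence in the function is built into [eqv]; congruence in the argument is the extensionality
    axiom. Application of classes thus agrees with application of representatives. *)
Lemma eqv_app s t (f g : car M (Arr s t)) x y :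
  eqv f g -> eqv x y -> eqv (app f x) (app g y).
Proof.
move=> fg xy; apply: eqv_trans (fg y).
have := @M_ext s t; rewrite /ax_ext /= => /(_ x y f).
by rewrite !sat_eqt; apply.
Qed.

Local Notation cl := (cls (@eqv _)).

Lemma clsE s (x y : car M s) : cl x = cl y <-> eqv x y.
Proof. exact: (clsP (@eqv_refl s) (@eqv_sym s) (@eqv_trans s)). Qed.

Lemma eqv_rep s (x : car M s) : eqv (rep (cl x)) x.
Proof. exact: (rep_cls (@eqv_refl s) (@eqv_sym s) (@eqv_trans s)). Qed.

Definition quotient : structure := {|
  car s := quot (@eqv s);
  app s t F X := cl (app (rep F) (rep X));
  zero_ := cl zero_;
  one_ := cl one_;
  plus_ := cl plus_;
  times_ := cl times_;
  pi_ s t := cl (pi_ s t);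
  sigma_ r s t := cl (sigma_ r s t);
  rec_ := cl rec_;
  eqr := eq;
  ltr X Y := ltr (rep X) (rep Y) |}.

Definition cls_env G (e : env M G) : env quotient G := fun s v => cl (e s v).

Lemma eval_quotient G (e : env M G) s (a : tm G s) :
  eval (cls_env e) a = cl (eval e a).
Proof.
elim: a => //= {}s t f -> a ->.
by apply/clsE; apply: eqv_app; apply: eqv_rep.
Qed.

Lemma sat_quotient G (A : fm G) : forall e : env M G,
  sat (cls_env e) A <-> sat e A.
Proof.
have cls_scons G' s (e : env M G') (x : car M s) :
    cls_env (scons (X := car M) x e) = scons (X := car quotient) (cl x) (cls_env e).
  exact: scons_ext.
elim: A => {G} [G a b|G a b|G|G A IA B IB|G A IA B IB|G A IA B IB|G s A IA|G s A IA]
  e /=; rewrite ?IA ?IB //.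
- by rewrite !eval_quotient; apply: clsE.
- rewrite !eval_quotient; split; apply: ltr_eqr; try exact: eqv_rep;
  by apply: eqr_sym; apply: (@eqv_rep ty0).
- split=> h x; first by rewrite -IA cls_scons; apply: h.
  by rewrite -(repK x) -cls_scons IA; apply: h.
- split=> -[x h].
    by exists (rep x); rewrite -IA cls_scons repK.
  by exists (cl x); rewrite -cls_scons IA.
Qed.

Lemma quotient_ext s t (F H : car quotient (Arr s t)) :
  (forall X, app F X = app H X) -> F = H.
Proof.
move=> FH; rewrite -(repK F) -(repK H); apply/clsE => z.
have /clsE := FH (cl z) => h.
apply: eqv_trans (eqv_trans h _).
  by apply: eqv_app; [apply: eqv_refl|apply/eqv_sym/eqv_rep].
by apply: eqv_app; [apply: eqv_refl|apply/eqv_rep].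
Qed.

End Quotient.

(** * The term model and the truth lemma *)

Section TermModel.
Variable sq : nat -> ty.
Hypothesis sqP : forall s n, exists2 m, n <= m & sq m = s.
Variable T : sentence -> Prop.
Variable S : nat -> stage sq.
Hypothesis S_cons : forall k, consistent T (S k).
Hypothesis S_ext : forall k, extends (S k) (S k.+1).
Hypothesis S_dec : forall u, exists k, decides u (S k).

Notation ctm := (ctm sq).
Notation ctx := (ctx sq).
Notation tru := (tru S).

Definition bk n G (e : forall s, var G s -> ctm s) : substitution G (ctx n) :=
  fun s v => back n (e s v).
Definition lowe n G (e : forall s, var G s -> ctm s) : Prop :=
  forall s v, low n (e s v).

Definition tru_rel (R : forall n, tm (ctx n) ty0 -> tm (ctx n) ty0 -> fm (ctx n))
    (d d' : ctm ty0) : Prop :=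
  exists n, low n d /\ low n d' /\ tru (R n (back n d) (back n d')).

Definition term_structure : structure := {|
  car := ctm;
  app s t f a := CApp f a;
  zero_ := CZero sq;
  one_ := COne sq;
  plus_ := CPlus sq;
  times_ := CTimes sq;
  pi_ := CPi sq;
  sigma_ := CSigma sq;
  rec_ := CRec sq;
  eqr := tru_rel (fun n => @Eq0 (ctx n));
  ltr := tru_rel (fun n => @Lt0 (ctx n)) |}.

Lemma low_env G (e : forall s, var G s -> ctm s) : exists n, lowe n e.
Proof.
elim: G e => [|s G IH] e; first by exists 0 => s v; apply: var_nil v.
have [n ne] := IH (fun t v => e t (VS v)); have [m me] := low_ex (e s V0).
exists (maxn n m); apply: var_ind_cons => [|t v].
  exact: low_le (leq_maxr _ _) me.
exact: low_le (leq_maxl _ _) (ne t v).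
Qed.

(** Truth of a formula about given elements does not depend on the level, so levels can be raised at
    will in the truth lemma. *)
Lemma tru_level n m G (e : forall s, var G s -> ctm s) A :
  lowe n e -> lowe m e -> tru (subst (bk n e) A) <-> tru (subst (bk m e) A).
Proof.
have h p q : p <= q -> lowe p e -> tru (subst (bk p e) A) <-> tru (subst (bk q e) A).
  move=> pq pe; rewrite -(tru_tr S_cons S_ext S_dec _ pq) subst_comp.
  by rewrite (@eq_subst _ _ _ (bk q e)) // => s v; apply: subst_back.
by move=> ne me; rewrite (h _ _ (leq_maxl n m) ne) (h _ _ (leq_maxr n m) me).
Qed.

Lemma eval_low n G (e : env term_structure G) s (a : tm G s) :
  lowe n e -> low n (eval e a).
Proof. by move=> ne; elim: a => //= {}s t f IHf a IHa. Qed.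

Lemma eval_back n G (e : env term_structure G) s (a : tm G s) :
  back n (eval e a) = subst_tm (bk n e) a.
Proof. by elim: a => //= {}s t f -> a ->. Qed.

Lemma sat_rel (R : forall G, tm G ty0 -> tm G ty0 -> fm G) :
  (forall G D (f : substitution G D) a b,
    subst f (R G a b) = R D (subst_tm f a) (subst_tm f b)) ->
  forall n G (e : env term_structure G) a b, lowe n e ->
  tru_rel (fun n => R (ctx n)) (eval e a) (eval e b) <-> tru (subst (bk n e) (R G a b)).
Proof.
move=> RE n G e a b ne; split; last first.
  by exists n; split; [exact: eval_low|split; [exact: eval_low|rewrite !eval_back -RE]].
move=> [m [ma [mb]]].
(* Both elements are packed into one environment, so that [tru_level] can change the level. *)
pose e2 := scons (X := ctm) (eval e a) (scons (X := ctm) (eval e b) (@env0 term_structure)).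
have le p : low p (eval e a) -> low p (eval e b) -> lowe p e2.
  move=> pa pb; do 2![apply: var_ind_cons => //].
  by move=> s v; apply: var_nil v.
have E p : R (ctx p) (back p (eval e a)) (back p (eval e b)) =
    subst (bk p e2) (R _ (Var V0) (Var (VS V0))) by rewrite RE.
rewrite E (tru_level _ (le _ ma mb) (le n (eval_low _ ne) (eval_low _ ne))).
by rewrite -E !eval_back -RE.
Qed.

Lemma lowe_scons n G (e : forall s, var G s -> ctm s) s (d : ctm s) :
  low n d -> lowe n e -> lowe n (scons (X := ctm) d e).
Proof. by move=> nd ne; apply: var_ind_cons. Qed.

Lemma bk_scons n G (e : forall s, var G s -> ctm s) s (d : ctm s) A :
  subst (bk n (scons (X := ctm) d e)) A = inst (subst (up (bk n e)) A) (back n d).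
Proof.
rewrite /inst subst_comp; apply: eq_subst; apply: var_ind_cons => //= t v.
by rewrite wk_tmE subst_tm_comp subst_tm_id.
Qed.

(** Truth lemma. The level is quantified inside the induction, because a witness or an arbitrary
    element raises it. *)
Lemma sat_term G (A : fm G) : forall n (e : env term_structure G), lowe n e ->
  sat e A <-> tru (subst (bk n e) A).
Proof.
have nd1 := tru_nd S_cons S_ext S_dec.
have neg := tru_neg S_cons S_ext S_dec.
have lift n m (nm_ : n <= m) G' (e : env term_structure G') : lowe n e -> lowe m e.
  by move=> ne s v; apply: low_le (ne s v).
elim: A => {G} [G a b|G a b|G|G A IA B IB|G A IA B IB|G A IA B IB|G s A IA|G s A IA]
  n e ne /=.
- exact: (sat_rel (R := @Eq0)).
- exact: (sat_rel (R := @Lt0)).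
- split=> // tB; apply: (tru_consistent S_cons S_ext S_dec (H := [:: Bot])).
    by move=> B [<-|[]]; apply: tB.
  by apply: ded_nd; apply: nd_hyp; left.
- rewrite (IA n) // (IB n) //; set A' := subst _ A; set B' := subst _ B.
  split=> [AB|tAB tA].
    have [tA|nA] := pselect (tru A').
      apply: (nd1 _ [:: B']); first by move=> C [<-|[]]; apply: AB.
      by apply: nd_impI; apply: nd_hyp; right; left.
    apply: (nd1 _ [:: Imp A' Bot]); first by move=> C [<-|[]]; apply/neg.
    apply: nd_impI; apply: nd_raa; apply: (@nd_impE _ _ A').
      by apply: nd_hyp; right; right; left.
    by apply: nd_hyp; right; left.
  apply: (nd1 _ [:: Imp A' B'; A']); first by move=> C [<-|[<-|[]]].
  by apply: (@nd_impE _ _ A'); apply: nd_hyp; [left|right; left].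
- rewrite (IA n) // (IB n) //; set A' := subst _ A; set B' := subst _ B.
  split=> [[tA tB]|tAB].
    apply: (nd1 _ [:: A'; B']); first by move=> C [<-|[<-|[]]].
    by apply: nd_andI; apply: nd_hyp; [left|right; left].
  split; apply: (nd1 _ [:: And A' B']); try by move=> C [<-|[]].
    by apply: (@nd_andE1 _ _ _ B'); apply: nd_hyp; left.
  by apply: (@nd_andE2 _ _ A'); apply: nd_hyp; left.
- rewrite (IA n) // (IB n) //; set A' := subst _ A; set B' := subst _ B.
  split=> [[tA|tB]|tAB].
  + apply: (nd1 _ [:: A']); first by move=> C [<-|[]].
    by apply: nd_orI1; apply: nd_hyp; left.
  + apply: (nd1 _ [:: B']); first by move=> C [<-|[]].
    by apply: nd_orI2; apply: nd_hyp; left.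
  have [tA|/neg nA] := pselect (tru A'); [by left|right].
  apply: (nd1 _ [:: Or A' B'; Imp A' Bot]); first by move=> C [<-|[<-|[]]].
  apply: (@nd_orE _ _ A' B'); first by apply: nd_hyp; left.
    apply: nd_raa; apply: (@nd_impE _ _ A').
      by apply: nd_hyp; do 3!right; left.
    by apply: nd_hyp; right; left.
  by apply: nd_hyp; left.
- set A' := subst _ A; split=> [Ax|tA d].
    (* If the universal formula were not true, classical logic would make the existential of the
       negated body true, and its Henkin witness would contradict [Ax]. *)
    have [//|/neg nA] := pselect (tru (All s A')).
    have : tru (Ex s (Imp A' Bot)).
      apply: (nd1 _ [:: Imp (All s A') Bot]); first by move=> C [<-|[]].
      apply: nd_raa; apply: (@nd_impE _ _ (All s A')).
        by apply: nd_hyp; right; left.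
      apply: nd_allI; apply: nd_raa.
      have E : Bot = wk (s := s) (@Bot (ctx n)) by [].
      rewrite {2}E.
      apply: (@nd_impE _ _ (wk (Ex s (Imp A' Bot)))).
        by apply: nd_hyp; right; left.
      rewrite /wk /=; apply: (@nd_exI _ _ _ _ (Var V0)).
      rewrite /inst /= subst_comp /=.
      rewrite (@eq_subst _ _ _ (fun _ v => Var v)) ?subst_id; last first.
        by apply: var_ind_cons.
      by apply: nd_hyp; left.
    move=> /(tru_ex S_cons S_ext S_dec) [m [v [nm_]]].
    rewrite [subst _ _]/= [inst _ _]/= => /neg nAv; case: nAv.
    have := Ax (nm v).
    rewrite (IA m); last by apply: lowe_scons (lift _ _ nm_ _ _ ne); apply: low_nm.
    rewrite bk_scons back_nm /A' subst_comp up_comp.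
    by rewrite (_ : (fun _ _ => _) = bk m e) //;
      apply: subst_ext => t w; apply: subst_back.
  have [m0 m0d] := low_ex d; pose m := maxn n m0.
  have me := lift _ _ (leq_maxl n m0) _ _ ne.
  have md := low_le (leq_maxr n m0) m0d.
  rewrite (IA m); last exact: lowe_scons.
  rewrite bk_scons.
  have := (tru_level (All s A) ne me).1 tA; rewrite /= => tA'.
  apply: (nd1 _ [:: All s (subst (up (bk m e)) A)]); first by move=> C [<-|[]].
  by apply: nd_allE; apply: nd_hyp; left.
- set A' := subst _ A; split=> [[d Ad]|].
    have [m0 m0d] := low_ex d; pose m := maxn n m0.
    have me := lift _ _ (leq_maxl n m0) _ _ ne.
    have md := low_le (leq_maxr n m0) m0d.
    apply/(tru_level (Ex s A) ne me).
    move: Ad; rewrite (IA m); last exact: lowe_scons.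
    rewrite bk_scons => tA.
    apply: (nd1 _ [:: inst (subst (up (bk m e)) A) (back m d)]).
      by move=> C [<-|[]].
    by apply: (@nd_exI _ _ _ _ (back m d)); apply: nd_hyp; left.
  move=> /(tru_ex S_cons S_ext S_dec) [m [v [nm_ tA]]]; exists (nm v).
  rewrite (IA m); last by apply: lowe_scons (lift _ _ nm_ _ _ ne); apply: low_nm.
  move: tA; rewrite bk_scons back_nm /A' subst_comp up_comp.
  by rewrite (_ : (fun _ _ => _) = bk m e) //;
    apply: subst_ext => t w; apply: subst_back.
Qed.

Lemma term_refl (x : car term_structure ty0) : eqr x x.
Proof.
have [n nx] := low_ex x; exists n; do 2!split=> //.
by apply: (tru_nd S_cons S_ext S_dec (H := nil)) => //; apply: nd_eq_refl.
Qed.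

Lemma term_cong G (e : env term_structure G) B (x y : car term_structure ty0) :
  eqr x y -> sat (M := term_structure) (scons (X := ctm) x e) B ->
  sat (M := term_structure) (scons (X := ctm) y e) B.
Proof.
have [n ne] := low_env (scons (X := ctm) x (scons (X := ctm) y e)).
have nx : low n x := ne _ V0.
have ny : low n y := ne _ (VS V0).
have {}ne : lowe n e := fun s v => ne s (VS (VS v)).
pose e2 := scons (X := ctm) x (scons (X := ctm) y (@env0 term_structure)).
have ne2 : lowe n e2.
  by do 2![apply: lowe_scons => //] => s v; apply: var_nil v.
have h : sat (M := term_structure) e2 (Eq0 (Var V0) (Var (VS V0))) <-> _ :=
  sat_term (Eq0 (Var V0) (Var (VS V0))) ne2.
move=> /h{h} xy.
rewrite !(@sat_term _ B n) ?bk_scons; try exact: lowe_scons.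
set B' := subst _ B => Bx.
apply: (tru_nd S_cons S_ext S_dec (H := [:: Eq0 (back n x) (back n y); inst B' (back n x)])).
  by move=> C [<-|[<-|[]]].
by apply: (@nd_eq_subst _ _ _ (back n x)); apply: nd_hyp; [left|right; left].
Qed.

Lemma term_model (A : sentence) : 
  (exists L, (forall B, In B L -> T B) /\ nd L A) -> sat (env0 term_structure) A.
Proof.
move=> TA; have [n n0] := low_env (env0 term_structure).
rewrite (sat_term _ n0).
have [L [TL LA]] := TA.
apply: (tru_ded S_cons S_ext S_dec (H := nil)) => //.
exists L; split=> //; have := nd_subst LA (bk n (env0 term_structure)).
rewrite app_nil_r (map_ext _ (cl (ctx n))) // => B.
by apply: eq_subst => s v; apply: var_nil v.
Qed.

End TermModel.

Definition normal (M : structure) : Prop :=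
  (forall x y : car M ty0, eqr x y <-> x = y) /\
  (forall s t (f g : car M (Arr s t)), (forall x, app f x = app g x) -> f = g).

(* Extensionality is what allows the quotient of the term model to consist of
   actual functions. *)
Theorem completeness (T : sentence -> Prop) (A : sentence) :
  (forall r t, T (ax_ext r t)) ->
  (forall M, normal M -> model M T -> sat (env0 M) A) -> proves T A.
Proof.
move=> Text TA; apply: contrapT => nTA.
have [sq sqP] := type_stream.
pose S0 : stage sq := existT _ 0 [:: Imp A Bot].
have c0 : consistent T S0.
  move=> [L [TL LB]]; apply: nTA; exists L; split=> //.
  apply: nd_raa; apply: (nd_weak LB) => B.
  rewrite in_app_iff in_map_iff => -[[C [<- LC]]|[<-|[]]]; last by left.
  right; rewrite /cl (@eq_subst _ _ _ (fun _ v => Var v)) ?subst_id //.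
  by move=> s v; apply: var_nil v.
have [S [S_0 S_cons S_ext S_dec]] := stage_chain sqP c0.
pose M := term_structure S.
have Mmodel B : (exists L, (forall B, In B L -> T B) /\ nd L B) -> sat (env0 M) B.
  exact: (term_model S_cons S_ext S_dec).
have Mext r t : sat (env0 M) (ax_ext r t).
  apply: Mmodel; exists [:: ax_ext r t]; split; first by move=> B [<-|[]].
  by apply: nd_hyp; left.
have Mrefl := @term_refl _ _ _ S_cons S_ext S_dec.
have Mcong := @term_cong _ _ _ S_cons S_ext S_dec.
have Qsat B : sat (env0 (quotient M)) B <-> sat (env0 M) B.
  rewrite -(sat_quotient Mrefl Mcong Mext).
  by rewrite (_ : cls_env _ = env0 _) //; apply: env_eq => s v; apply: var_nil v.
have /TA /(_ _)/Qsat MA : normal (quotient M).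
  by split=> //; apply: (quotient_ext Mrefl Mcong Mext).
have {}MA : sat (env0 M) A.
  apply: MA => B TB; apply/Qsat; apply: Mmodel; exists [:: B].
  by split; [move=> C [<-|[]]|apply: nd_hyp; left].
have : tru S (Imp A Bot : fm (ctx sq 0)).
  exists 0; rewrite S_0; split=> //; left.
  by apply: esym; apply: (@subst_tr_id sq 0 (Imp A Bot)).
rewrite (tru_neg S_cons S_ext S_dec); apply.
have n0 : @lowe sq 0 _ (env0 M) by move=> s v; apply: var_nil v.
move: MA; rewrite (sat_term S_cons S_ext S_dec _ n0).
by rewrite (@eq_subst _ _ _ (fun _ v => Var v)) ?subst_id // => s v; apply: var_nil v.
Qed.

(** * The ordered field of a semiring *)

Import Order.TTheory GRing.Theory Num.Theory.
Local Open Scope ring_scope.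

Section Fractions.
Variable X : comNzSemiRingType.
Hypothesis addI : forall x y z : X, x + z = y + z -> x = y.
Hypothesis total : forall x y : X, exists z, y = x + z \/ x = y + z.
Hypothesis add_eq0 : forall x y : X, x + y = 0 -> x = 0.
Hypothesis mul_eq0 : forall x y : X, x * y = 0 -> x = 0 \/ y = 0.

Lemma addI0 (x y : X) : x = x + y -> y = 0.
Proof. by move=> e; apply: (addI (z := x)); rewrite add0r addrC -e. Qed.

(** For want of subtraction, the larger of [x] and [y] is written as the other plus a remainder,
    whose product with [z] must vanish. *)
Lemma mulIs (x y z : X) : z <> 0 -> x * z = y * z -> x = y.
Proof.
move=> z0; have [w [->|->]] := total x y; rewrite mulrDl.
- by move=> /addI0/mul_eq0[->|//]; rewrite addr0.
- by move=> /esym/addI0/mul_eq0[->|//]; rewrite addr0.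
Qed.

(* The fraction (pos - neg) / den. *)
Record frac := Frac { pos : X; neg : X; den : X; den0 : den <> 0 }.

Definition eqf (u v : frac) : Prop :=
  pos u * den v + neg v * den u = pos v * den u + neg u * den v.

Lemma eqf_refl u : eqf u u.
Proof. by []. Qed.

Lemma eqf_sym u v : eqf u v -> eqf v u.
Proof. exact: esym. Qed.

Lemma eqf_trans u v w : eqf u v -> eqf v w -> eqf u w.
Proof.
rewrite /eqf => uv vw; apply: (mulIs (@den0 v)).
(* The summand supplies the terms in the numerator of [v] that occur when [uv] is multiplied by
   [den w] and [vw] by [den u]. *)
apply: (addI (z := neg v * den u * den w + pos v * den w * den u)).
transitivity ((pos u * den v + neg v * den u) * den w +
  (pos v * den w + neg w * den v) * den u); first by ring.
by rewrite uv vw; ring.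
Qed.

Lemma one_neq0 : (1 : X) <> 0.
Proof. exact/eqP/oner_neq0. Qed.

Lemma mul_neq0 (x y : X) : x <> 0 -> y <> 0 -> x * y <> 0.
Proof. by move=> x0 y0 /mul_eq0[]. Qed.

Definition fractions : Type := quot eqf.
Notation F := fractions.
Notation cl u := (cls eqf u : F).

Lemma clP u v : cl u = cl v <-> eqf u v.
Proof. exact: clsP eqf_refl eqf_sym eqf_trans u v. Qed.

Definition addf u v := Frac (pos u * den v + pos v * den u)
  (neg u * den v + neg v * den u) (mul_neq0 (@den0 u) (@den0 v)).
Definition oppf u := Frac (neg u) (pos u) (@den0 u).
Definition mulf u v := Frac (pos u * pos v + neg u * neg v)
  (pos u * neg v + neg u * pos v) (mul_neq0 (@den0 u) (@den0 v)).
Definition natf x := Frac (x) (0) one_neq0.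

Definition addF (x y : F) : F := cl (addf (rep x) (rep y)).
Definition oppF (x : F) : F := cl (oppf (rep x)).
Definition mulF (x y : F) : F := cl (mulf (rep x) (rep y)).

Lemma repP u : eqf (rep (cl u)) u.
Proof. exact: rep_cls eqf_refl eqf_sym eqf_trans u. Qed.

Lemma addFE u v : addF (cl u) (cl v) = cl (addf u v).
Proof.
apply/clP; move: (repP u) (repP v); rewrite /eqf /=.
set u' := rep _; set v' := rep _ => uu vv.
transitivity ((pos u' * den u + neg u * den u') * (den v * den v') +
  (pos v' * den v + neg v * den v') * (den u * den u')); first by ring.
by rewrite uu vv; ring.
Qed.

Lemma oppFE u : oppF (cl u) = cl (oppf u).
Proof.
apply/clP; move: (repP u); rewrite /eqf /= => uu.
by rewrite [LHS]addrC -uu addrC.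
Qed.

Lemma mulFE u v : mulF (cl u) (cl v) = cl (mulf u v).
Proof.
apply/clP; apply: (@eqf_trans _ (mulf u (rep (cl v)))).
  move: (repP u); rewrite /eqf /=; set u' := rep _; set v' := rep _ => uu.
  transitivity ((pos u' * den u + neg u * den u') * (pos v' * den v') +
    (pos u * den u' + neg u' * den u) * (neg v' * den v')); first by ring.
  by rewrite {1}uu -{2}uu; ring.
move: (repP v); rewrite /eqf /=; set v' := rep _ => vv.
transitivity ((pos v' * den v + neg v * den v') * (pos u * den u) +
  (pos v * den v' + neg v' * den v) * (neg u * den u)); first by ring.
by rewrite {1}vv -{2}vv; ring.
Qed.

Notation zeroF := (cl (natf 0)).
Notation oneF := (cl (natf 1)).

Lemma addFA : associative addF.
Proof.
elim/quotW=> u; elim/quotW=> v; elim/quotW=> w; rewrite !addFE.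
by apply/clP; rewrite /eqf /=; ring.
Qed.

Lemma addFC : commutative addF.
Proof.
by elim/quotW=> u; elim/quotW=> v; rewrite !addFE; apply/clP; rewrite /eqf /=; ring.
Qed.

Lemma add0F : left_id zeroF addF.
Proof. by elim/quotW=> u; rewrite !addFE; apply/clP; rewrite /eqf /=; ring. Qed.

Lemma addNF : left_inverse zeroF oppF addF.
Proof. by elim/quotW=> u; rewrite oppFE addFE; apply/clP; rewrite /eqf /=; ring. Qed.

Lemma mulFA : associative mulF.
Proof.
elim/quotW=> u; elim/quotW=> v; elim/quotW=> w; rewrite !mulFE.
by apply/clP; rewrite /eqf /=; ring.
Qed.

Lemma mulFC : commutative mulF.
Proof.
by elim/quotW=> u; elim/quotW=> v; rewrite !mulFE; apply/clP; rewrite /eqf /=; ring.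
Qed.

Lemma mul1F : left_id oneF mulF.
Proof. by elim/quotW=> u; rewrite !mulFE; apply/clP; rewrite /eqf /=; ring. Qed.

Lemma mulFDl : left_distributive mulF addF.
Proof.
elim/quotW=> u; elim/quotW=> v; elim/quotW=> w; rewrite !(addFE, mulFE).
by apply/clP; rewrite /eqf /=; ring.
Qed.

Lemma clz u : cl u = zeroF <-> pos u = neg u.
Proof. by rewrite clP /eqf /= !mulr1 !mul0r !addr0 add0r. Qed.

Lemma natFE x y : cl (natf x) = cl (natf y) <-> x = y.
Proof. by rewrite clP /eqf /= !mul0r !addr0 !mulr1. Qed.

Lemma oneF_neq0 : oneF <> zeroF.
Proof. by move=> /natFE /one_neq0. Qed.

Definition nneg (x : F) : Prop := exists n d (d0 : d <> 0), x = cl (Frac n 0 d0).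

Lemma nneg_total x : nneg x \/ nneg (oppF x).
Proof.
elim/quotW: x => u; have [z [e|e]] := total (pos u) (neg u); [right|left];
  exists z, (den u), (@den0 u); rewrite ?oppFE; apply/clP;
  by rewrite /eqf /= e; ring.
Qed.

(** A nonzero [n / d] without negative part is inverted to [d / n]; negation reduces the other sign
    to this case. *)
Lemma invF_ex x : x <> zeroF -> exists y, mulF y x = oneF.
Proof.
have inv_nneg y : nneg y -> y <> zeroF -> exists z, mulF z y = oneF.
  move=> [n [d [d0 ->]]] /clz /= n0; exists (cl (Frac d 0 n0)).
  by rewrite mulFE; apply/clP; rewrite /eqf /=; ring.
move=> x0; have [/inv_nneg|/inv_nneg h] := nneg_total x; first exact.
have [|z hz] := h.
  by move: x0; elim/quotW: x {h} => u; rewrite oppFE !clz /= => + e; apply.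
exists (oppF z); rewrite -hz; elim/quotW: x {h hz x0} => u.
by elim/quotW: z => w; rewrite !(oppFE, mulFE); apply/clP; rewrite /eqf /=; ring.
Qed.

Definition invF (x : F) : F :=
  if pselect (x <> zeroF) is left h then sval (cid (invF_ex h)) else zeroF.

HB.instance Definition _ := gen_eqMixin F.
HB.instance Definition _ := gen_choiceMixin F.
HB.instance Definition _ := GRing.isZmodule.Build F addFA addFC add0F addNF.

Lemma oneF_neq0b : oneF != 0.
Proof. exact/eqP/oneF_neq0. Qed.

HB.instance Definition _ :=
  GRing.Zmodule_isComNzRing.Build F mulFA mulFC mul1F mulFDl oneF_neq0b.

Lemma mulVF (x : F) : x != 0 -> invF x * x = 1.
Proof.
by move=> /eqP x0; rewrite /invF; case: pselect => // h; case: cid.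
Qed.

Lemma invF0 : invF 0 = 0.
Proof. by rewrite /invF; case: pselect. Qed.

HB.instance Definition _ := GRing.ComNzRing_isField.Build F mulVF invF0.

Definition leF (x y : F) : bool := `[< nneg (y - x) >].
Definition ltF (x y : F) : bool := (y != x) && leF x y.
Definition absF (x : F) : F := if leF 0 x then x else - x.

Lemma leF0 x : leF 0 x <-> nneg x.
Proof. by rewrite /leF subr0; split=> /asboolP. Qed.

Lemma leF0_add x y : leF 0 x -> leF 0 y -> leF 0 (x + y).
Proof.
rewrite !leF0 => -[n [d [d0 ->]]] [m [e [e0 ->]]].
exists (n * e + m * d), (d * e), (mul_neq0 d0 e0); rewrite [LHS]addFE.
by apply/clP; rewrite /eqf /=; ring.
Qed.

Lemma leF0_mul x y : leF 0 x -> leF 0 y -> leF 0 (x * y).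
Proof.
rewrite !leF0 => -[n [d [d0 ->]]] [m [e [e0 ->]]].
exists (n * m), (d * e), (mul_neq0 d0 e0); rewrite [LHS]mulFE.
by apply/clP; rewrite /eqf /=; ring.
Qed.

Lemma leF0_anti x : leF 0 x -> leF x 0 -> x = 0.
Proof.
rewrite leF0 /leF sub0r => -[n [d [d0 ->]]] /asboolP[m [e [e0]]].
rewrite [- _]oppFE => /clP; rewrite /eqf /= !mul0r add0r => h.
apply/clz => /=; have /esym/add_eq0/mul_eq0[//|//] : 0 = n * e + m * d.
by rewrite addrC -h.
Qed.

Lemma subF_ge0 x y : leF 0 (y - x) = leF x y.
Proof. by rewrite /leF subr0. Qed.

Lemma leF0_total x : leF 0 x || leF x 0.
Proof.
apply/orP; rewrite leF0 /leF sub0r; have [|h] := nneg_total x; first by left.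
by right; apply/asboolP.
Qed.

Lemma absFN x : absF (- x) = absF x.
Proof.
rewrite /absF; have h y : leF 0 (- y) = leF y 0 by rewrite -sub0r subF_ge0.
rewrite h opprK; have [x0|x0] := boolP (leF x 0).
  by case: ifP => // /leF0_anti/(_ x0) ->; rewrite oppr0.
by have := leF0_total x; rewrite (negbTE x0) orbF => ->.
Qed.

Lemma ge0_absF x : leF 0 x -> absF x = x.
Proof. by rewrite /absF => ->. Qed.

Lemma ltF_def x y : ltF x y = (y != x) && leF x y.
Proof. by []. Qed.

HB.instance Definition _ := Num.IntegralDomain_isLeReal.Build F
  leF0_add leF0_mul leF0_anti subF_ge0 leF0_total absFN ge0_absF ltF_def.

Lemma ordered_field_of_semiring : exists (K : realFieldType) (i : X -> K),
  [/\ i 0 = 0, i 1 = 1, forall x y, i (x + y) = i x + i y,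
      forall x y, i (x * y) = i x * i y & injective i /\ forall x, 0 <= i x].
Proof.
exists F, (fun x => cl (natf x)); split=> //.
- by move=> x y; rewrite [RHS]addFE; apply/clP; rewrite /eqf /=; ring.
- by move=> x y; rewrite [RHS]mulFE; apply/clP; rewrite /eqf /=; ring.
split; first by move=> x y /natFE.
by move=> x; apply/leF0; exists x, 1, one_neq0.
Qed.

End Fractions.

(** * Arithmetic in a model *)

Notation "x .: e" := (scons (X := car _) x e) (at level 60, right associativity).

Section Model.
Variable M : structure.
Hypothesis M_normal : normal M.
Hypothesis M_RCA : model M RCA0w.

Lemma eqrE (x y : car M ty0) : eqr x y <-> x = y.
Proof. exact: M_normal.1. Qed.

Lemma app_ext s t (f g : car M (Arr s t)) : (forall x, app f x = app g x) -> f = g.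
Proof. exact: M_normal.2. Qed.

Lemma sat_eqt_eq t G (e : env M G) (a b : tm G t) :
  sat e (eqt a b) <-> eval e a = eval e b.
Proof.
elim: t G e a b => [|s _ t IH] G e a b /=; first exact: eqrE.
split=> [h|ab x]; last first.
  by rewrite IH /= /lift !eval_ren; exact: (congr1 (fun f : car M (Arr s t) => app f x) ab).
by apply: app_ext => x; have := h x; rewrite IH /= /lift !eval_ren.
Qed.

Lemma app_pi s t x y : app (app (@pi_ M s t) x) y = x.
Proof.
have := M_RCA (RCA_Pi s t) => /= /(_ x y).
by rewrite sat_eqt_eq.
Qed.

Lemma app_sigma r s t x y z :
  app (app (app (@sigma_ M r s t) x) y) z = app (app x z) (app y z).
Proof.
have := M_RCA (RCA_Sigma r s t) => /= /(_ x y z).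
by rewrite sat_eqt_eq.
Qed.

Lemma app_rec0 f m : app (app (app (@rec_ M) f) m) zero_ = m.
Proof. by have := M_RCA RCA_Rec0 => /= /(_ f m) /eqrE. Qed.

Lemma app_recS f m n :
  app (app (app (@rec_ M) f) m) (app (app plus_ n) one_) =
  app (app f n) (app (app (app rec_ f) m) n).
Proof. by have := M_RCA RCA_RecS => /= /(_ f m n) /eqrE. Qed.

(** Combinatory completeness: the axioms for [Pi] and [Sigma] give the beta rule. *)
Lemma eval_abstract G s t (a : tm (s :: G) t) (e : env M G) x :
  app (eval e (abstract a)) x = eval (x .: e) a.
Proof.
(* The context is generalised to [D] with an equation, because induction on [a] cannot keep the
   index [s :: G] fixed. *)
have : forall D t (a : tm D t) (E : s :: G = D),
    app (eval e (abstract (eq_rect_r (tm^~ t) a E))) x =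
    eval (x .: e) (eq_rect_r (tm^~ t) a E).
  move=> D {}t {}a; elim: a => [r v|||||s1 t1|r1 s1 t1||r' t' f IHf b IHb] E; subst D;
    rewrite /eq_rect_r /=; try by rewrite app_pi.
  - move: r v; apply: var_ind_cons => [|r v] /=; last exact: app_pi.
    by rewrite app_sigma !app_pi.
  - by rewrite app_sigma; have := IHf erefl; have := IHb erefl;
      rewrite /eq_rect_r /= => -> ->.
by move=> /(_ _ _ a erefl).
Qed.

Lemma eval_lam G s t (f : tm (s :: G) s -> tm (s :: G) t) (e : env M G) x :
  app (eval e (lam s f)) x = eval (x .: e) (f (Var V0)).
Proof. exact: eval_abstract. Qed.

Lemma lift_refl G (e : env M G) s (a : tm G s) :
  eval e (lift (E := @Ext_refl G) a) = eval e a.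
Proof. by rewrite /lift eval_ren. Qed.

Lemma lift_step G D (E : Ext G D) r (x : car M r) (e : env M D) s (a : tm G s) :
  eval (x .: e) (lift (E := @Ext_step G D r E) a) = eval e (lift (E := E) a).
Proof. by rewrite /lift !eval_ren. Qed.

(** The only induction over the numbers of [M]. Later claims are first restated, by [suff], as
    satisfaction of an explicit quantifier-free formula with its parameters in the environment. *)
Lemma qf_induction G (A : fm (ty0 :: G)) (e : env M G) : qf A ->
  sat (zero_ .: e) A ->
  (forall n, sat (n .: e) A -> sat (app (app plus_ n) one_ .: e) A) ->
  forall n, sat (n .: e) A.
Proof.
move=> qA A0 AS.
have := M_RCA (RCA_QFind qA); rewrite sat_close => /(_ e) /=; apply.
split; first by rewrite sat_inst.
move=> n /AS; rewrite /at_succ sat_subst; set e1 := (X in sat X A -> _).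
set e2 := (X in _ -> sat X A).
by rewrite (_ : e1 = e2) //; apply: scons_ext.
Qed.

Lemma qf_choice G (A : fm (ty0 :: ty1 :: G)) (e : env M G) : qf A ->
  (forall x, exists n, sat (n .: x .: e) A) ->
  exists Y : car M ty2, forall x, sat (app Y x .: x .: e) A.
Proof.
move=> qA Ae.
have := M_RCA (RCA_QFAC qA); rewrite sat_close => /(_ e) /= /(_ Ae) [Y hY].
exists Y => x; have := hY x; rewrite sat_subst.
set e1 := (X in sat X A -> _); set e2 := (X in _ -> sat X A).
by rewrite (_ : e1 = e2) //; apply: scons_ext => //; apply: var_ind_cons.
Qed.

(** * The semiring of type 0 objects *)

Definition num : Type := car M ty0.
Definition add (x y : num) : num := app (app plus_ x) y.
Definition mul (x y : num) : num := app (app times_ x) y.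

Let ax A (h : ordered_semiring A) : sat (env0 M) A := M_RCA (RCA_semiring h).

Lemma num_addA : associative add.
Proof. by move=> x y z; have /= /(_ x y z) /eqrE/esym := ax ax_addA. Qed.
Lemma num_addC : commutative add.
Proof. by move=> x y; have /= /(_ x y) /eqrE := ax ax_addC. Qed.
Lemma num_add0 : left_id (zero_ : num) add.
Proof. by move=> x; rewrite num_addC; have /= /(_ x) /eqrE := ax ax_add0. Qed.
Lemma num_mulA : associative mul.
Proof. by move=> x y z; have /= /(_ x y z) /eqrE/esym := ax ax_mulA. Qed.
Lemma num_mulC : commutative mul.
Proof. by move=> x y; have /= /(_ x y) /eqrE := ax ax_mulC. Qed.
Lemma num_mul1 : left_id (one_ : num) mul.
Proof. by move=> x; rewrite num_mulC; have /= /(_ x) /eqrE := ax ax_mul1. Qed.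
Lemma num_mul0 : left_zero (zero_ : num) mul.
Proof. by move=> x; rewrite num_mulC; have /= /(_ x) /eqrE := ax ax_mul0. Qed.
Lemma num_mulDr : right_distributive mul add.
Proof. by move=> x y z; have /= /(_ x y z) /eqrE := ax ax_mulD. Qed.
Lemma num_mulDl : left_distributive mul add.
Proof. by move=> x y z; rewrite !(num_mulC _ z) num_mulDr. Qed.
Lemma ltr_irr (x : num) : ~ ltr x x.
Proof. exact: (ax ax_lt_irrefl). Qed.
Lemma ltr_trans (x y z : num) : ltr x y -> ltr y z -> ltr x z.
Proof. by have /= := ax ax_lt_trans; apply. Qed.
Lemma ltr_total (x y : num) : ltr x y \/ x = y \/ ltr y x.
Proof. by have /= /(_ x y) := ax ax_lt_total; rewrite eqrE. Qed.
Lemma ltr_add (x y z : num) : ltr x y -> ltr (add x z) (add y z).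
Proof. by have /= := ax ax_lt_add; apply. Qed.
Lemma ltr_mul (x y z : num) : ltr zero_ z -> ltr x y -> ltr (mul x z) (mul y z).
Proof. by have /= := ax ax_lt_mul; apply. Qed.
Lemma num_ltr01 : ltr (zero_ : num) one_.
Proof. exact: (ax ax_lt01). Qed.
Lemma ltr0 (x : num) : ltr zero_ x \/ zero_ = x.
Proof. by have /= /(_ x) := ax ax_le0; rewrite eqrE. Qed.
Lemma ltr_succ (x y : num) : ltr x (add y one_) -> ltr x y \/ x = y.
Proof. by have /= /(_ x y) h := ax ax_discrete => /h; rewrite eqrE. Qed.

HB.instance Definition _ := gen_eqMixin num.
HB.instance Definition _ := gen_choiceMixin num.
HB.instance Definition _ := GRing.isNmodule.Build num num_addA num_addC num_add0.
Lemma one_neq_zero : (one_ : num) != zero_.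
Proof. by apply/eqP => e; have := num_ltr01; rewrite e => /ltr_irr. Qed.
HB.instance Definition _ := GRing.Nmodule_isComNzSemiRing.Build num
  num_mulA num_mulC num_mul1 num_mulDl num_mul0 one_neq_zero.

(** * Rules for evaluating terms and formulas *)

Lemma eval_app G (e : env M G) s t (f : tm G (Arr s t)) a :
  eval e (App f a) = app (eval e f) (eval e a).
Proof. by []. Qed.

Lemma eval_var0 G (e : env M G) s (x : car M s) : eval (x .: e) (Var V0) = x.
Proof. by []. Qed.

Lemma eval_varS G (e : env M G) s (x : car M s) t (v : var G t) :
  eval (x .: e) (Var (VS v)) = eval e (Var v).
Proof. by []. Qed.

Lemma eval_zero G (e : env M G) : eval e Zero = zero_.
Proof. by []. Qed.

Lemma eval_one G (e : env M G) : eval e One = one_.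
Proof. by []. Qed.

Lemma eval_plus G (e : env M G) : eval e Plus = plus_.
Proof. by []. Qed.

Lemma eval_times G (e : env M G) : eval e Times = times_.
Proof. by []. Qed.

Lemma eval_rec G (e : env M G) : eval e Rec = rec_.
Proof. by []. Qed.

Definition evE := (eval_lam, lift_step, lift_refl, eval_app, eval_var0,
  eval_varS, eval_zero, eval_one, eval_plus, eval_times, eval_rec).

Lemma sat_eq0 G (e : env M G) a b : sat e (Eq0 a b) = (eval e a = eval e b).
Proof. exact/propext/eqrE. Qed.

Lemma sat_lt0 G (e : env M G) a b : sat e (Lt0 a b) = ltr (eval e a) (eval e b).
Proof. by []. Qed.

Lemma sat_bot G (e : env M G) : sat e Bot = False.
Proof. by []. Qed.

Lemma sat_imp G (e : env M G) A B : sat e (Imp A B) = (sat e A -> sat e B).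
Proof. by []. Qed.

Lemma sat_and G (e : env M G) A B : sat e (And A B) = (sat e A /\ sat e B).
Proof. by []. Qed.

Lemma sat_or G (e : env M G) A B : sat e (Or A B) = (sat e A \/ sat e B).
Proof. by []. Qed.

Lemma sat_all G (e : env M G) s (A : tm (s :: G) s -> fm (s :: G)) :
  sat e (all_ s A) = forall x, sat (x .: e) (A (Var V0)).
Proof. by []. Qed.

Lemma sat_ex G (e : env M G) s (A : tm (s :: G) s -> fm (s :: G)) :
  sat e (ex_ s A) = exists x, sat (x .: e) (A (Var V0)).
Proof. by []. Qed.

Lemma sat_leq G (e : env M G) a b :
  sat e (leq a b) = (ltr (eval e a) (eval e b) \/ eval e a = eval e b).
Proof. by rewrite /leq sat_or sat_lt0 sat_eq0. Qed.

Definition satE := (sat_leq, sat_eq0, sat_lt0, sat_bot, sat_imp, sat_and, sat_or,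
  sat_all, sat_ex).

(** * Predecessor, truncated subtraction and the passage to a field *)

Definition predN (x : num) : num := eval (x .: env0 M) (pred_ (Var V0)).
Definition monusN (x y : num) : num :=
  eval (x .: y .: env0 M) (monus (Var V0) (Var (VS V0))).

Lemma eval_pred G (e : env M G) a : eval e (pred_ a) = predN (eval e a).
Proof. by []. Qed.

Lemma eval_monus G (e : env M G) a b :
  eval e (monus a b) = monusN (eval e a) (eval e b).
Proof. by []. Qed.

Lemma predN0 : predN 0 = 0.
Proof. exact: app_rec0. Qed.

Lemma predNS x : predN (x + 1) = x.
Proof. by rewrite /predN /pred_ 3!eval_app app_recS !evE. Qed.

Lemma monusN0 x : monusN x 0 = x.
Proof. exact: app_rec0. Qed.

Lemma monusNS x y : monusN x (y + 1) = predN (monusN x y).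
Proof. by rewrite /monusN /monus 3!eval_app app_recS !(eval_pred, evE). Qed.

Definition arE := (eval_pred, eval_monus, evE).

Lemma addE (x y : num) : app (app plus_ x) y = x + y.
Proof. by []. Qed.

Lemma num_zero_succ (x : num) : x = 0 \/ x = predN x + 1.
Proof.
suff: sat (x .: env0 M) (Or (Eq0 (Var V0) Zero)
  (Eq0 (Var V0) (App (App Plus (pred_ (Var V0))) One))) by rewrite !satE !arE.
apply: qf_induction x => //; first by rewrite !satE; left.
by move=> n _; rewrite !satE !arE !addE predNS; right.
Qed.

Lemma monusNSS x y : monusN (x + 1) (y + 1) = monusN x y.
Proof.
suff: sat (y .: add x one_ .: x .: env0 M)
  (Eq0 (monus (Var (VS V0)) (App (App Plus (Var V0)) One))
    (monus (Var (VS (VS V0))) (Var V0))) by rewrite !satE !arE.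
apply: qf_induction y => //.
  by rewrite satE !arE addE monusNS !monusN0 predNS.
move=> n; rewrite !satE !arE !addE => e.
by rewrite monusNS e -monusNS.
Qed.

Lemma monusN_add x y : monusN (x + y) y = x.
Proof.
suff: sat (y .: x .: env0 M) (Eq0 (monus (App (App Plus (Var (VS V0))) (Var V0)) (Var V0))
  (Var (VS V0))) by rewrite satE !arE.
apply: qf_induction y => //.
  by rewrite satE !arE monusN0 addE addr0.
by move=> n; rewrite !satE !arE !addE addrA monusNSS.
Qed.

Lemma monusN_add0 x z : monusN x (x + z) = 0.
Proof.
suff: sat (z .: x .: env0 M)
  (Eq0 (monus (Var (VS V0)) (App (App Plus (Var (VS V0))) (Var V0))) Zero)
  by rewrite satE !arE.
apply: qf_induction z => //.
  by rewrite satE !arE addE addr0 -{1}[x]add0r monusN_add.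
move=> n; rewrite !satE !arE !addE addrA monusNS => ->.
exact: predN0.
Qed.

(** The existential is not quantifier-free; naming the difference by [monusN], in either direction,
    gives a formula to which induction on [y] applies. *)
Lemma num_sub (x y : num) : exists z, y = x + z \/ x = y + z.
Proof.
suff h : x = y + monusN x y \/ y = x + monusN y x.
  by case: h => h; [exists (monusN x y); right|exists (monusN y x); left].
suff: sat (y .: x .: env0 M) (Or
  (Eq0 (Var (VS V0)) (App (App Plus (Var V0)) (monus (Var (VS V0)) (Var V0))))
  (Eq0 (Var V0) (App (App Plus (Var (VS V0))) (monus (Var V0) (Var (VS V0))))))
  by rewrite !satE !arE.
apply: qf_induction y => //.
  by rewrite !satE !arE monusN0 !addE add0r; left.
move=> n; rewrite !satE !arE !addE => -[|].
  (* If the difference is already zero, then [x = n] and the roles switch; otherwise it is the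
     successor of [d], and [d] is the next difference. *)
  have [-> e|] := num_zero_succ (monusN x n).
    by right; rewrite e addr0 [in monusN _ _]addrC monusN_add.
  set d := predN _ => -> e; left.
  by rewrite monusNS {1}e -/d -addrA [1 + d]addrC.
move: (monusN n x) => d e; right.
have -> : (n : num) + 1 = (d + 1) + x by rewrite e -addrA addrC.
by rewrite monusN_add addrC.
Qed.

Lemma num_addI (x y z : num) : x + z = y + z -> x = y.
Proof.
move=> e; have [/(@ltr_add _ _ z)|[//|/(@ltr_add _ _ z)]] := ltr_total x y.
  by rewrite -![add _ _]/(_ + _ : num) e => /ltr_irr.
by rewrite -![add _ _]/(_ + _ : num) e => /ltr_irr.
Qed.

Lemma num_add_eq0 (x y : num) : x + y = 0 -> x = 0.
Proof.
move=> e; have [x0|//] := ltr0 x.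
have := ltr_add y x0; rewrite -![add _ _]/(_ + _ : num) e add0r.
have [y0 /(ltr_trans y0)/ltr_irr //|<- /ltr_irr //] := ltr0 y.
Qed.

Lemma num_mul_eq0 (x y : num) : x * y = 0 -> x = 0 \/ y = 0.
Proof.
move=> e; have [x0|] := ltr0 x; last by left.
have [y0|] := ltr0 y; last by right.
have := ltr_mul y0 x0; rewrite -![mul _ _]/(_ * _ : num) e mul0r.
by move=> /ltr_irr.
Qed.

(** Moves arithmetic of [M] into an ordered field, where [lra] and [field] apply. The last clause
    turns an inequality in [K] back into a difference in [M]. *)
Lemma num_field : exists (K : realFieldType) (i : car M ty0 -> K),
  [/\ i zero_ = 0, i one_ = 1,
      forall x y, i (app (app plus_ x) y) = i x + i y &
      forall x y, i (app (app times_ x) y) = i x * i y] /\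
  [/\ injective i, forall x, 0 <= i x, forall x y, ltr x y <-> i x < i y,
      forall x y, i x < i y -> i x + 1 <= i y &
      [/\ forall x, i (predN x) = Num.max (i x - 1) 0,
          forall x y, i (monusN x y) = Num.max (i x - i y) 0 &
          forall x y, i x <= i y -> exists d, y = app (app plus_ x) d]].
Proof.
have [K [i [i0 i1 iD iM [iI i_ge0]]]] :=
  ordered_field_of_semiring num_addI num_sub num_add_eq0 num_mul_eq0.
exists K, i; split; first by split.
have lt_i x y : ltr x y -> i x < i y.
  move=> xy; rewrite lt_neqAle; apply/andP; split.
    by apply/eqP => /iI e; move: xy; rewrite e => /ltr_irr.
  have [z [e|e]] := num_sub x y; first by rewrite e iD lerDl.
  have [z0|e0] := ltr0 z; last by rewrite e -e0 addr0.
  have := ltr_add y z0; rewrite -![add _ _]/(_ + _ : num) addrC addr0 [z + y]addrC -e.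
  by move=> /(ltr_trans xy)/ltr_irr.
have ltiE x y : ltr x y <-> i x < i y.
  split; first exact: lt_i.
  move=> xy; have [//|[e|/lt_i yx]] := ltr_total x y.
    by move: xy; rewrite e ltxx.
  by have := lt_trans xy yx; rewrite ltxx.
have disc x y : i x < i y -> i x + 1 <= i y.
  move=> /ltiE xy; have [//|] := lerP (i x + 1) (i y).
  rewrite -i1 -iD => /ltiE /ltr_succ[/(ltr_trans xy)/ltr_irr//|e].
  by move: xy; rewrite e => /ltr_irr.
have ipred x : i (predN x) = Num.max (i x - 1) 0.
  have [->|e] := num_zero_succ x.
    by rewrite predN0 i0 sub0r; apply/esym/max_r; rewrite oppr_le0 ler01.
  by rewrite {2}e iD i1 addrK; apply/esym/max_l.
split=> //; split=> // x y; last first.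
  move=> xy; have [z [->|e]] := num_sub x y; first by exists z.
  exists (0 : num); rewrite addE addr0 e; suff -> : z = 0 by rewrite addr0.
  apply: iI; apply/eqP; rewrite [i 0]i0 eq_le i_ge0 andbT.
  by move: xy; rewrite e iD; lra.
have [z [->|->]] := num_sub x y; last first.
  by rewrite addrC monusN_add iD addrK; apply/esym/max_l.
rewrite iD opprD addrA subrr sub0r max_r ?oppr_le0 //.
by rewrite monusN_add0.
Qed.

End Model.

(** * Rationals and reals in a model *)

Section Rationals.
Variable M : structure.
Hypothesis M_normal : normal M.
Hypothesis M_RCA : model M RCA0w.
Variable K : realFieldType.
Variable i : car M ty0 -> K.
Hypothesis i0 : i zero_ = 0.
Hypothesis i1 : i one_ = 1.
Hypothesis iD : forall x y, i (app (app plus_ x) y) = i x + i y.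
Hypothesis iM : forall x y, i (app (app times_ x) y) = i x * i y.
Hypothesis i_inj : injective i.
Hypothesis i_ge0 : forall x, 0 <= i x.
Hypothesis i_lt : forall x y, ltr x y <-> i x < i y.
Hypothesis i_disc : forall x y, i x < i y -> i x + 1 <= i y.
Hypothesis i_pred : forall x, i (predN x) = Num.max (i x - 1) 0.
Hypothesis i_monus : forall x y, i (monusN x y) = Num.max (i x - i y) 0.

Hypothesis i_sub : forall x y, i x <= i y -> exists d, y = app (app plus_ x) d.

Notation N := (car M ty0).
Let satM := satE M_normal.

Hint Rewrite (@eval_lam M M_normal M_RCA) @lift_step @lift_refl @eval_app @eval_var0
  @eval_varS @eval_zero @eval_one @eval_plus @eval_times @eval_rec
  @eval_pred @eval_monus : ev.

Notation succ n := (app (app plus_ n) one_).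

Definition iE := (i0, i1, iD, iM, i_pred, i_monus).

(** * Powers of two, square root and pairing *)

Definition leqN (x y : N) : N := eval (x .: y .: env0 M) (leq_test (Var V0) (Var (VS V0))).
Definition exp2N (x : N) : N := eval (x .: env0 M) (exp2 (Var V0)).
Definition rootN (x : N) : N := eval (x .: env0 M) (root (Var V0)).
Definition fstN (x : N) : N := eval (x .: env0 M) (fst_ (Var V0)).
Definition sndN (x : N) : N := eval (x .: env0 M) (snd_ (Var V0)).
Definition pairN (x y : N) : N := eval (x .: y .: env0 M) (pair_ (Var V0) (Var (VS V0))).

Lemma eval_leq_test G (e : env M G) a b :
  eval e (leq_test a b) = leqN (eval e a) (eval e b).
Proof. by []. Qed.
Lemma eval_exp2 G (e : env M G) a : eval e (exp2 a) = exp2N (eval e a).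
Proof. by []. Qed.
Lemma eval_root G (e : env M G) a : eval e (root a) = rootN (eval e a).
Proof. by []. Qed.
Lemma eval_fst G (e : env M G) a : eval e (fst_ a) = fstN (eval e a).
Proof. by []. Qed.
Lemma eval_snd G (e : env M G) a : eval e (snd_ a) = sndN (eval e a).
Proof. by []. Qed.
Lemma eval_pair G (e : env M G) a b :
  eval e (pair_ a b) = pairN (eval e a) (eval e b).
Proof. by []. Qed.

Hint Rewrite eval_leq_test eval_exp2 eval_root eval_fst eval_snd eval_pair : ev.
Hint Rewrite i0 i1 iD iM i_pred i_monus : iv.
(* [autorewrite] matches syntactically, whereas the matching of ssreflect's
   [rewrite] would unfold the combinator terms. *)
Ltac ev := autorewrite with ev.
Ltac iv := autorewrite with iv.

Lemma i_le (x y : N) : i x < i y + 1 -> i x <= i y.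
Proof. by move=> xy; have [//|/i_disc] := lerP (i x) (i y); lra. Qed.

Lemma i_leq x y : i (leqN x y) = if i x <= i y then 1 else 0.
Proof.
rewrite /leqN /leq_test; ev; iv; case: (lerP (i x) (i y)) => xy.
  by rewrite [Num.max (i x - i y) 0]max_r ?subr_le0 // subr0 max_l ?ler01.
rewrite [Num.max (i x - i y) 0]max_l ?subr_ge0 1?ltW // max_r //.
by have := i_disc xy; lra.
Qed.

Lemma exp2N0 : exp2N zero_ = one_.
Proof. by rewrite /exp2N /exp2 3!eval_app eval_rec (app_rec0 M_normal M_RCA). Qed.

Lemma exp2NS n : i (exp2N (succ n)) = 2 * i (exp2N n).
Proof.
rewrite {1}/exp2N /exp2 3!eval_app (app_recS M_normal M_RCA).
ev.
by rewrite iD -mulr2n mulr_natl; congr (i _ *+ 2).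
Qed.

Lemma exp2N_gt0 n : 0 < i (exp2N n).
Proof.
suff: sat (n .: env0 M) (Lt0 Zero (exp2 (Var V0))).
  by rewrite satM i_lt; ev; rewrite i0.
apply: (qf_induction M_RCA) n => //; first by rewrite satM i_lt; ev; rewrite exp2N0 i0 i1 ltr01.
by move=> n; rewrite !satM !i_lt; ev; rewrite i0 exp2NS; lra.
Qed.

Lemma exp2ND n m : i (exp2N (app (app plus_ n) m)) = i (exp2N n) * i (exp2N m).
Proof.
suff: sat (m .: n .: env0 M) (Eq0 (exp2 (App (App Plus (Var (VS V0))) (Var V0)))
    (App (App Times (exp2 (Var (VS V0)))) (exp2 (Var V0)))).
  by rewrite satM; ev => ->; rewrite iM.
apply: (qf_induction M_RCA) m => //.
  rewrite satM; ev; apply: i_inj; rewrite iM exp2N0 i1 mulr1.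
  by congr (i (exp2N _)); apply: i_inj; rewrite iD i0 addr0.
move=> m; rewrite !satM; ev => e; apply: i_inj.
rewrite iM exp2NS mulrCA -iM -e -exp2NS; congr (i (exp2N _)).
by apply: i_inj; rewrite !iD addrA.
Qed.

(** The precision $2^{-n}$ for a possibly nonstandard [n]. *)
Definition h (n : N) : K := (i (exp2N n))^-1.

Lemma h_gt0 n : 0 < h n.
Proof. by rewrite invr_gt0 exp2N_gt0. Qed.

Lemma h0 : h zero_ = 1.
Proof. by rewrite /h exp2N0 i1 invr1. Qed.

Lemma hD n m : h (app (app plus_ n) m) = h n * h m.
Proof. by rewrite /h exp2ND invfM. Qed.

Lemma h1 : h one_ = 1 / 2.
Proof.
have : h (succ zero_) = 1 / 2 by rewrite /h exp2NS exp2N0 i1 mulr1 div1r.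
by rewrite hD h0 mul1r.
Qed.

Lemma hS n : h (succ n) = h n / 2.
Proof. by rewrite hD h1 mul1r. Qed.

Lemma h_le1 n : h n <= 1.
Proof.
rewrite invf_le1 ?exp2N_gt0 // -i1; apply: i_le.
by rewrite i1; have := exp2N_gt0 n; lra.
Qed.

Lemma h_anti n m : i n <= i m -> h m <= h n.
Proof.
by move=> /i_sub[d ->]; rewrite hD ler_piMr ?h_le1 // ltW ?h_gt0.
Qed.

Lemma rootN0 : rootN zero_ = zero_.
Proof. by rewrite /rootN /root 3!eval_app eval_rec (app_rec0 M_normal M_RCA). Qed.

Lemma rootNS n : i (rootN (succ n)) =
  i (rootN n) + if (i (rootN n) + 1) * (i (rootN n) + 1) <= i n + 1 then 1 else 0.
Proof.
rewrite {1}/rootN /root 3!eval_app (app_recS M_normal M_RCA).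
ev.
by rewrite iD i_leq !iE.
Qed.

Lemma root_bounds n : i (rootN n) * i (rootN n) <= i n < (i (rootN n) + 1) * (i (rootN n) + 1).
Proof.
suff: sat (n .: env0 M) (And
    (leq (App (App Times (root (Var V0))) (root (Var V0))) (Var V0))
    (Lt0 (Var V0) (App (App Times (App (App Plus (root (Var V0))) One))
      (App (App Plus (root (Var V0))) One)))).
  rewrite !satM !i_lt; ev; iv => -[le_ ->]; rewrite andbT.
  by case: le_ => [/ltW //|e]; rewrite -iM e.
apply: (qf_induction M_RCA) n => //.
  rewrite !satM !i_lt; ev; iv; rewrite rootN0 i0; split; last by lra.
  by right; apply: i_inj; rewrite iM i0 mulr0.
move=> n; rewrite !satM !i_lt; ev; iv; rewrite rootNS.
set r := i (rootN n); have r0 : 0 <= r := i_ge0 _.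
move=> [le_ lt_]; have {}le_ : r * r <= i n.
  by case: le_ => [/ltW //|e]; rewrite /r -iM e.
case: (lerP ((r + 1) * (r + 1)) (i n + 1)) => c; rewrite ?addr0; split=> //.
- suff : (r + 1) * (r + 1) <= i (succ n).
    rewrite le_eqVlt => /orP[/eqP e|]; last by rewrite iE i1 => ?; left.
    by right; apply: i_inj; rewrite iM rootNS -/r c e.
  by rewrite iE i1.
- by rewrite (_ : (r + 1 + 1) * _ = (r + 1) * (r + 1) + (2 * r + 3)); [lra|ring].
suff : r * r <= i (succ n).
  rewrite le_eqVlt => /orP[/eqP e|]; last by rewrite iE i1 => ?; left.
  by right; apply: i_inj; rewrite iM rootNS -/r leNgt c /= addr0 e.
by rewrite iE i1; lra.
Qed.

Lemma i_pair x y : i (pairN x y) = (i x + i y) * (i x + i y) + i x.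
Proof. by rewrite /pairN /pair_; ev; iv. Qed.

(** The code $(x+y)^2+x$ lies below $(x+y+1)^2$, so its integer root is the sum, from which both
    components are recovered. *)
Lemma root_pair x y : i (rootN (pairN x y)) = i x + i y.
Proof.
have /andP[] := root_bounds (pairN x y); rewrite i_pair.
set r := i _; have r0 : 0 <= r := i_ge0 _.
have x0 := i_ge0 x; have y0 := i_ge0 y => le_ lt_.
apply/eqP; rewrite eq_le -iD; apply/andP; split; apply: i_le; rewrite -/r iD.
  rewrite ltNge; apply/negP => c.
  have : (i x + i y + 1) * (i x + i y + 1) <= r * r by apply: ler_pM => //; lra.
  by lra.
rewrite ltNge; apply/negP => c.
have : (r + 1) * (r + 1) <= (i x + i y) * (i x + i y) by apply: ler_pM => //; lra.
by lra.
Qed.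

Lemma fst_pair x y : fstN (pairN x y) = x.
Proof.
apply: i_inj; rewrite /fstN /fst_; ev; iv; rewrite root_pair i_pair.
by rewrite addrAC subrr add0r max_l.
Qed.

Lemma snd_pair x y : sndN (pairN x y) = y.
Proof.
apply: i_inj; rewrite /sndN /snd_; ev; iv; rewrite root_pair.
by rewrite fst_pair addrAC subrr add0r max_l.
Qed.

(* The rational coded by [q]. *)
Definition V (q : N) : K :=
  (i (fstN (fstN q)) - i (sndN (fstN q))) / (i (sndN q) + 1).

Lemma den_gt0 q : 0 < i (sndN q) + 1.
Proof. by rewrite ltr_pwDr. Qed.

Lemma eval_qmk G (e : env M G) a b c :
  eval e (qmk a b c) = pairN (pairN (eval e a) (eval e b)) (eval e c).
Proof. by []. Qed.

Lemma V_qmk G (e : env M G) a b c :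
  V (eval e (qmk a b c)) = (i (eval e a) - i (eval e b)) / (i (eval e c) + 1).
Proof. by rewrite eval_qmk /V !(fst_pair, snd_pair). Qed.

Lemma eval_qpos G (e : env M G) q : eval e (qpos q) = fstN (fstN (eval e q)).
Proof. by []. Qed.
Lemma eval_qneg G (e : env M G) q : eval e (qneg q) = sndN (fstN (eval e q)).
Proof. by []. Qed.
Lemma eval_qden G (e : env M G) q : eval e (qden q) = sndN (eval e q).
Proof. by []. Qed.

Hint Rewrite eval_qmk eval_qpos eval_qneg eval_qden : ev.

Lemma V_qadd G (e : env M G) q r :
  V (eval e (qadd q r)) = V (eval e q) + V (eval e r).
Proof.
rewrite V_qmk; ev; iv.
have := den_gt0 (eval e q); have := den_gt0 (eval e r); rewrite /V.
set d := i (sndN _) + 1; set d' := i (sndN (eval e q)) + 1 => d0 d0'.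
(* The product of the denominators is at least 1, so the truncated predecessor stored in the code is
   exact. *)
have /i_disc : i zero_ < i (app (app times_ (succ (sndN (eval e q)))) (succ (sndN (eval e r)))).
  by iv; rewrite mulr_gt0.
iv => ge1; rewrite max_l; last by rewrite subr_ge0 -[leLHS]add0r.
by rewrite subrK -/d -/d'; field; rewrite !gt_eqF.
Qed.

Lemma V_qopp G (e : env M G) q : V (eval e (qopp q)) = - V (eval e q).
Proof. by rewrite V_qmk; ev; rewrite /V -mulNr opprB. Qed.

Lemma V_qsub G (e : env M G) q r :
  V (eval e (qsub q r)) = V (eval e q) - V (eval e r).
Proof. by rewrite V_qadd V_qopp. Qed.

Lemma V_qabs G (e : env M G) q : V (eval e (qabs q)) = `|V (eval e q)|.
Proof.
rewrite V_qmk; ev; iv; rewrite /V.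
have d0 := den_gt0 (eval e q); set d := _ + 1 in d0 *.
move: (i (fstN _)) (i (sndN (fstN _))) => p n; rewrite subr0.
have -> : `|(p - n) / d| = `|p - n| / d by rewrite normf_div [`|d|]gtr0_norm.
congr (_ / _); case: (lerP p n) => c.
  rewrite (max_r (x := p - n)) ?subr_le0 //.
  by rewrite max_l ?subr_ge0 // add0r.
rewrite (max_l (x := p - n)) ?subr_ge0 1?ltW //.
by rewrite max_r ?addr0 // subr_le0 ltW.
Qed.

Lemma V_qdyad G (e : env M G) a n :
  V (eval e (qdyad a n)) = i (eval e a) * h (eval e n).
Proof.
rewrite V_qmk; ev; iv; rewrite subr0 max_l; first by rewrite subrK.
rewrite subr_ge0; have := @i_disc zero_ (exp2N (eval e n)).
by rewrite i0 add0r; apply; apply: exp2N_gt0.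
Qed.

Lemma sat_qlt G (e : env M G) q r :
  sat e (qlt q r) = (V (eval e q) < V (eval e r)) :> Prop.
Proof.
rewrite /qlt satM; apply/propext; rewrite i_lt.
ev; iv; rewrite /V.
rewrite ltr_pdivrMr ?den_gt0 // mulrAC ltr_pdivlMr ?den_gt0 // !mulrBl.
by rewrite ltrBlDr addrAC ltrBrDr.
Qed.

Lemma sat_qle G (e : env M G) q r :
  sat e (qle q r) = (V (eval e q) <= V (eval e r)) :> Prop.
Proof.
rewrite /qle satM; apply/propext; rewrite i_lt.
set a := eval e _; set b := eval e _.
have -> : (i a < i b \/ a = b) <-> i a <= i b.
  rewrite le_eqVlt; split=> [[->|->]|/orP[/eqP/i_inj|]]; rewrite ?eqxx ?orbT //.
    by right.
  by left.
rewrite {}/a {}/b; ev; iv; rewrite /V.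
rewrite ler_pdivrMr ?den_gt0 // mulrAC ler_pdivlMr ?den_gt0 // !mulrBl.
by rewrite lerBlDr addrAC lerBrDr.
Qed.

Hint Rewrite V_qadd V_qopp V_qsub V_qabs V_qdyad : ev.

Lemma V_pair a b c : V (pairN (pairN a b) c) = (i a - i b) / (i c + 1).
Proof. by rewrite /V !(fst_pair, snd_pair). Qed.

Hint Rewrite V_pair : ev.

(** * Reals and their order, evaluated in the field *)

Notation ap x n := (V (app x n)).

Definition is_real (x : car M ty1) : Prop :=
  forall n j, `|ap x n - ap x (app (app plus_ n) j)| < h n.

(** The bounds are the negations of [lt_real] against 0 and 1, taken at every precision. *)
Definition is_unit (x : car M ty1) : Prop :=
  is_real x /\ forall n, - (2 * h n) <= ap x n <= 1 + 2 * h n.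

Definition lt_real (x y : car M ty1) : Prop := exists n, ap x n + 2 * h n < ap y n.

Lemma i2 : i (succ one_) = 2.
Proof. by rewrite iD i1. Qed.

Hint Rewrite i2 : iv.

Lemma sat_real G (e : env M G) x : sat e (real x) <-> is_real (eval e x).
Proof.
rewrite /real sat_all; split=> H n; have := H n; rewrite sat_all => {}H j.
  by have := H j; rewrite sat_qlt; ev; iv; rewrite mul1r.
by have := H j; rewrite sat_qlt; ev; iv; rewrite mul1r.
Qed.

Lemma sat_rlt G (e : env M G) x y :
  sat e (rlt x y) <-> lt_real (eval e x) (eval e y).
Proof.
by rewrite /rlt sat_ex; split=> -[n Hn]; exists n; move: Hn; rewrite sat_qlt; ev; iv.
Qed.

Lemma sat_rle G (e : env M G) x y :
  sat e (rle x y) <-> ~ lt_real (eval e y) (eval e x).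
Proof. by rewrite /rle sat_imp sat_bot sat_rlt. Qed.

Lemma sat_req G (e : env M G) x y :
  sat e (req x y) <-> forall n, `|ap (eval e x) n - ap (eval e y) n| <= 2 * h n.
Proof.
by rewrite /req sat_all; split=> H n; have := H n; rewrite sat_qle; ev; iv.
Qed.

Lemma ap_rzero G (e : env M G) n : V (app (eval e rzero) n) = 0.
Proof. by rewrite /rzero; ev; iv; rewrite subrr mul0r. Qed.

Lemma ap_rone G (e : env M G) n : V (app (eval e rone) n) = 1.
Proof. by rewrite /rone; ev; iv; rewrite subr0 add0r divr1. Qed.

Lemma ap_radd G (e : env M G) x y n :
  V (app (eval e (radd x y)) n) = ap (eval e x) (succ n) + ap (eval e y) (succ n).
Proof. by rewrite /radd; ev. Qed.

Lemma ap_ropp G (e : env M G) x n : V (app (eval e (ropp x)) n) = - ap (eval e x) n.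
Proof. by rewrite /ropp; ev. Qed.

Lemma ap_rsub G (e : env M G) x y n :
  V (app (eval e (rsub x y)) n) = ap (eval e x) (succ n) - ap (eval e y) (succ n).
Proof. by rewrite /rsub ap_radd ap_ropp. Qed.

Lemma ap_rabs G (e : env M G) x n : V (app (eval e (rabs x)) n) = `|ap (eval e x) n|.
Proof. by rewrite /rabs; ev. Qed.

Hint Rewrite ap_rzero ap_rone ap_radd ap_ropp ap_rsub ap_rabs : ev.

Lemma sat_posreal G (e : env M G) x : sat e (posreal x) <->
  is_real (eval e x) /\ exists n, 2 * h n < ap (eval e x) n.
Proof.
rewrite /posreal sat_and sat_real sat_rlt.
by split=> -[xr [n hn]]; split=> //; exists n; move: hn; ev; rewrite add0r.
Qed.

Lemma sat_unit G (e : env M G) x : sat e (unit_interval x) <-> is_unit (eval e x).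
Proof.
rewrite /unit_interval !sat_and sat_real !sat_rle /is_unit.
split=> [[xr [x0 x1]]|[xr H]]; split=> //.
  move=> n; apply/andP; split; rewrite leNgt; apply/negP => c.
    by apply: x0; exists n; ev; move: c; lra.
  by apply: x1; exists n; ev; move: c; lra.
by split=> -[n]; ev; have /andP[] := H n; lra.
Qed.

(** * Case distinctions, clipping and maxima as terms *)

Definition cond {G} (t a b : tm G ty0) : tm G ty0 := (t * a + monus 1 t * b)%tm.
Definition condN (t a b : N) : N :=
  eval (t .: a .: b .: env0 M) (cond (Var V0) (Var (VS V0)) (Var (VS (VS V0)))).

Lemma eval_cond G (e : env M G) t a b :
  eval e (cond t a b) = condN (eval e t) (eval e a) (eval e b).
Proof. by []. Qed.

Lemma condN1 t a b : i t = 1 -> condN t a b = a.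
Proof.
move=> t1; apply: i_inj; rewrite /condN /cond; ev; iv.
by rewrite t1 subrr max_l // mul1r mul0r addr0.
Qed.

Lemma condN0 t a b : i t = 0 -> condN t a b = b.
Proof.
move=> t1; apply: i_inj; rewrite /condN /cond; ev; iv.
by rewrite t1 subr0 max_l ?ler01 // mul0r mul1r add0r.
Qed.

Definition eq_test {G} (a b : tm G ty0) : tm G ty0 := (leq_test a b * leq_test b a)%tm.
Definition eqN (a b : N) : N := eval (a .: b .: env0 M) (eq_test (Var V0) (Var (VS V0))).

Lemma eval_eq_test G (e : env M G) a b :
  eval e (eq_test a b) = eqN (eval e a) (eval e b).
Proof. by rewrite /eqN /eq_test; ev. Qed.

Lemma i_eq a b : i (eqN a b) = if pselect (a = b) then 1 else 0.
Proof.
rewrite /eqN /eq_test; ev; iv; rewrite !i_leq.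
case: pselect => [ab|ab] /=; first by rewrite ab lexx mulr1.
case: (ltrgtP (i a) (i b)) => [||/i_inj //]; by rewrite ?mul0r ?mulr0.
Qed.

Definition lt_test {G} (q r : tm G ty0) : tm G ty0 :=
  leq_test (qpos q * (qden r + 1) + qneg r * (qden q + 1) + 1)
    (qpos r * (qden q + 1) + qneg q * (qden r + 1))%tm.
Definition ltN (a b : N) : N := eval (a .: b .: env0 M) (lt_test (Var V0) (Var (VS V0))).

Lemma eval_lt_test G (e : env M G) a b :
  eval e (lt_test a b) = ltN (eval e a) (eval e b).
Proof. by rewrite /ltN /lt_test; ev. Qed.

Lemma i_ltN a b : i (ltN a b) = if V a < V b then 1 else 0.
Proof.
have /propeqP := sat_qlt (a .: b .: env0 M) (Var V0) (Var (VS V0)).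
rewrite /qlt satM i_lt /ltN /lt_test; ev; rewrite i_leq [i (succ _)]iD i1 => -[lt1 lt2].
congr (if _ then _ else _); apply/idP/idP => [ab|/lt2/i_disc//].
by apply: lt1; apply: lt_le_trans ab; rewrite ltrDl.
Qed.

Definition clip (r : K) : K := Num.min (Num.max r 0) 1.

Lemma clipP r : [\/ r <= 0 /\ clip r = 0, (0 <= r /\ r <= 1) /\ clip r = r |
  1 <= r /\ clip r = 1].
Proof.
rewrite /clip; have [r0|/ltW r0] := lerP r 0.
  by apply: Or31; split=> //; rewrite min_l.
have [r1|/ltW r1] := lerP r 1; first by apply: Or32.
by apply: Or33.
Qed.

Lemma clip01 r : 0 <= clip r /\ clip r <= 1.
Proof. by case: (clipP r) => -[? ->]; lra. Qed.

Lemma clip_lip r s : `|clip r - clip s| <= `|r - s|.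
Proof.
suff H a b : a <= b -> `|clip a - clip b| <= b - a.
  have [rs|/ltW sr] := lerP r s; first exact: H.
  by rewrite distrC; apply: H.
move=> ab; rewrite ler_norml.
by case: (clipP a) => -[? ->]; case: (clipP b) => -[? ->]; lra.
Qed.

Lemma clip_near r d : - d <= r -> r <= 1 + d -> 0 <= d -> `|clip r - r| <= d.
Proof. by rewrite ler_norml; case: (clipP r) => -[? ->]; lra. Qed.

Lemma max_div0 (r d : K) : 0 < d -> Num.max r 0 / d = Num.max (r / d) 0.
Proof.
move=> d0; case: (lerP r 0) => c; first by rewrite mul0r max_r // pmulr_lle0 ?invr_gt0.
by rewrite max_l // divr_ge0 // ltW.
Qed.

(** With $m$ the truncated numerator, $d$ the denominator and truncated subtraction,
    $m-(m-d)=\min(m,d)$. *)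
Definition qclip {G} (q : tm G ty0) : tm G ty0 :=
  qmk (monus (monus (qpos q) (qneg q)) (monus (monus (qpos q) (qneg q)) (qden q + 1)))
    0 (qden q).

Lemma V_qclip G (e : env M G) q : V (eval e (qclip q)) = clip (V (eval e q)).
Proof.
rewrite V_qmk; ev; iv; rewrite /V /clip.
have d0 := den_gt0 (eval e q); set d := _ + 1 in d0 *.
rewrite -[Num.max (_ / d) 0]max_div0 //.
have : 0 <= Num.max (i (fstN (fstN (eval e q))) - i (sndN (fstN (eval e q)))) 0.
  by rewrite le_max lexx orbT.
move: (Num.max (i (fstN _) - i (sndN (fstN _))) 0) => m m0.
rewrite subr0; case: (lerP (m - d) 0) => c.
  have md : m / d <= 1 by rewrite ler_pdivrMr // mul1r -subr_le0.
  by rewrite subr0 min_l // max_l.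
have md : 1 <= m / d by rewrite ler_pdivlMr // mul1r -subr_ge0 ltW.
by rewrite opprB addrC subrK max_l ?ltW // divff ?gt_eqF // min_r.
Qed.

Definition qpart {G} (q : tm G ty0) : tm G ty0 :=
  qmk (monus (qpos q) (qneg q)) 0 (qden q).

Lemma V_qpart G (e : env M G) q : V (eval e (qpart q)) = Num.max (V (eval e q)) 0.
Proof.
rewrite V_qmk; ev; iv; rewrite /V subr0.
by rewrite max_div0 // den_gt0.
Qed.

Definition qmax {G} (q r : tm G ty0) : tm G ty0 := qadd q (qpart (qsub r q)).

Lemma V_qmax G (e : env M G) q r :
  V (eval e (qmax q r)) = Num.max (V (eval e q)) (V (eval e r)).
Proof.
rewrite /qmax V_qadd V_qpart V_qsub.
move: (V _) (V _) => a b.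
by case: (lerP (a - b) 0) => ?; case: (lerP b a) => ?; lra.
Qed.

Definition qscale {G} (t q : tm G ty0) : tm G ty0 :=
  qmk (t * qpos q) (t * qneg q) (qden q).

Lemma V_qscale G (e : env M G) t q :
  V (eval e (qscale t q)) = i (eval e t) * V (eval e q).
Proof. by rewrite V_qmk; ev; iv; rewrite -mulrBr -mulrA. Qed.

Hint Rewrite eval_cond eval_eq_test eval_lt_test V_qclip V_qmax V_qscale : ev.

Notation v0 := (Var V0).
Notation v1 := (Var (VS V0)).
Notation v2 := (Var (VS (VS V0))).
Notation v3 := (Var (VS (VS (VS V0)))).
Notation v4 := (Var (VS (VS (VS (VS V0))))).
Notation v5 := (Var (VS (VS (VS (VS (VS V0)))))).
Notation v6 := (Var (VS (VS (VS (VS (VS (VS V0))))))).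
Notation qzero := (qmk 0 0 0)%tm.

Lemma addN0 (n : N) : app (app plus_ n) zero_ = n.
Proof. by apply: i_inj; rewrite iD i0 addr0. Qed.

Lemma addNS (n m : N) : app (app plus_ n) (succ m) = succ (app (app plus_ n) m).
Proof. by apply: i_inj; rewrite !iD addrA. Qed.

Lemma real_near x n m : is_real x -> i n <= i m -> `|ap x n - ap x m| < h n.
Proof. by move=> xr /i_sub[d ->]. Qed.

Lemma real_diff x n m : is_real x -> `|ap x n - ap x m| < h n + h m.
Proof.
move=> xr; have [nm|/ltW mn] := lerP (i n) (i m).
  by apply: lt_trans (real_near xr nm) _; rewrite ltrDl h_gt0.
by rewrite distrC; apply: lt_trans (real_near xr mn) _; rewrite ltrDr h_gt0.
Qed.

(** Steps of size [h (n + 2)] telescope to the closed bound [h (n + 1) - h (n + 1 + j)], which an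
    internal induction on [j] can state and which is below [h n]. *)
Lemma slow_real x :
  (forall n, `|ap x n - ap x (succ n)| <= h (succ (succ n))) -> is_real x.
Proof.
move=> slow n j.
have H : `|ap x n - ap x (app (app plus_ n) j)| <=
    h (succ n) - h (app (app plus_ (succ n)) j).
  suff: sat (j .: n .: x .: env0 M) (qle (qabs (qsub (v2 · v1) (v2 · (v1 + v0))))
    (qsub (qdyad 1 (v1 + 1)) (qdyad 1 (v1 + 1 + v0))))%tm.
    by rewrite sat_qle; ev; iv; rewrite !mul1r.
  apply: (qf_induction M_RCA) j => //.
    by rewrite sat_qle; ev; iv; rewrite !addN0 !subrr normr0.
  move=> j; rewrite !sat_qle; ev; iv; rewrite !mul1r !addNS !(hD, h1) => IH.
  have := slow (app (app plus_ n) j); rewrite !(hD, h1) => {}slow.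
  apply: le_trans (ler_distD (ap x (app (app plus_ n) j)) _ _) _.
  by move: IH slow; lra.
apply: le_lt_trans H _.
have := h_gt0 (app (app plus_ (succ n)) j); have := h_gt0 n.
by rewrite hS; lra.
Qed.

(** An invariant for recursions of possibly nonstandard length. The bound is the value of a code
    [b], not any element of [K], since the induction formula must name it; the lemmas on the net
    inherit this form. *)
Lemma rec_le f z b : V z <= V b ->
  (forall k r, V r <= V b -> V (app (app f k) r) <= V b) ->
  forall j, V (app (app (app rec_ f) z) j) <= V b.
Proof.
move=> zb fb j.
suff: sat (j .: b .: z .: f .: env0 M) (qle (Rec · v3 · v2 · v0) v1)%tm.
  by rewrite sat_qle; ev.
apply: (qf_induction M_RCA) j => //.
  by rewrite sat_qle; ev; rewrite (app_rec0 M_normal M_RCA).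
by move=> j; rewrite !sat_qle; ev; rewrite (app_recS M_normal M_RCA); apply: fb.
Qed.

Lemma rec_ge f z : (forall k r, V r <= V (app (app f k) r)) ->
  forall j, V z <= V (app (app (app rec_ f) z) j).
Proof.
move=> fb j.
suff: sat (j .: z .: f .: env0 M) (qle v1 (Rec · v2 · v1 · v0))%tm.
  by rewrite sat_qle; ev.
apply: (qf_induction M_RCA) j => //.
  by rewrite sat_qle; ev; rewrite (app_rec0 M_normal M_RCA).
move=> j; rewrite !sat_qle; ev; rewrite (app_recS M_normal M_RCA) => IH.
exact: le_trans IH (fb _ _).
Qed.

(** Step [k] lifts the value to at least [V b], and later steps never lower it. *)
Lemma rec_ge_at f z b k : (forall k r, V r <= V (app (app f k) r)) ->
  (forall r, V b <= V (app (app f k) r)) ->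
  forall j, i k < i j -> V b <= V (app (app (app rec_ f) z) j).
Proof.
move=> fm fk j.
suff: sat (j .: k .: b .: z .: f .: env0 M)
    (Imp (Lt0 v1 v0) (qle v2 (Rec · v4 · v3 · v0))%tm).
  by rewrite sat_imp sat_lt0 i_lt sat_qle; ev.
apply: (qf_induction M_RCA) j => //.
  by rewrite sat_imp sat_lt0 i_lt sat_qle; ev; rewrite i0 ltNge i_ge0.
move=> j; rewrite !sat_imp !sat_lt0 !i_lt !sat_qle; ev => IH.
rewrite (app_recS M_normal M_RCA) iD i1 => /i_le; rewrite le_eqVlt.
by move=> /orP[/eqP/i_inj <- //|/IH kj]; apply: le_trans kj (fm _ _).
Qed.

Lemma rec_close f f' z b : 0 <= V b ->
  (forall k r r', `|V r - V r'| <= V b ->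
     `|V (app (app f k) r) - V (app (app f' k) r')| <= V b) ->
  forall j, `|V (app (app (app rec_ f) z) j) - V (app (app (app rec_ f') z) j)| <= V b.
Proof.
move=> b0 fb j.
suff: sat (j .: b .: z .: f' .: f .: env0 M)
    (qle (qabs (qsub (Rec · v4 · v2 · v0) (Rec · v3 · v2 · v0))) v1)%tm.
  by rewrite sat_qle; ev.
apply: (qf_induction M_RCA) j => //.
  by rewrite sat_qle; ev; rewrite !(app_rec0 M_normal M_RCA) subrr normr0.
by move=> j; rewrite !sat_qle; ev; rewrite !(app_recS M_normal M_RCA); apply: fb.
Qed.

Definition clipN (q : N) : N := eval (q .: env0 M) (qclip v0).

Lemma eval_qclip G (e : env M G) q : eval e (qclip q) = clipN (eval e q).
Proof. by rewrite /clipN /qclip; ev. Qed.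

Lemma V_clipN q : V (clipN q) = clip (V q).
Proof. by rewrite /clipN; ev. Qed.

Hint Rewrite eval_qclip V_clipN : ev.

(* [nrmM x] is a real in [0,1] for every [x], and equal to [x] when [x] already
   is one: a term is only accepted if it is close enough to the previous one. *)
Definition nrmM : car M (ty1 ⇒ ty1)%ty := eval (env0 M)
  (LAM x : ty1, Rec ·
    (LAM k : ty0, LAM z : ty0,
      cond (lt_test (qabs (qsub (qclip (↑x · (↑k + 1 + 1 + 1))) z)) (qdyad 1 (↑k + 1 + 1)))
        (qclip (↑x · (↑k + 1 + 1 + 1))) z) ·
    (qclip (x · (1 + 1))))%tm.

Notation nrm x := (app nrmM x).

Lemma nrm_rec x : exists2 f, nrm x = app (app rec_ f) (clipN (app x (succ one_))) &
  forall k z, app (app f k) z =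
    if `|clip (ap x (succ (succ (succ k)))) - V z| < h (succ (succ k))
    then clipN (app x (succ (succ (succ k)))) else z.
Proof.
eexists; first by rewrite /nrmM; ev.
move=> k z; ev.
case: ifP => c; [apply: condN1|apply: condN0]; rewrite i_ltN; ev; iv.
  by move: c; ev; rewrite mul1r => ->.
by move: c; ev; rewrite mul1r => ->.
Qed.

Lemma nrm_step x n : `|ap (nrm x) n - ap (nrm x) (succ n)| <= h (succ (succ n)).
Proof.
have [f -> fE] := nrm_rec x; rewrite (app_recS M_normal M_RCA) fE.
by case: ifP => c; [rewrite V_clipN distrC ltW|rewrite subrr normr0 ltW ?h_gt0].
Qed.

Lemma nrm01 x n : 0 <= ap (nrm x) n /\ ap (nrm x) n <= 1.
Proof.
have Cb y : 0 <= V (clipN y) /\ V (clipN y) <= 1 by rewrite V_clipN; apply: clip01.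
have [f -> fE] := nrm_rec x.
suff: sat (n .: f .: app x (succ one_) .: env0 M)
    (And (qle (qmk 0 0 0) (Rec · v1 · qclip v2 · v0))
      (qle (Rec · v1 · qclip v2 · v0) (qmk 1 0 0)))%tm.
  by rewrite sat_and !sat_qle; ev; iv; rewrite !subr0 mul0r add0r divr1.
apply: (qf_induction M_RCA) n => //.
  rewrite sat_and !sat_qle; ev; iv; rewrite !subr0 mul0r add0r divr1.
  by rewrite !(app_rec0 M_normal M_RCA).
move=> n; rewrite !sat_and !sat_qle; ev; iv; rewrite !subr0 mul0r add0r divr1.
by rewrite !(app_recS M_normal M_RCA) fE; case: ifP.
Qed.

Lemma nrm_unit x : is_unit (nrm x).
Proof.
split=> [|n]; first exact/slow_real/nrm_step.
by have := h_gt0 n; have := nrm01 x n; lra.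
Qed.

(** The terms of a real at [n + 2] and [n + 3] differ by less than [h (n + 2)], exactly the
    tolerance of [nrmM], so every candidate is accepted. The shift by two makes the accepted jumps
    fit [slow_real]. *)
Lemma nrm_id x n : is_real x -> app (nrm x) n = clipN (app x (succ (succ n))).
Proof.
move=> xr; have [f -> fE] := nrm_rec x.
suff: sat (n .: f .: x .: env0 M)
    (Eq0 (Rec · v1 · qclip (v2 · (1 + 1)) · v0) (qclip (v2 · (v0 + 1 + 1))))%tm.
  by rewrite satM; ev.
apply: (qf_induction M_RCA) n => //.
  rewrite satM; ev; rewrite (app_rec0 M_normal M_RCA); congr (clipN (app x _)).
  by apply: i_inj; iv; lra.
move=> n; rewrite !satM; ev => IH; rewrite (app_recS M_normal M_RCA) fE IH.
rewrite ifT // V_clipN; apply: le_lt_trans (clip_lip _ _) _; rewrite distrC.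
by apply: real_near => //; iv; lra.
Qed.

(** * The net of tent functions *)

Section Net.
(* [Y x] is the exponent of a radius below the value of the cover at [nrm x]. *)
Variable Y : car M ty2.

(* The rational interval attached to [x]: its centre and radius exponent. *)
Definition codeM : car M (ty1 ⇒ ty0)%ty := eval (nrmM .: Y .: env0 M)
  (LAM x : ty1, pair_ (v1 · x · (v2 · x + 1 + 1)) (v2 · x))%tm.

Notation code x := (app codeM x).

Lemma codeE x : code x = pairN (app (nrm x) (succ (succ (app Y x)))) (app Y x).
Proof. by rewrite /codeM; ev. Qed.

(** Columns are read one place later than the pairing says, because [d] at zero holds the bound on
    the codes. *)
Definition colM : car M (ty1 ⇒ ty0 ⇒ ty1)%ty := eval (env0 M)
  (LAM d : ty1, LAM k : ty0, LAM n : ty0, ↑d · (pair_ (↑k) n + 1))%tm.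

Notation col d k := (app (app colM d) k).

Lemma colE d k n : app (col d k) n = app d (succ (pairN k n)).
Proof. by rewrite /colM; ev. Qed.

(* [d] is read as the finite set of those [k] below its first value for which
   the [k]-th column of [d] witnesses that [k] is the code of some interval. *)
Definition active (d : car M ty1) (k : N) : Prop :=
  i k < i (app d zero_) /\ code (col d k) = k.

Definition actM : car M (ty1 ⇒ ty0 ⇒ ty0)%ty := eval (codeM .: colM .: env0 M)
  (LAM d : ty1, LAM k : ty0,
    leq_test (k + 1) (↑d · 0) * eq_test (v2 · (v3 · ↑d · k)) k)%tm.

Notation act d k := (app (app actM d) k).

Lemma act_cases d k : (active d k /\ i (act d k) = 1) \/ (~ active d k /\ i (act d k) = 0).
Proof.
have -> : i (act d k) = (if i k + 1 <= i (app d zero_) then 1 else 0) *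
    (if pselect (code (col d k) = k) then 1 else 0).
  by rewrite /actM; ev; iv; rewrite i_leq i_eq; iv.
rewrite /active; case: pselect => [c|c] /=; last by right; split; [case|rewrite mulr0].
case: (lerP (i k + 1) (i (app d zero_))) => b.
  left; split; last by rewrite mulr1.
  by split=> //; move: b; lra.
by right; split=> [[/i_disc]|]; [rewrite leNgt b|rewrite mul0r].
Qed.

(* Inclusion between the sets of active codes. *)
Definition subM : car M (ty1 ⇒ ty1 ⇒ ty0)%ty := eval (actM .: env0 M)
  (LAM d : ty1, LAM e : ty1, monus 1 (lt_test qzero
    (Rec · (LAM k : ty0, LAM r : ty0,
        qmax r (qmk (monus 1 (leq_test (v4 · ↑d · ↑k) (v4 · ↑e · ↑k))) 0 0)) ·
      qzero · (↑d · 0))))%tm.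

Notation sub d e := (app (app subM d) e).
Notation q0 := (pairN (pairN zero_ zero_) zero_).

Lemma V_q0 : V q0 = 0.
Proof. by rewrite V_pair i0 subrr mul0r. Qed.

Lemma sub_rec d e : exists2 f,
  sub d e = monusN one_ (ltN q0 (app (app (app rec_ f) q0) (app d zero_))) &
  forall k r, V (app (app f k) r) =
    Num.max (V r) (if i (act d k) <= i (act e k) then 0 else 1).
Proof.
eexists; first by rewrite /subM; ev.
move=> k r; ev; iv; rewrite i_leq subr0 add0r divr1; congr (Num.max _ _).
by case: ifP => _; rewrite ?subrr ?subr0 maxxx || rewrite subr0 max_l ?ler01.
Qed.

Lemma act_le d e k : i (act d k) <= i (act e k) <-> (active d k -> active e k).
Proof.
have [[dk ->]|[dk ->]] := act_cases d k; have [[ek ->]|[ek ->]] := act_cases e k;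
  by split=> //; rewrite ?ler10 ?ler01 ?lexx //; move=> /(_ dk).
Qed.

Lemma i_sub01 d e : i (sub d e) <= 1.
Proof.
have [f -> _] := sub_rec d e; iv; rewrite i_ltN.
by case: ifP => _; rewrite ?subrr ?subr0 ?maxxx ?ler01 // max_l ?ler01.
Qed.

(** The recursion takes the maximum of the indicators that [k] is active in [d] but not in [e].
    Searching below [d] at zero suffices, as no larger code is active in [d]; rational values allow
    reuse of the recursion lemmas. *)
Lemma subP d e : sub d e = one_ <-> forall k, active d k -> active e k.
Proof.
have [f -> fE] := sub_rec d e.
have fm k r : V r <= V (app (app f k) r) by rewrite fE le_max lexx.
set R := app _ (app d zero_).
have -> : monusN one_ (ltN q0 R) = one_ <-> V R <= V q0.
  have E : i (monusN one_ (ltN q0 R)) = if V q0 < V R then 0 else 1.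
    by iv; rewrite i_ltN; case: ifP => _; rewrite ?subrr ?subr0 ?maxxx // max_l ?ler01.
  split=> [e1|le_]; last by apply: i_inj; rewrite E ltNge le_ i1.
  by move: E; rewrite e1 i1 leNgt; case: ifP => // _ /eqP; rewrite oner_eq0.
split=> [R0 k|H].
  rewrite -act_le; case: (lerP (i (act d k)) (i (act e k))) => // lt_.
  have kd : i k < i (app d zero_).
    by move: lt_; have [[[kd _] _]|[_ ->]] := act_cases d k; rewrite // ltNge i_ge0.
  have := @rec_ge_at f q0 (pairN (pairN one_ zero_) zero_) k fm _ _ kd.
  rewrite -/R V_pair i0 i1 subr0 add0r divr1 => /(_ _)/le_trans/(_ R0).
  rewrite V_q0 ler10; apply=> r.
  by rewrite fE [i (act d k) <= _]leNgt lt_ /= le_max lexx orbT.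
apply: rec_le => // k r; rewrite fE V_q0 => r0.
by have /act_le -> := H k; rewrite ge_max r0 lexx.
Qed.

(* A tent over the interval coded by [k], equal to 1 on its middle half. *)
Definition tentM : car M (ty0 ⇒ ty1 ⇒ ty0 ⇒ ty0)%ty := eval (env0 M)
  (LAM k : ty0, LAM x : ty1, LAM n : ty0,
    qclip (qsub (qmk (1 + 1) 0 0)
      (qscale (exp2 (snd_ (↑k) + 1 + 1))
        (qabs (qsub (qclip (↑x · (n + (snd_ (↑k) + 1 + 1 + 1 + 1)))) (fst_ (↑k)))))))%tm.

Notation tent k x n := (app (app (app tentM k) x) n).
Notation tidx k n := (app (app plus_ n) (succ (succ (succ (succ (sndN k)))))).

(** The tent is 1 up to distance [h / 4] from the centre and 0 from [h / 2] on, at [h = h (sndN k)].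
    The slope [4 / h] is why [tidx] reads that far ahead: it turns the error [h (tidx k n)] into
    [h n / 4]. *)
Lemma tentE k x n : V (tent k x n) =
  clip (2 - 4 / h (sndN k) * `|clip (ap x (tidx k n)) - V (fstN k)|).
Proof.
rewrite /tentM; ev; iv; congr (clip (_ - _ * _)); last first.
  by rewrite -[i _]invrK -/(h _) !(hD, h1); field; rewrite gt_eqF ?h_gt0.
by rewrite subr0 add0r divr1.
Qed.

Definition netM : car M (ty1 ⇒ ty1 ⇒ ty1)%ty := eval (actM .: tentM .: env0 M)
  (LAM d : ty1, LAM x : ty1, LAM n : ty0,
    Rec · (LAM k : ty0, LAM r : ty0,
        qmax r (qscale (v5 · ↑d · ↑k) (v6 · ↑k · ↑x · ↑n))) ·
      qzero · (↑d · 0))%tm.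

Notation net d x := (app (app netM d) x).

Lemma net_rec d x n : exists2 f,
  app (net d x) n = app (app (app rec_ f) q0) (app d zero_) &
  forall k r, V (app (app f k) r) = Num.max (V r) (i (act d k) * V (tent k x n)).
Proof.
eexists; first by rewrite /netM; ev.
by move=> k r; ev.
Qed.

Lemma h_tidx k n : h (tidx k n) = h n * h (sndN k) / 16.
Proof. by rewrite !(hD, h1); field. Qed.

Lemma net_ge0 d x n : 0 <= ap (net d x) n.
Proof.
have [f -> fE] := net_rec d x n; rewrite -V_q0.
by apply: rec_ge => k r; rewrite fE le_max lexx.
Qed.

Lemma net_ge d x n k : active d k -> V (tent k x n) <= ap (net d x) n.
Proof.
move=> dk; have [f -> fE] := net_rec d x n.
apply: (@rec_ge_at f q0 (tent k x n) k) => [l r|r|]; last exact: dk.1.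
  by rewrite fE le_max lexx.
have [[_ a1]|[/(_ dk)//]] := act_cases d k.
by rewrite fE a1 mul1r le_max lexx orbT.
Qed.

Lemma net_le d x n b : 0 <= V b -> (forall k, active d k -> V (tent k x n) <= V b) ->
  ap (net d x) n <= V b.
Proof.
move=> b0 tb; have [f -> fE] := net_rec d x n.
apply: rec_le => [|k r rb]; first by rewrite V_q0.
rewrite fE ge_max rb /=; have [[dk ->]|[_ ->]] := act_cases d k.
  by rewrite mul1r; apply: tb.
by rewrite mul0r.
Qed.

Lemma max_lip (a b c d e : K) : `|a - c| <= e -> `|b - d| <= e ->
  `|Num.max a b - Num.max c d| <= e.
Proof.
rewrite !ler_norml => /andP[? ?] /andP[? ?].
by apply/andP; case: (lerP a b) => ?; case: (lerP c d) => ?; split; lra.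
Qed.

(** Both recursions run through the same codes and a maximum is 1-Lipschitz, so the errors of single
    tents do not add up, however many there are. *)
Lemma net_lip d x y n m b : 0 <= V b ->
  (forall k, active d k -> `|V (tent k x n) - V (tent k y m)| <= V b) ->
  `|ap (net d x) n - ap (net d y) m| <= V b.
Proof.
move=> b0 tb; have [f -> fE] := net_rec d x n; have [g -> gE] := net_rec d y m.
apply: rec_close => // k r r' rr; rewrite fE gE; apply: max_lip => //.
have [[dk ->]|[_ ->]] := act_cases d k; first by rewrite !mul1r; apply: tb.
by rewrite !mul0r subrr normr0.
Qed.

Lemma tent01 k x n : 0 <= V (tent k x n) /\ V (tent k x n) <= 1.
Proof. by rewrite tentE; apply: clip01. Qed.

Lemma tent_lip k x y n m b : `|ap x (tidx k n) - ap y (tidx k m)| <= b ->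
  `|V (tent k x n) - V (tent k y m)| <= 4 / h (sndN k) * b.
Proof.
move=> xy; rewrite !tentE; apply: le_trans (clip_lip _ _) _.
have s0 : 0 <= 4 / h (sndN k) by rewrite divr_ge0 ?ler0n // ltW ?h_gt0.
set s := 4 / _ in s0 *; set u := clip _; set v := clip _; set c := V _.
have -> : 2 - s * `|u - c| - (2 - s * `|v - c|) = s * (`|v - c| - `|u - c|) by ring.
rewrite normrM ger0_norm // ler_wpM2l //.
apply: le_trans (ler_dist_dist _ _) _.
have -> : v - c - (u - c) = v - u by ring.
by rewrite distrC; apply: le_trans (clip_lip _ _) _.
Qed.

Lemma net_le1 d x n : ap (net d x) n <= 1.
Proof.
have V1 : V (pairN (pairN one_ zero_) zero_) = 1.
  by rewrite V_pair i0 i1 subr0 add0r divr1.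
by rewrite -V1; apply: net_le => [|k _]; rewrite V1 ?ler01 //; have [] := tent01 k x n.
Qed.

Lemma net_real d x : is_real x -> is_real (net d x).
Proof.
move=> xr n j.
have Vb : V (eval (n .: env0 M) (qdyad 1 (v0 + 1 + 1))%tm) = h n / 4.
  by ev; iv; rewrite !(hD, h1); field.
have n0 := h_gt0 n.
apply: (@le_lt_trans _ _ (h n / 4)); last by lra.
rewrite -Vb; apply: net_lip => [|k _]; rewrite Vb; first by lra.
have nk : i (tidx k n) <= i (tidx k (app (app plus_ n) j)).
  by iv; have := i_ge0 j; lra.
apply: le_trans (tent_lip (ltW (real_near xr nk))) _.
rewrite h_tidx (_ : 4 / _ * _ = h n / 4) //; field.
by rewrite gt_eqF ?h_gt0.
Qed.

Lemma net_req d x y : (forall n, `|ap x n - ap y n| <= 2 * h n) ->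
  forall n, `|ap (net d x) n - ap (net d y) n| <= 2 * h n.
Proof.
move=> xy n.
have Vb : V (eval (n .: env0 M) (qdyad 1 (v0 + 1))%tm) = h n / 2.
  by ev; iv; rewrite !(hD, h1); field.
have n0 := h_gt0 n.
apply: (@le_trans _ _ (h n / 2)); last by lra.
rewrite -Vb; apply: net_lip => [|k _]; rewrite Vb; first by lra.
apply: le_trans (tent_lip (xy _)) _.
rewrite h_tidx (_ : 4 / _ * _ = h n / 2) //; field.
by rewrite gt_eqF ?h_gt0.
Qed.

Lemma net_mono d e x n : sub d e = one_ -> ap (net d x) n <= ap (net e x) n.
Proof.
move=> /subP de; apply: net_le => [|k /de ek]; first exact: net_ge0.
exact: net_ge.
Qed.

Definition close_real x y r : Prop :=
  exists n, `|ap x (succ n) - ap y (succ n)| + 2 * h n < ap r n.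

Lemma sat_rlt_dist G (e : env M G) x y r :
  sat e (rlt (rabs (rsub x y)) r) <-> close_real (eval e x) (eval e y) (eval e r).
Proof. by rewrite sat_rlt; split=> -[n H]; exists n; move: H; ev. Qed.

(** Carries an inequality seen at one precision to every precision; the slack [2 * h n] absorbs the
    errors of both reals at [succ n]. *)
Lemma close_bound x y p n m : is_real x -> is_real y ->
  `|ap x (succ n) - ap y (succ n)| + 2 * h n < p ->
  `|ap x m - ap y m| <= p + 2 * h m.
Proof.
move=> xr yr; have := real_diff (succ n) m xr; have := real_diff (succ n) m yr.
rewrite !hS; move: (ap x (succ n)) (ap y (succ n)) => xs ys.
rewrite !ltr_norml ler_norml => /andP[? ?] /andP[? ?] xy.
have n0 := h_gt0 n; have : `|xs - ys| < p - 2 * h n by lra.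
by rewrite ltr_norml => /andP[? ?]; apply/andP; split; lra.
Qed.

(** The pairing dominates its components, so [d] at zero bounds all radius exponents. This bounds
    the slopes of all active tents at once. *)
Lemma snd_le_active d k : active d k -> i (sndN k) <= i (app d zero_).
Proof.
move=> [/ltW kd ck]; apply: le_trans kd.
have kE : k = pairN (fstN k) (sndN k) by rewrite -ck codeE fst_pair snd_pair.
have : i k = (i (fstN k) + i (sndN k)) * (i (fstN k) + i (sndN k)) + i (fstN k).
  by rewrite {1}kE i_pair.
have c0 := i_ge0 (fstN k); have s0 := i_ge0 (sndN k).
have s1 : 0 < i (sndN k) -> 1 <= i (sndN k) by rewrite -i0 => /i_disc; rewrite i0 add0r.
move: (i (fstN k)) (i (sndN k)) c0 s0 s1 => c s c0 s0 s1 ->.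
have := mulr_ge0 c0 c0; have := mulr_ge0 c0 s0.
case: (lerP s 0) => [s_le0|/s1 {}s1]; first by nra.
have : s <= s * s by rewrite ler_peMr.
by lra.
Qed.

Lemma net_continuous d x r : is_real x -> is_real r -> (exists n, 2 * h n < ap r n) ->
  exists s, [/\ is_real s, exists n, 2 * h n < ap s n &
    forall y, is_real y -> close_real x y s -> close_real (net d x) (net d y) r].
Proof.
move=> xr rr [n rn]; pose D := app d zero_.
(* All slopes are at most [4 / h D], so a distance of [h D * h n / 8] moves each tent by at most
   [h n / 2]. *)
pose p := app (app plus_ D) (succ (succ (succ n))).
have hp : h p = h D * h n / 8 by rewrite !(hD, h1); field.
pose s := eval (p .: env0 M) (LAM l : ty0, qdyad 1 v1)%tm.
have Es l : ap s l = h p by rewrite /s; ev; iv; rewrite mul1r.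
have p0 := h_gt0 p.
exists s; split.
- by move=> l j; rewrite !Es subrr normr0 h_gt0.
- by exists (succ (succ p)); rewrite Es !hS; lra.
move=> y yr [l]; rewrite Es => xyl.
(* At [m] the real [r] still exceeds [h n - h m = 7/8 * h n], while the movement [h n / 2 + h m / 4]
   and the margin [2 * h m] add up to [25/32 * h n]. *)
pose m := succ (succ (succ n)); exists m.
have hm : h m = h n / 8 by rewrite !(hD, h1); field.
have n0 := h_gt0 n; have D0 := h_gt0 D.
have Vb : V (eval (n .: m .: env0 M) (qadd (qdyad 1 (v0 + 1)) (qdyad 1 (v1 + 1 + 1)))%tm) =
    h n / 2 + h m / 4.
  by ev; iv; rewrite !(hD, h1); field.
have : `|ap (net d x) (succ m) - ap (net d y) (succ m)| <= h n / 2 + h m / 4.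
  rewrite -Vb; apply: net_lip => [|k dk]; rewrite Vb; first by rewrite hm; lra.
  have xyk := close_bound (tidx k (succ m)) xr yr xyl.
  apply: le_trans (tent_lip xyk) _.
  have N0 := h_gt0 (sndN k).
  have DN : h D <= h (sndN k) := h_anti (snd_le_active dk).
  rewrite h_tidx hp [h (succ m)]hS hm.
  have -> : 4 / h (sndN k) * (h D * h n / 8 + 2 * (h n / 8 / 2 * h (sndN k) / 16)) =
    h D / h (sndN k) * (h n / 2) + h n / 8 / 4 by field; rewrite gt_eqF.
  rewrite lerD2r -[leRHS]mul1r ler_wpM2r //; first by lra.
  by rewrite ler_pdivrMr // mul1r.
have := real_diff n m rr; rewrite ltr_norml => /andP[_].
by rewrite hm; lra.
Qed.

(** * Directedness of the indices and pointwise convergence *)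

Lemma sat_mem G (e : env M G) d D : sat e (mem d D) <-> app (eval e D) (eval e d) = one_.
Proof. by rewrite /mem satM; ev. Qed.

Lemma sat_related G (e : env M G) P d d' :
  sat e (related P d d') <-> app (app (eval e P) (eval e d)) (eval e d') = one_.
Proof. by rewrite /related satM; ev. Qed.

Lemma le_one (n : N) : i n <= 1 -> ltr n one_ \/ n = one_.
Proof.
rewrite -i1 le_eqVlt => /orP[/eqP/i_inj|]; first by right.
by left; apply/i_lt.
Qed.

(** Every type 1 object is an index: columns that do not witness their code are simply inactive. *)
Definition allM : car M ty2 := eval (env0 M) (LAM d : ty1, 1)%tm.
Definition constM : car M (ty1 ⇒ ty1)%ty := eval (env0 M) (LAM x : ty1, rone)%tm.

Lemma allE d : app allM d = one_.
Proof. by rewrite /allM; ev. Qed.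

Lemma constE x n : app (app constM x) n = app (eval (x .: env0 M) rone) n.
Proof. by rewrite /constM; ev. Qed.

Lemma ap_const x n : ap (app constM x) n = 1.
Proof. by rewrite constE; ev. Qed.

(** An upper bound of [d] and [e]. The bounds are added, and column [k] comes from [d] if [k] is
    active there, otherwise from [e]. *)
Definition joinM : car M (ty1 ⇒ ty1 ⇒ ty1)%ty := eval (actM .: env0 M)
  (LAM d : ty1, LAM e : ty1, LAM n : ty0,
    cond (leq_test n 0) (↑d · 0 + ↑e · 0)
      (cond (v3 · ↑d · fst_ (pred_ n)) (↑d · n) (↑e · n)))%tm.

Lemma pred_succ (n : N) : predN (succ n) = n.
Proof. by apply: i_inj; rewrite i_pred iD i1 addrK max_l ?i_ge0. Qed.

Lemma join0 d e : app (app (app joinM d) e) zero_ =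
  app (app plus_ (app d zero_)) (app e zero_).
Proof. by rewrite /joinM; ev; apply: condN1; rewrite i_leq lexx. Qed.

Lemma col_join d e k : col (app (app joinM d) e) k =
  if pselect (active d k) then col d k else col e k.
Proof.
apply: (app_ext M_normal) => n; rewrite colE.
rewrite /joinM; ev; rewrite condN0; last first.
  by rewrite i_leq i0 iD i1 leNgt ltr_pwDr ?i_ge0.
rewrite pred_succ fst_pair; case: pselect => dk /=; rewrite colE.
  by apply: condN1; have [[_ ->]|[/(_ dk)]] := act_cases d k.
by apply: condN0; have [[/dk]|[_ ->]] := act_cases d k.
Qed.

Lemma active_join d e k :
  active d k \/ active e k -> active (app (app joinM d) e) k.
Proof.
rewrite {3}/active col_join join0 iD => dek; case: pselect => [dk|dk] /=.
  by split; [apply: lt_le_trans dk.1 _; rewrite lerDl i_ge0|exact: dk.2].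
case: dek => // ek; split; last exact: ek.2.
by apply: lt_le_trans ek.1 _; rewrite lerDr i_ge0.
Qed.

(* The index whose columns are all equal to [x]. *)
Definition pointM : car M (ty1 ⇒ ty1)%ty := eval (codeM .: env0 M)
  (LAM x : ty1, LAM n : ty0,
    cond (leq_test n 0) (v2 · ↑x + 1) (↑x · snd_ (pred_ n)))%tm.

Lemma active_point x : active (app pointM x) (code x).
Proof.
split.
  suff -> : app (app pointM x) zero_ = succ (code x) by rewrite iD i1; lra.
  by rewrite /pointM; ev; apply: condN1; rewrite i_leq lexx.
have -> // : col (app pointM x) (code x) = x.
apply: (app_ext M_normal) => n; rewrite colE /pointM; ev; rewrite condN0.
  by rewrite pred_succ snd_pair.
by rewrite i_leq i0 iD i1 leNgt ltr_pwDr ?i_ge0.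
Qed.

(** The centre is the clipped term of [x] at [N + 4], for [N] the radius exponent. The tent reads
    [x] no earlier, so the distance is at most [h N / 16], and the slope turns it into [1 / 4],
    inside the plateau. *)
Lemma net_point e x n : is_real x -> active e (code x) -> ap (net e x) n = 1.
Proof.
move=> xr ek; apply/eqP; rewrite eq_le net_le1 /=; apply: le_trans (net_ge x n ek).
rewrite tentE codeE fst_pair snd_pair (nrm_id _ xr) V_clipN.
set m := app Y x; have m0 := h_gt0 m.
have near : h m / 16 >=
    `|clip (ap x (tidx (code x) n)) - clip (ap x (succ (succ (succ (succ m)))))|.
  apply: le_trans (clip_lip _ _) _; rewrite distrC codeE snd_pair.
  have <- : h (succ (succ (succ (succ m)))) = h m / 16 by rewrite !(hD, h1); field.
  by apply/ltW/real_near => //; iv; have := i_ge0 n; lra.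
rewrite codeE snd_pair in near; rewrite -/m in near *; set t := `|_| in near *.
have : 4 / h m * t <= 1 / 4.
  have -> : 1 / 4 = 4 / h m * (h m / 16) by field; rewrite gt_eqF.
  by rewrite ler_wpM2l // divr_ge0 ?ler0n // ltW.
by case: (clipP (2 - 4 / h m * t)) => -[? ->]; lra.
Qed.

(** * From uniform convergence to a finite subcover *)

Section Cover.
Variable Psi : car M (ty1 ⇒ ty1)%ty.
Hypothesis Psi_real : forall x, is_real x -> is_real (app Psi x).
Hypothesis Y_radius : forall x, 2 * h (app Y x) < ap (app Psi (nrm x)) (app Y x).

(** A positive tent puts [x] within half the radius [h m] of the centre, and the centre is within a
    quarter of the normalised column; the remainder pays for clipping and rounding. *)
Lemma active_cover d x n k : is_unit x -> active d k -> 0 < V (tent k x n) ->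
  lt_real (eval (nrm (col d k) .: Psi .: env0 M) (rsub v0 (v1 · v0))) x /\
  lt_real x (eval (nrm (col d k) .: Psi .: env0 M) (radd v0 (v1 · v0))).
Proof.
move=> [xr x01] [_ ck]; set y := col d k in ck *.
have [yr _] := nrm_unit y.
rewrite tentE -ck codeE fst_pair snd_pair; set m := app Y y.
set a := app (app plus_ n) (succ (succ (succ (succ m)))); have m0 := h_gt0 m.
have ha : h a = h n * h m / 16 by rewrite /a !(hD, h1); field.
have n1 := h_le1 n; have n0 := h_gt0 n.
have {n1} ha16 : h a <= h m / 16.
  by rewrite ha ler_pM2r ?invr_gt0 ?ltr0n // ler_piMl // ltW.
set c := V (app (nrm y) _) => t0.
have {t0} near : `|clip (ap x a) - c| < h m / 2.
  set t := `|_| in t0 *; have : 0 < 2 - 4 / h m * t.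
    by move: t0; case: (clipP (2 - 4 / h m * t)) => -[? ->]; lra.
  have -> : 4 / h m * t = t * 4 / h m by ring.
  by rewrite subr_gt0 ltr_pdivrMr //; lra.
(* The distance is below [h m] times [1/2 + 1/4 + 1/8 + 1/16 + 1/64]. With the margin
   [2 * h p = h m / 32] it stays below [h m], and the factor 2 in [Y_radius] keeps [Psi] above [h m]
   at [succ p]. *)
pose p := succ (succ (succ (succ (succ (succ m))))).
have hp : h p = h m / 64 by rewrite !(hD, h1); field.
have /andP[xa0 xa1] := x01 a.
have a0 := h_gt0 a.
have clipx : `|clip (ap x a) - ap x a| <= 2 * h a by apply: clip_near => //; lra.
have xap := real_diff a p xr; rewrite hp in xap.
have yc : `|c - ap (nrm y) (succ p)| < h m / 4.
  have <- : h (succ (succ m)) = h m / 4 by rewrite !(hD, h1); field.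
  by apply: real_near => //; rewrite /p; iv; lra.
have Pm : `|ap (app Psi (nrm y)) m - ap (app Psi (nrm y)) (succ p)| < h m.
  by apply: real_near; [apply: Psi_real|rewrite /p; iv; lra].
have Py := Y_radius y; rewrite -/m in Py.
move: near clipx xap yc Pm; rewrite !ltr_norml ler_norml.
move=> /andP[? ?] /andP[? ?] /andP[? ?] /andP[? ?] /andP[? ?].
by split; exists p; ev; rewrite hp; lra.
Qed.

Hypothesis DIN : sat (env0 M) DIN_net.

(** Accuracy 1 suffices, as only positivity of $f_d$ is wanted. Reflexivity of the order allows the
    uniform index itself to be used. *)
Lemma uniform_index : exists d, forall x, is_unit x ->
  close_real (net d x) (app constM x) (eval (env0 M) rone).
Proof.
move: DIN; rewrite /DIN_net sat_all => /(_ allM); rewrite sat_all => /(_ subM).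
rewrite sat_all => /(_ netM); rewrite sat_all => /(_ constM); rewrite !sat_imp.
have subdd d : sub d d = one_ by apply/subP.
move=> H; unshelve epose proof (H _ _ _ _ _) as C; clear H.
- rewrite /directed !sat_and; split; [|split; [|split; [|split; [|split]]]].
  + rewrite /charfun sat_all => d; rewrite satM; ev; rewrite allE; by right.
  + rewrite /charrel sat_all => d; rewrite sat_all => e; rewrite satM; ev.
    exact/le_one/i_sub01.
  + rewrite sat_ex; exists (app pointM (eval (env0 M) rone)).
    by rewrite sat_mem; ev; rewrite allE.
  + rewrite sat_all => x; rewrite sat_all => y; rewrite sat_all => z.
    rewrite !sat_imp !sat_related => _ _ _; ev => /subP xy /subP yz.
    by apply/subP => k /xy /yz.
  + by rewrite sat_all => x; rewrite sat_imp sat_related => _; ev.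
  + rewrite sat_all => x; rewrite sat_all => y; rewrite !sat_imp sat_ex => _ _.
    exists (app (app joinM x) y); rewrite !sat_and sat_mem !sat_related; ev.
    rewrite allE; split=> //.
    by split; apply/subP => k dk; apply: active_join; [left|right].
- rewrite sat_all => d; rewrite sat_imp sat_and => _; split.
  + rewrite /unit_function sat_and; split; rewrite sat_all => x.
      rewrite sat_imp sat_unit sat_real; ev => -[xr _]; exact: net_real.
    rewrite sat_all => y; rewrite !sat_imp !sat_unit !sat_req; ev => _ _.
    exact: net_req.
  rewrite /unit_continuous sat_all => x; rewrite sat_imp sat_unit sat_all; ev => -[xr _] r.
  rewrite sat_imp sat_posreal sat_ex; ev => -[rr r0].
  have [s [sr s0 sP]] := net_continuous d xr rr r0.
  exists s; rewrite sat_and sat_posreal; split; first by ev; split.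
  rewrite sat_all => y; rewrite !sat_imp !sat_rlt_dist sat_unit; ev => -[yr _].
  exact: sP.
- rewrite /increasing sat_all => a; rewrite sat_all => b.
  rewrite !sat_imp !(sat_related, sat_mem); ev => _ _ ab.
  rewrite sat_all => x; rewrite sat_imp sat_rle; ev => _ [n].
  by have := net_mono x n ab; have := h_gt0 n; lra.
- rewrite sat_and; split.
    rewrite /unit_function sat_and; split; rewrite sat_all => x.
      rewrite sat_imp sat_real; ev => _ n j.
      by rewrite !ap_const subrr normr0 h_gt0.
    rewrite sat_all => y; rewrite !sat_imp !sat_unit !sat_req; ev => _ _ _ n.
    by rewrite !ap_const subrr normr0 mulr_ge0 ?ler0n // ltW ?h_gt0.
  rewrite /unit_continuous sat_all => x; rewrite sat_imp sat_unit sat_all; ev => _ r.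
  rewrite sat_imp sat_posreal sat_ex; ev => -[rr [n rn]].
  exists r; rewrite sat_and sat_posreal; split; first by ev; split; last exists n.
  rewrite sat_all => y; rewrite !sat_imp sat_unit !sat_rlt_dist; ev => _ _.
  by exists n; rewrite !ap_const subrr normr0 add0r.
- rewrite /converges sat_all => x; rewrite sat_imp sat_unit sat_all; ev => -[xr _] r.
  rewrite sat_imp sat_posreal sat_ex; ev => -[_ [n rn]].
  (* Any index above this one has the code of [x] active, so its function takes exactly the value 1
     at [x]. *)
  exists (app pointM x); rewrite sat_and sat_mem sat_all; ev; rewrite allE; split=> // e.
  rewrite !sat_imp !(sat_related, sat_mem) sat_rlt_dist; ev => _ /subP/(_ _ (active_point x)) ek.
  by exists n; rewrite ap_const net_point // subrr normr0 add0r.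
move: C; rewrite /converges_uniformly sat_all => /(_ (eval (env0 M) rone)).
rewrite sat_imp sat_posreal sat_ex; ev => -[|d].
  split=> [n j|]; first by ev; rewrite subrr normr0 h_gt0.
  (* Index 2 is the first with [2 * h n < 1]. *)
  by exists (succ (succ zero_)); ev; rewrite !hS h0; lra.
rewrite sat_and sat_all => -[_ dP]; exists d => x xu.
have := dP x; rewrite sat_imp sat_unit sat_all; ev => /(_ xu d).
rewrite !sat_imp !(sat_related, sat_mem) sat_rlt_dist; ev; rewrite allE.
by apply.
Qed.

(** Were all active tents zero at [x], the maximum would be 0, although it is closer to 1 than
    distance 1. *)
Lemma finite_cover : exists d, forall x, is_unit x -> exists2 k, i k < i (app d zero_) &
  lt_real (eval (nrm (col d k) .: Psi .: env0 M) (rsub v0 (v1 · v0))) x /\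
  lt_real x (eval (nrm (col d k) .: Psi .: env0 M) (radd v0 (v1 · v0))).
Proof.
have [d dP] := uniform_index; exists d => x xu; have [n] := dP x xu.
rewrite ap_const; ev => dn.
suff [k dk t0] : exists2 k, active d k & 0 < V (tent k x (succ n)).
  by exists k; [exact: dk.1|apply: active_cover t0].
apply: contrapT => none.
have : ap (net d x) (succ n) <= V q0.
  apply: net_le => [|k dk]; rewrite V_q0 // leNgt; apply/negP => t0.
  by apply: none; exists k.
rewrite V_q0 => net0; move: dn; have := h_gt0 n.
by have := ler_norm (1 - ap (net d x) (succ n)); rewrite distrC; lra.
Qed.

End Cover.

End Net.

Lemma HBU_of_DIN : sat (env0 M) DIN_net -> sat (env0 M) HBU.
Proof.
move=> DIN; rewrite /HBU sat_all => Psi; rewrite sat_imp sat_and => -[].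
rewrite /real_function sat_and !sat_all => -[Pr _] Ppos.
have {}Pr x : is_real x -> is_real (app Psi x).
  by have := Pr x; rewrite sat_imp !sat_real; ev.
have {}Ppos x : is_real x -> exists n, 2 * h n < ap (app Psi x) n.
  move=> xr; have := Ppos x; rewrite sat_imp sat_real sat_rlt; ev.
  by move=> /(_ xr)[n]; ev; rewrite add0r; exists n.
(* Positivity of a real is witnessed by a precision with quantifier-free matrix. Composing [Psi]
   with [nrm] provides such a witness for every type 1 object, as choice demands. *)
pose A : fm [:: ty0; ty1; (ty1 ⇒ ty1)%ty; (ty1 ⇒ ty1)%ty] :=
  qlt (qdyad (1 + 1) v0) (v3 · (v2 · v1) · v0)%tm.
have [|x|Y YP] := @qf_choice M M_RCA _ A (nrmM .: Psi .: env0 M).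
- by [].
- have [n nP] := Ppos _ (nrm_unit x).1.
  by exists n; rewrite /A sat_qlt; ev; iv.
have Yr x : 2 * h (app Y x) < ap (app Psi (nrm x)) (app Y x).
  by move: (YP x); rewrite /A sat_qlt; ev; iv.
have [d dP] := @finite_cover Y Psi Pr Yr DIN.
rewrite sat_ex; exists (app d zero_); rewrite sat_ex.
exists (eval (d .: colM .: nrmM .: env0 M) (LAM k : ty0, v3 · (v2 · v1 · v0))%tm).
rewrite sat_and !sat_all; split=> [k|x].
  by rewrite sat_imp sat_unit => _; ev; apply: nrm_unit.
rewrite sat_imp sat_unit sat_ex; ev => /dP[k kd [kl kr]].
exists k; rewrite !sat_and !sat_rlt sat_lt0 i_lt; ev.
split=> //; split.
  by have [n kn] := kl; exists n; move: kn; ev.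
by have [n kn] := kr; exists n; move: kn; ev.
Qed.

End Rationals.

Theorem theorem3p27 : proves (fun A => RCA0w A \/ A = DIN_net) HBU.
Proof.
apply: completeness => [r t|M M_normal MT]; first by left; apply: RCA_ext.
have M_RCA : model M RCA0w by move=> A ?; apply: MT; left.
have [K [i [[i0 i1 iD iM] [i_inj i_ge0 i_lt i_disc [i_pred i_monus i_sub]]]]] :=
  num_field M_normal M_RCA.
apply: (HBU_of_DIN M_normal M_RCA i0 i1 iD iM i_inj i_ge0 i_lt i_disc i_pred i_monus i_sub).
by apply: MT; right.
Qed.
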